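(* Consider an equation of the form $u_{12}=F(u)$ with $F_u\ne0$, where $u=u(x)$, $x=(x_1,x_2)$, $u_{12}=\partial^2u/\partial x_1\partial x_2$ and $F$ is a smooth function of $u$. Up to the equivalence of solution families, there exists a one-to-one correspondence between one-parametric families of its solutions and its reduction operators of the form $Q=\partial_2+\zeta(x,u)\partial_u$, where $\zeta_u\ne0$ (resp. $Q^*=\partial_1+\zeta^*(x,u)\partial_u$, where $\zeta^*_u\ne0$). Namely, any such operator corresponds to the family of solutions which are invariant with respect to this operator. (Thus the construction of all one-parametric solution families of the equation and the exhaustive description of its reduction operators of the form $Q=\partial_2+\zeta(x,u)\partial_u$ with $\zeta_u\ne0$ (resp. $Q^*=\partial_1+\zeta^*(x,u)\partial_u$ with $\zeta^*_u\ne0$) are completely equivalent problems.)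
   Context: All considerations are local (domains may be shrunk so that functions assumed or shown to be nonzero do not vanish there); functions are smooth; $\partial_i=\partial/\partial x_i$. For a vector field $Q=\xi^1\partial_1+\xi^2\partial_2+\eta\partial_u$ (coefficients functions of $(x,u)$, $(\xi^1,\xi^2)\ne(0,0)$) put $Q[u]=\eta-\xi^1u_1-\xi^2u_2$, and let $\mathcal Q_{(2)}$ be the submanifold of the second-order jet space defined by $Q[u]=0$, $D_1Q[u]=0$, $D_2Q[u]=0$, where $D_i$ are the total derivatives. A function $u=f(x)$ is $Q$-invariant if it solves $Q[u]=0$. With $L=u_{12}-F(u)$, $Q$ is a reduction operator of the equation $L=0$ if the second prolongation of $Q$ applied to $L$ vanishes on $\{L=0\}\cap\mathcal Q_{(2)}$. A one-parametric family of solutions is a family $u=f(x,\varkappa)$ of solutions with $f_\varkappa\neq0$. Two families $u=f(x,\varkappa)$ and $u=\tilde f(x,\tilde\varkappa)$ are equivalent if they differ only by parameterization: $\tilde f(x,\theta(\varkappa))=f(x,\varkappa)$ for some function $\theta$ with $\theta_\varkappa\neq0$. *)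

(* Defs.v *)
From Stdlib Require Import Reals List.
From Coquelicot Require Import Coquelicot.
Import ListNotations.
Open Scope R_scope.

(** All functions are total; a function "on" an
    open set is a total function constrained only on that set. *)

Inductive axis := ax1 | ax2.

Definition axis_eqb (i k : axis) : bool :=
  match i, k with ax1, ax1 | ax2, ax2 => true | _, _ => false end.

Definition sum_axis (g : axis -> R) : R := g ax1 + g ax2.

(** [plane] carries the independent variables [x = (x1, x2)]; [space] carries
    [(x, u)] for coefficients of vector fields and [(x, kappa)] for families. *)
Definition plane : Type := (R * R)%type.
Definition space : Type := (plane * R)%type.

Record coordinate (T : Type) := Coordinate { get : T -> R; put : T -> R -> T }.
Arguments Coordinate {T} _ _.
Arguments get {T} _ _.
Arguments put {T} _ _ _.

Definition partial {T : Type} (c : coordinate T) (f : T -> R) (p : T) : R :=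
  Derive (fun t => f (put c p t)) (get c p).

Definition ex_partial {T : Type} (c : coordinate T) (f : T -> R) (p : T) : Prop :=
  ex_derive (fun t => f (put c p t)) (get c p).

Definition plane_x (i : axis) : coordinate plane :=
  match i with
  | ax1 => Coordinate fst (fun x t => (t, snd x))
  | ax2 => Coordinate snd (fun x t => (fst x, t))
  end.

Definition space_x (i : axis) : coordinate space :=
  Coordinate (fun p => get (plane_x i) (fst p))
             (fun p t => (put (plane_x i) (fst p) t, snd p)).

Definition space_z : coordinate space :=
  Coordinate snd (fun p t => (fst p, t)).

(** [f] is of class C^n on [D] with respect to the coordinates [cs]: all
    iterated partial derivatives of order at most [n] exist and are continuous
    at every point of [D]. *)
Fixpoint Ck {T : UniformSpace} (cs : list (coordinate T)) (n : nat)
    (D : T -> Prop) (f : T -> R) : Prop :=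
  (forall p, D p -> continuous f p) /\
  match n with
  | O => True
  | S m => forall c, In c cs ->
      (forall p, D p -> ex_partial c f p) /\ Ck cs m D (partial c f)
  end.

Definition smooth_line (D : R -> Prop) (g : R -> R) : Prop :=
  forall n t, D t -> ex_derive_n g n t.

Definition smooth_plane (D : plane -> Prop) (f : plane -> R) : Prop :=
  forall n, Ck [plane_x ax1; plane_x ax2] n D f.

Definition smooth_space (D : space -> Prop) (f : space -> R) : Prop :=
  forall n, Ck [space_x ax1; space_x ax2; space_z] n D f.

(** The second-order jet space, with coordinates
    [(x1, x2, u, u_1, u_2, u_11, u_12, u_22)]. *)
Inductive jet_index := X1 | X2 | U | U1 | U2 | U11 | U12 | U22.

Scheme Equality for jet_index.

Definition jet : Type := jet_index -> R.

Definition jet_coord (c : jet_index) : coordinate jet :=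
  Coordinate (fun j => j c)
             (fun j t => fun c' => if jet_index_beq c c' then t else j c').

Definition ind_x (i : axis) : jet_index :=
  match i with ax1 => X1 | ax2 => X2 end.
Definition ind_u1 (i : axis) : jet_index :=
  match i with ax1 => U1 | ax2 => U2 end.
Definition ind_u2 (i k : axis) : jet_index :=
  match i, k with
  | ax1, ax1 => U11
  | ax2, ax2 => U22
  | _, _ => U12
  end.

(** A differential function is a function on [jet].  The total derivative is
    only ever applied to differential functions of order at most one, for which
    the terms in third-order derivatives are absent. *)
Definition total_D (i : axis) (G : jet -> R) (j : jet) : R :=
  partial (jet_coord (ind_x i)) G j
  + j (ind_u1 i) * partial (jet_coord U) G j
  + sum_axis (fun k => j (ind_u2 i k) * partial (jet_coord (ind_u1 k)) G j).

(** The vector field [xi^1 d_1 + xi^2 d_2 + eta d_u]. *)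
Record vfield := VField { xi : axis -> space -> R; eta : space -> R }.

Definition base (j : jet) : space := ((j X1, j X2), j U).

Definition lift (g : space -> R) (j : jet) : R := g (base j).

(** The characteristic [Q[u] = eta - xi^1 u_1 - xi^2 u_2]. *)
Definition characteristic (Q : vfield) (j : jet) : R :=
  lift (eta Q) j - sum_axis (fun i => lift (xi Q i) j * j (ind_u1 i)).

(** The manifold [Q_(2)]. *)
Definition char_manifold (Q : vfield) (j : jet) : Prop :=
  characteristic Q j = 0 /\
  forall i, total_D i (characteristic Q) j = 0.

(** Coefficients [eta^i] and [eta^{ik}] of the second prolongation of [Q], by
    the usual recursion
    [eta^i = D_i eta - (D_i xi^l) u_l],
    [eta^{ik} = D_k eta^i - (D_k xi^l) u_{il}]. *)
Definition prolong1 (Q : vfield) (i : axis) (j : jet) : R :=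
  total_D i (lift (eta Q)) j
  - sum_axis (fun l => total_D i (lift (xi Q l)) j * j (ind_u1 l)).

Definition prolong2 (Q : vfield) (i k : axis) (j : jet) : R :=
  total_D k (prolong1 Q i) j
  - sum_axis (fun l => total_D k (lift (xi Q l)) j * j (ind_u2 i l)).

Definition second_prolongation (Q : vfield) (G : jet -> R) (j : jet) : R :=
  sum_axis (fun i => lift (xi Q i) j * partial (jet_coord (ind_x i)) G j)
  + lift (eta Q) j * partial (jet_coord U) G j
  + sum_axis (fun i => prolong1 Q i j * partial (jet_coord (ind_u1 i)) G j)
  + prolong2 Q ax1 ax1 j * partial (jet_coord U11) G j
  + prolong2 Q ax1 ax2 j * partial (jet_coord U12) G j
  + prolong2 Q ax2 ax2 j * partial (jet_coord U22) G j.

(** The left-hand side [L = u_12 - F(u)]. *)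
Definition wave_lhs (F : R -> R) (j : jet) : R := j U12 - F (j U).

(** [J] is the domain of [F], [W] the domain of the coefficients of [Q]. *)
Definition reduction_operator (F : R -> R) (J : R -> Prop)
    (W : space -> Prop) (Q : vfield) : Prop :=
  open W /\
  (forall p, W p -> J (snd p)) /\
  (forall i, smooth_space W (xi Q i)) /\ smooth_space W (eta Q) /\
  (forall p, W p -> ~ (xi Q ax1 p = 0 /\ xi Q ax2 p = 0)) /\
  (forall j, W (base j) -> wave_lhs F j = 0 -> char_manifold Q j ->
     second_prolongation Q (wave_lhs F) j = 0).

(** [d_i + zeta(x, u) d_u]. *)
Definition axis_field (i : axis) (zeta : space -> R) : vfield :=
  VField (fun k _ => if axis_eqb i k then 1 else 0) zeta.

Definition axis_reduction_operator (F : R -> R) (J : R -> Prop) (i : axis)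
    (W : space -> Prop) (zeta : space -> R) : Prop :=
  reduction_operator F J W (axis_field i zeta) /\
  (forall p, W p -> partial space_z zeta p <> 0).

(** The second-order jet of [u] at [x]. *)
Definition jet_of (u : plane -> R) (x : plane) : jet := fun c =>
  match c with
  | X1 => fst x
  | X2 => snd x
  | U => u x
  | U1 => partial (plane_x ax1) u x
  | U2 => partial (plane_x ax2) u x
  | U11 => partial (plane_x ax1) (partial (plane_x ax1) u) x
  | U12 => partial (plane_x ax2) (partial (plane_x ax1) u) x
  | U22 => partial (plane_x ax2) (partial (plane_x ax2) u) x
  end.

Definition solution (F : R -> R) (J : R -> Prop)
    (O : plane -> Prop) (u : plane -> R) : Prop :=
  open O /\ smooth_plane O u /\
  forall x, O x -> J (u x) /\ wave_lhs F (jet_of u x) = 0.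

Definition invariant (Q : vfield) (O : plane -> Prop) (u : plane -> R) : Prop :=
  forall x, O x -> characteristic Q (jet_of u x) = 0.

Definition member (f : space -> R) (k : R) : plane -> R := fun x => f (x, k).

Definition slice (V : space -> Prop) (k : R) : plane -> Prop := fun x => V (x, k).

Definition solution_family (F : R -> R) (J : R -> Prop)
    (V : space -> Prop) (f : space -> R) : Prop :=
  open V /\ smooth_space V f /\
  (forall p, V p -> partial space_z f p <> 0) /\
  (forall k, solution F J (slice V k) (member f k)).

(** The family [f] on [V] is the family of the [Q]-invariant solutions whose
    graphs lie in [W]: its members are such solutions, exactly one of them passes
    through each point of [W], and every such solution is, near each point of its
    domain, a member of the family. *)
Definition invariant_family (F : R -> R) (J : R -> Prop) (Q : vfield)
    (W V : space -> Prop) (f : space -> R) : Prop :=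
  (forall x k, V (x, k) -> W (x, f (x, k))) /\
  (forall k, invariant Q (slice V k) (member f k)) /\
  (forall x z, W (x, z) -> exists! k, V (x, k) /\ f (x, k) = z) /\
  (forall O u, solution F J O u -> (forall x, O x -> W (x, u x)) ->
     invariant Q O u ->
     forall x, O x ->
       exists k, V (x, k) /\ locally x (fun y => u y = f (y, k))).

(** Local form, at [(x0, k)] and [(x0, k')], of the equivalence
    [f'(x, theta(kappa)) = f(x, kappa)] of families. *)
Definition equivalent_families_at (x0 : plane) (f : space -> R) (k : R)
    (f' : space -> R) (k' : R) : Prop :=
  exists (theta : R -> R) (I : R -> Prop),
    open I /\ I k /\ smooth_line I theta /\
    (forall t, I t -> Derive theta t <> 0) /\
    theta k = k' /\
    locally ((x0, k) : space) (fun p => f' (fst p, theta (snd p)) = f p).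

Definition subdomain (A B : space -> Prop) : Prop := forall p, A p -> B p.

Definition dense_in (A B : space -> Prop) : Prop :=
  forall p, B p -> forall P, locally p P -> exists q, A q /\ P q.

(** The points of [V] with [f_{i kappa} <> 0]: where [zeta(x, f) = f_i], one has
    [zeta_u = f_{i kappa} / f_kappa], so [zeta_u <> 0] holds exactly there. *)
Definition nondegenerate (i : axis) (V : space -> Prop) (f : space -> R)
    : space -> Prop :=
  fun p => V p /\ partial (space_x i) (partial space_z f) p <> 0.

(* Main.v *)
Require Import Defs.
From Stdlib Require Import Reals List Lra Lia ClassicalEpsilon Classical FunctionalExtensionality.
From Coquelicot Require Import Coquelicot.
Import ListNotations.
Open Scope R_scope.

(** Let [o] be the axis other than [i].  On an invariant solution [u_i = zeta], and
    [F = D_o zeta] determines [u_o = zeta'], where [zeta' = (F - zeta_o) / zeta_u].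
    The condition for [d_i + zeta d_u] to be a reduction operator is equivalent to
    [zeta'_i + zeta zeta'_u = F], while [zeta_o + zeta' zeta_u = F] by the choice of
    [zeta']: the fields [d_i + zeta d_u] and [d_o + zeta' d_u] commute.  By Frobenius
    the invariant solutions form a one-parametric family [f].  Conversely a family
    gives [zeta(x, f) = f_i]; then [zeta'(x, f) = f_o], and differentiating in [x_i]
    returns the condition.  If [K] inverts [kappa |-> f(x, kappa)], then [K(x, u(x))]
    is locally constant along every invariant solution [u], and this gives both the
    uniqueness of the family and the parameter change between two families.  The set
    [f_{i kappa} <> 0] is dense because [f_{i kappa} = 0] on an open set would give
    [0 = f_{12 kappa} = F'(f) f_kappa]. *)

(** Smoothness here means that all iterated partials exist and are continuous, so a total
    differential is never given directly. Its substitute is Hadamard's formula: on a ball,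
    [f q' - f q] is the sum of the coordinate increments times continuous coefficients. The chain
    rule, the partials of the fibrewise inverse and the partials of a flow in its parameters all
    come from the same device: an exact difference quotient is written with these coefficients and
    its continuity gives the derivative. Higher smoothness is then a bootstrap, because each
    derivative formula involves the unknown function but not its derivatives. Every local
    construction lives on a ball. Balls of the product metric are boxes: replacing one coordinate by
    an admissible value stays inside, so axis-parallel segments and integrals are always available.
    The role of [zeta_u <> 0] is to turn one first-order equation plus the wave equation into a
    complete first-order system. Two functions obeying the system can therefore be compared by their
    first derivatives at points with equal values, which is how a family is compared with a single
    solution and with another family. *)

(* [Some i] stands for the coordinate [x_i], [None] for the last coordinate of [space]. *)
Definition sc (v : option axis) : coordinate space :=
  match v with Some i => space_x i | None => space_z end.

Definition other (i : axis) : axis := match i with ax1 => ax2 | ax2 => ax1 end.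

Definition var_eq_dec (v w : option axis) : {v = w} + {v <> w}.
Proof. repeat decide equality. Defined.

Notation gt v := (get (sc v)).
Notation pt v := (put (sc v)).

Lemma get_put_same v p t : gt v (pt v p t) = t.
Proof. destruct v as [[]|]; reflexivity. Qed.

Lemma get_put_diff v w p t : v <> w -> gt v (pt w p t) = gt v p.
Proof. destruct v as [[]|], w as [[]|]; intros H; try reflexivity; now destruct H. Qed.

Lemma put_put v p s t : pt v (pt v p s) t = pt v p t.
Proof. destruct v as [[]|]; reflexivity. Qed.

Lemma put_get v p : pt v p (gt v p) = p.
Proof. destruct p as [[a b] c]; destruct v as [[]|]; reflexivity. Qed.

Lemma put_comm v w p s t : v <> w -> pt v (pt w p s) t = pt w (pt v p t) s.
Proof. destruct v as [[]|], w as [[]|]; intros H; try reflexivity; now destruct H. Qed.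

Lemma space_eq (p q : space) : (forall v, gt v p = gt v q) -> p = q.
Proof.
  intros H; generalize (H (Some ax1)) (H (Some ax2)) (H None).
  destruct p as [[a b] c], q as [[a' b'] c']; simpl; intros; subst; reflexivity.
Qed.

Definition sum3 (g : option axis -> R) : R := g (Some ax1) + g (Some ax2) + g None.

Lemma sum3_ext g h : (forall v, g v = h v) -> sum3 g = sum3 h.
Proof. intros H; unfold sum3; now rewrite !H. Qed.

(** * Balls of [space] as boxes in the three coordinates *)

Lemma ball_R (x : R) e y : ball x e y <-> Rabs (y - x) < e.
Proof. reflexivity. Qed.

Lemma ball_space (c : space) r p : ball c r p <-> forall v, Rabs (gt v p - gt v c) < r.
Proof.
  destruct c as [[a b] z], p as [[a' b'] z']; split.
  - intros [[H1 H2] H3] [[]|]; assumption.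
  - intros H; repeat split; [apply (H (Some ax1))|apply (H (Some ax2))|apply (H None)].
Qed.

Lemma ball_put c r p v t : ball c r p -> Rabs (t - gt v c) < r -> ball c r (pt v p t).
Proof.
  rewrite !ball_space; intros H Ht w; destruct (var_eq_dec w v) as [->|E].
  - now rewrite get_put_same.
  - now rewrite get_put_diff.
Qed.

Lemma ball_space_open (c : space) r : open (ball c r).
Proof.
  intros p H; rewrite ball_space in H.
  set (m := Rmin (r - Rabs (gt (Some ax1) p - gt (Some ax1) c))
     (Rmin (r - Rabs (gt (Some ax2) p - gt (Some ax2) c)) (r - Rabs (gt None p - gt None c)))).
  assert (Hm : 0 < m).
  { unfold m; repeat apply Rmin_glb_lt; apply Rlt_0_minus; apply H. }
  exists (mkposreal m Hm); intros q Hq; rewrite ball_space in *; intros v; change (pos (mkposreal m Hm)) with m in Hq.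
  specialize (Hq v).
  assert (m <= r - Rabs (gt v p - gt v c)).
  { unfold m; destruct v as [[]|].
    - apply Rmin_l.
    - eapply Rle_trans; [apply Rmin_r|apply Rmin_l].
    - eapply Rle_trans; [apply Rmin_r|apply Rmin_r]. }
  replace (gt v q - gt v c) with ((gt v q - gt v p) + (gt v p - gt v c)) by ring.
  eapply Rle_lt_trans; [apply Rabs_triang|]; lra.
Qed.

Lemma open_ball (D : space -> Prop) c : open D -> D c -> exists r : posreal, forall p, ball c r p -> D p.
Proof. intros H Hc; destruct (H c Hc) as [r Hr]; now exists r. Qed.

Lemma ball_convex1 (c r a b s : R) : Rabs (a - c) < r -> Rabs (b - c) < r -> 0 <= s <= 1 ->
  Rabs (a + s * (b - a) - c) < r.
Proof.
  intros Ha Hb Hs; apply Rabs_def2 in Ha; apply Rabs_def2 in Hb.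
  destruct (Rle_dec a b).
  - assert (0 <= s * (b - a)) by nra; assert (0 <= (1 - s) * (b - a)) by nra; apply Rabs_def1; lra.
  - assert (0 <= s * (a - b)) by nra; assert (0 <= (1 - s) * (a - b)) by nra; apply Rabs_def1; lra.
Qed.

(** * Continuity on [space] and of integrals depending on a parameter *)

Lemma continuous_get v (p : space) : continuous (gt v) p.
Proof.
  intros P [e He]; exists e; intros q Hq; apply He; rewrite ball_space in Hq; apply ball_R, Hq.
Qed.

Lemma continuous_to_space {T : UniformSpace} (a : T -> space) p :
  (forall v, continuous (fun q => gt v (a q)) p) -> continuous a p.
Proof.
  intros H P [e He].
  unfold filtermap.
  assert (H' : forall v, locally p (fun q => Rabs (gt v (a q) - gt v (a p)) < e)).
  { intros v; apply (H v (fun y => Rabs (y - gt v (a p)) < e)); exists e; intros y Hy; apply Hy. }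
  generalize (filter_and _ _ (H' (Some ax1)) (filter_and _ _ (H' (Some ax2)) (H' None))).
  apply filter_imp; intros q (H1 & H2 & H3); apply He, ball_space; intros [[]|]; assumption.
Qed.

Lemma continuous_put {T : UniformSpace} v (a : T -> space) (t : T -> R) p :
  continuous a p -> continuous t p -> continuous (fun q => pt v (a q) (t q)) p.
Proof.
  intros Ha Ht; apply continuous_to_space; intros w; destruct (var_eq_dec w v) as [->|E].
  - eapply continuous_ext; [intros q; symmetry; apply get_put_same|exact Ht].
  - eapply continuous_ext; [intros q; symmetry; now apply get_put_diff|].
    apply (continuous_comp a (gt w)); [exact Ha|apply continuous_get].
Qed.

Lemma continuous_at_locally {T : UniformSpace} (f : T -> R) p (e : R) :
  continuous f p -> 0 < e -> locally p (fun q => Rabs (f q - f p) < e).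
Proof.
  intros H He; apply (H (fun y => Rabs (y - f p) < e)); exists (mkposreal e He); intros y Hy; apply Hy.
Qed.

Lemma continuous_from_locally {T : UniformSpace} (f : T -> R) p :
  (forall e, 0 < e -> locally p (fun q => Rabs (f q - f p) < e)) -> continuous f p.
Proof.
  intros H P [e He]; unfold filtermap.
  generalize (H e (cond_pos e)); apply filter_imp; intros q Hq; apply He, Hq.
Qed.

Lemma continuous_Rplus {T : UniformSpace} (f g : T -> R) p :
  continuous f p -> continuous g p -> continuous (fun q => f q + g q) p.
Proof. exact (@continuous_plus T R_AbsRing R_NormedModule f g p). Qed.

Lemma continuous_Rminus {T : UniformSpace} (f g : T -> R) p :
  continuous f p -> continuous g p -> continuous (fun q => f q - g q) p.
Proof. exact (@continuous_minus T R_AbsRing R_NormedModule f g p). Qed.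

Lemma continuous_Rmult {T : UniformSpace} (f g : T -> R) p :
  continuous f p -> continuous g p -> continuous (fun q => f q * g q) p.
Proof. exact (@continuous_mult T R_AbsRing f g p). Qed.

Lemma continuous_Rinv_comp {T : UniformSpace} (f : T -> R) p :
  continuous f p -> f p <> 0 -> continuous (fun q => / f q) p.
Proof. intros; now apply (continuous_comp f Rinv); [|apply continuous_Rinv]. Qed.

(** Tube lemma: continuity at each point of the compact segment over [p] is upgraded to one
    neighbourhood of [p] that serves all [s]. The limits are fixed at 0 and 1; integrals with a
    moving endpoint are rescaled to this form before use. *)
Lemma continuous_RInt_param {T : UniformSpace} (g : R -> T -> R) (p : T) :
  locally p (fun q => forall s, 0 <= s <= 1 -> continuous (fun y : R * T => g (fst y) (snd y)) (s, q)) ->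
  continuous (fun q => RInt (fun s => g s q) 0 1) p.
Proof.
  intros Hc; apply continuous_from_locally; intros e He.
  assert (Hp := locally_singleton _ _ Hc).
  assert (He2 : 0 < e / 4) by lra.
  assert (Hd : forall s, exists d : posreal, 0 <= s <= 1 -> forall y : R * T, ball (s, p) d y ->
     Rabs (g (fst y) (snd y) - g s p) < e / 4).
  { intros s; destruct (Rle_dec 0 s); [|exists (mkposreal 1 Rlt_0_1); lra].
    destruct (Rle_dec s 1); [|exists (mkposreal 1 Rlt_0_1); lra].
    destruct (continuous_at_locally _ _ _ (Hp s (conj r r0)) He2) as [d Hd].
    exists d; intros _ y Hy; exact (Hd y Hy). }
  set (delta s := proj1_sig (constructive_indefinite_description _ (Hd s))).
  assert (Hdelta : forall s, 0 <= s <= 1 -> forall y : R * T, ball (s, p) (delta s) y ->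
     Rabs (g (fst y) (snd y) - g s p) < e / 4).
  { intros s; exact (proj2_sig (constructive_indefinite_description _ (Hd s))). }
  clearbody delta.
  (* The radius [d] is uniform in [s]. The covering point [t] comes only under a double negation, so
     the pointwise bound below is proved by contradiction: the values at [(s, q)] and [(s, p)] both
     lie within [e / 4] of the value at [(t, p)]. *)
  destruct (compactness_value_1d 0 1 delta) as [d Hcomp].
  assert (Hl : locally p (ball p d)) by now exists d.
  generalize (filter_and _ _ Hl Hc); apply filter_imp; intros q [Hq Hcq].
  assert (Hint : forall q, (forall s, 0 <= s <= 1 -> continuous (fun y : R * T => g (fst y) (snd y)) (s, q)) ->
     ex_RInt (fun s => g s q) 0 1).
  { intros q' Hq'; apply (ex_RInt_continuous (V := R_CompleteNormedModule)); rewrite Rmin_left, Rmax_right by lra; intros s Hs.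
    apply (continuous_comp_2 (fun s : R => s) (fun _ => q') g).
    apply continuous_id. apply continuous_const. now apply Hq'. }
  assert (E : RInt (fun s => g s q) 0 1 - RInt (fun s => g s p) 0 1 = RInt (fun s => g s q - g s p) 0 1).
  { symmetry; apply (RInt_minus (V := R_CompleteNormedModule)); now apply Hint. }
  rewrite E.
  apply Rle_lt_trans with ((1 - 0) * (e / 2)); [|lra].
  apply abs_RInt_le_const; [lra| |].
  - apply (ex_RInt_minus (V := R_CompleteNormedModule)); now apply Hint.
  - intros s Hs; apply Rnot_lt_le; intros Hlt; apply (Hcomp s Hs); intros (t & Ht & Hst & Hdt).
    assert (H1 : Rabs (g s q - g t p) < e / 4).
    { apply (Hdelta t Ht (s, q)); split; [exact Hst|]. eapply ball_le; [exact Hdt|exact Hq]. }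
    assert (H2 : Rabs (g s p - g t p) < e / 4).
    { apply (Hdelta t Ht (s, p)); split; [exact Hst|]; apply ball_center. }
    revert Hlt; apply Rle_not_lt.
    replace (g s q - g s p) with ((g s q - g t p) - (g s p - g t p)) by ring.
    eapply Rle_trans; [apply Rabs_triang|]; rewrite Rabs_Ropp; lra.
Qed.

(** * Calculus of the classes C^n on open subsets of [space] *)

Notation axes := [space_x ax1; space_x ax2; space_z].
Notation SP := (prod_UniformSpace (prod_UniformSpace R_UniformSpace R_UniformSpace) R_UniformSpace).
Notation CS n D f := (Ck (T := SP) axes n D f).
Notation pd v f := (partial (sc v) f).

Lemma CS_cont n (D : space -> Prop) f p : CS n D f -> D p -> continuous f p.
Proof. destruct n; intros [H _]; apply H. Qed.

Lemma CS_ex n (D : space -> Prop) f v p : CS (S n) D f -> D p -> ex_partial (sc v) f p.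
Proof. intros [_ H]; apply H; destruct v as [[]|]; simpl; tauto. Qed.

Lemma CS_pd n (D : space -> Prop) f v : CS (S n) D f -> CS n D (pd v f).
Proof. intros [_ H]; apply H; destruct v as [[]|]; simpl; tauto. Qed.

Lemma CS_intro n (D : space -> Prop) f : (forall p, D p -> continuous f p) ->
  (forall v p, D p -> ex_partial (sc v) f p) -> (forall v, CS n D (pd v f)) -> CS (S n) D f.
Proof.
  intros H H1 H2; split; [exact H|].
  intros c [<-|[<-|[<-|[]]]]; split.
  - apply (H1 (Some ax1)). - apply (H2 (Some ax1)).
  - apply (H1 (Some ax2)). - apply (H2 (Some ax2)).
  - apply (H1 None). - apply (H2 None).
Qed.

Lemma CS_sub n (D E : space -> Prop) f : (forall p, E p -> D p) -> CS n D f -> CS n E f.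
Proof.
  intros HE; revert f; induction n; intros f H.
  - split; [|exact I]; intros p Hp; eapply CS_cont; eauto.
  - apply CS_intro.
    + intros p Hp; eapply CS_cont; eauto.
    + intros v p Hp; eapply CS_ex; eauto.
    + intros v; apply IHn; now apply CS_pd.
Qed.

Lemma CS_le n (D : space -> Prop) f : CS (S n) D f -> CS n D f.
Proof.
  revert f; induction n; intros f H.
  - split; [|exact I]; intros p Hp; eapply CS_cont; eauto.
  - apply CS_intro.
    + intros p Hp; eapply CS_cont; eauto.
    + intros v p Hp; eapply CS_ex; eauto.
    + intros v; apply IHn; now apply CS_pd.
Qed.

Lemma is_pd (D : space -> Prop) n f v p t : CS (S n) D f -> D (pt v p t) ->
  is_derive (fun s => f (pt v p s)) t (pd v f (pt v p t)).
Proof.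
  intros H Hp; assert (E := CS_ex _ _ _ v _ H Hp); unfold ex_partial in E; unfold partial.
  rewrite get_put_same in *.
  apply Derive_correct in E.
  eapply is_derive_ext; [|exact E]; intros s; simpl; now rewrite put_put.
Qed.

Lemma is_pd' (D : space -> Prop) n f v p : CS (S n) D f -> D p ->
  is_derive (fun s => f (pt v p s)) (gt v p) (pd v f p).
Proof. intros H Hp; generalize (is_pd D n f v p (gt v p) H); rewrite put_get; auto. Qed.

Lemma locally_put v (p : space) (P : space -> Prop) : locally p P -> locally (gt v p) (fun t => P (pt v p t)).
Proof.
  intros [e He]; exists e; intros t Ht; apply He, ball_put; [apply ball_center|exact Ht].
Qed.

Lemma pd_ext_loc v f g (p : space) : locally p (fun q => f q = g q) -> pd v f p = pd v g p.
Proof. intros H; apply Derive_ext_loc; now apply (locally_put v p (fun q => f q = g q)). Qed.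

Lemma CS_ext n (D : space -> Prop) f g : open D -> (forall p, D p -> f p = g p) -> CS n D f -> CS n D g.
Proof.
  intros HD; revert f g; induction n; intros f g E H.
  - split; [|exact I]; intros p Hp; apply continuous_ext_loc with f; [|eapply CS_cont; eauto].
    generalize (HD p Hp); apply filter_imp; auto.
  - apply CS_intro.
    + intros p Hp; apply continuous_ext_loc with f; [|eapply CS_cont; eauto].
      generalize (HD p Hp); apply filter_imp; auto.
    + intros v p Hp; apply ex_derive_ext_loc with (fun t => f (pt v p t)).
      * apply (locally_put v p (fun q => f q = g q)). generalize (HD p Hp); apply filter_imp; auto.
      * eapply CS_ex; eauto.
    + intros v; apply IHn with (pd v f); [|now apply CS_pd].
      intros p Hp; apply pd_ext_loc. generalize (HD p Hp); apply filter_imp; auto.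
Qed.

(** The common induction step of the closure properties: exhibit a formula for the partials and its
    class. Openness of [D] matters because the formula equals the partial only on [D], while the
    next derivative looks at a neighbourhood. *)
Lemma CS_step n (D : space -> Prop) f (df : option axis -> space -> R) : open D ->
  (forall p, D p -> continuous f p) ->
  (forall v p, D p -> is_derive (fun t => f (pt v p t)) (gt v p) (df v p)) ->
  (forall v, CS n D (df v)) -> CS (S n) D f.
Proof.
  intros HD Hc Hd H; apply CS_intro; auto.
  - intros v p Hp; eexists; now apply Hd.
  - intros v; apply CS_ext with (df v); auto.
    intros p Hp; symmetry; now apply is_derive_unique, Hd.
Qed.

Lemma CS_const n (D : space -> Prop) k : CS n D (fun _ => k).
Proof.
  revert k; induction n; intros k.
  - split; [|exact I]; intros; apply continuous_const.
  - apply CS_intro.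
    + intros; apply continuous_const.
    + intros; unfold ex_partial; apply @ex_derive_const.
    + intros v; assert (E : pd v (fun _ : space => k) = fun _ => 0).
      { apply functional_extensionality; intros p; unfold partial; apply Derive_const. }
      exact (eq_ind_r (fun g => CS n D g) (IHn 0) E).
Qed.

Lemma CS_get n (D : space -> Prop) v : open D -> CS n D (gt v).
Proof.
  intros HD; destruct n.
  - split; [|exact I]; intros; apply continuous_get.
  - apply CS_step with (fun w _ => if var_eq_dec w v then 1 else 0); auto.
    + intros; apply continuous_get.
    + intros w p _; destruct (var_eq_dec w v) as [->|E].
      * eapply is_derive_ext; [intros t; symmetry; apply get_put_same|exact (is_derive_id (K := R_AbsRing) (gt v p))].
      * eapply is_derive_ext; [intros t; symmetry; apply get_put_diff; congruence|apply @is_derive_const].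
    + intros w; apply CS_const.
Qed.

Lemma continuous_fst_comp {S T U : UniformSpace} (a : S -> T * U) p :
  continuous a p -> continuous (fun y => fst (a y)) p.
Proof. intros H; apply (continuous_comp a fst); [exact H|]; destruct (a p); apply continuous_fst. Qed.

Lemma continuous_snd_comp {S T U : UniformSpace} (a : S -> T * U) p :
  continuous a p -> continuous (fun y => snd (a y)) p.
Proof. intros H; apply (continuous_comp a snd); [exact H|]; destruct (a p); apply continuous_snd. Qed.

Lemma continuous_get_comp {S : UniformSpace} v (a : S -> space) p :
  continuous a p -> continuous (fun y => gt v (a y)) p.
Proof. intros H; apply (continuous_comp a (gt v)); [exact H|apply continuous_get]. Qed.

Lemma is_derive_Rplus (f g : R -> R) (x a b : R) : is_derive f x a -> is_derive g x b ->
  is_derive (fun t => f t + g t) x (a + b).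
Proof. intros Hf Hg; exact (is_derive_plus (K := R_AbsRing) (V := R_NormedModule) f g x a b Hf Hg). Qed.

Lemma is_derive_Rminus (f g : R -> R) (x a b : R) : is_derive f x a -> is_derive g x b ->
  is_derive (fun t => f t - g t) x (a - b).
Proof. intros Hf Hg; exact (is_derive_minus (K := R_AbsRing) (V := R_NormedModule) f g x a b Hf Hg). Qed.

Lemma is_derive_Rmult (f g : R -> R) (x a b : R) : is_derive f x a -> is_derive g x b ->
  is_derive (fun t => f t * g t) x (a * g x + f x * b).
Proof. rewrite !is_derive_Reals; intros; now apply derivable_pt_lim_mult. Qed.

Lemma is_derive_Rcomp (f g : R -> R) (x a b : R) : is_derive f (g x) a -> is_derive g x b ->
  is_derive (fun t => f (g t)) x (b * a).
Proof. intros Hf Hg; exact (is_derive_comp (K := R_AbsRing) (V := R_NormedModule) f g x a b Hf Hg). Qed.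

Lemma is_derive_Rinv (f : R -> R) (x a : R) : f x <> 0 -> is_derive f x a ->
  is_derive (fun t => / f t) x (- a / (f x * f x)).
Proof.
  intros H0 Hf; generalize (is_derive_inv f x a Hf H0); now replace (f x ^ 2) with (f x * f x) by ring.
Qed.

Lemma is_derive_eq (f : R -> R) (x a b : R) : is_derive f x a -> a = b -> is_derive f x b.
Proof. intros H <-; exact H. Qed.

Lemma CS_plus n (D : space -> Prop) f g : open D -> CS n D f -> CS n D g -> CS n D (fun p => f p + g p).
Proof.
  intros HD; revert f g; induction n; intros f g Hf Hg.
  - split; [|exact I]; intros; apply continuous_Rplus; eapply CS_cont; eauto.
  - apply CS_step with (fun v p => pd v f p + pd v g p); auto.
    + intros; apply continuous_Rplus; eapply CS_cont; eauto.
    + intros v p Hp; apply is_derive_Rplus; eapply is_pd'; eauto.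
    + intros v; apply IHn; now apply CS_pd.
Qed.

Lemma CS_mult n (D : space -> Prop) f g : open D -> CS n D f -> CS n D g -> CS n D (fun p => f p * g p).
Proof.
  intros HD; revert f g; induction n; intros f g Hf Hg.
  - split; [|exact I]; intros; apply continuous_Rmult; eapply CS_cont; eauto.
  - apply CS_step with (fun v p => pd v f p * g p + f p * pd v g p); auto.
    + intros; apply continuous_Rmult; eapply CS_cont; eauto.
    + intros v p Hp.
      eapply is_derive_eq; [apply is_derive_Rmult; eapply is_pd'; eauto|].
      cbv beta; rewrite ?put_get; reflexivity.
    + intros v; apply CS_plus; auto; apply IHn; auto using CS_pd, CS_le.
Qed.

Lemma CS_opp n (D : space -> Prop) f : open D -> CS n D f -> CS n D (fun p => - f p).
Proof.
  intros HD Hf; apply CS_ext with (fun p => -1 * f p); auto.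
  - intros; ring.
  - apply CS_mult; auto; apply CS_const.
Qed.

Lemma CS_minus n (D : space -> Prop) f g : open D -> CS n D f -> CS n D g -> CS n D (fun p => f p - g p).
Proof. intros; apply CS_plus; auto; now apply CS_opp. Qed.

Lemma CS_inv n (D : space -> Prop) f : open D -> (forall p, D p -> f p <> 0) -> CS n D f -> CS n D (fun p => / f p).
Proof.
  intros HD H0; revert f H0; induction n; intros f H0 Hf.
  - split; [|exact I]; intros; apply continuous_Rinv_comp; auto; eapply CS_cont; eauto.
  - apply CS_step with (fun v p => (- pd v f p) * (/ f p * / f p)); auto.
    + intros; apply continuous_Rinv_comp; auto; eapply CS_cont; eauto.
    + intros v p Hp.
      eapply is_derive_eq; [apply is_derive_Rinv; [cbv beta; rewrite put_get; auto|eapply is_pd'; eauto]|].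
      cbv beta; rewrite ?put_get. field; auto.
    + intros v; apply CS_mult; auto.
      * apply CS_opp; auto. now apply CS_pd.
      * apply CS_mult; auto using CS_le.
Qed.

Lemma CS_div n (D : space -> Prop) f g : open D -> (forall p, D p -> g p <> 0) ->
  CS n D f -> CS n D g -> CS n D (fun p => f p / g p).
Proof. intros; apply CS_mult; auto; now apply CS_inv. Qed.

Lemma CS_line n (D : space -> Prop) (J : R -> Prop) F f : open D -> smooth_line J F ->
  (forall p, D p -> J (f p)) -> CS n D f -> CS n D (fun p => F (f p)).
Proof.
  intros HD; revert F f; induction n; intros F f HF HJ Hf;
  (assert (Hc : forall p, D p -> continuous (fun p => F (f p)) p) by
    (intros p Hp; apply (continuous_comp f F); [eapply CS_cont; eauto|];
     apply @ex_derive_continuous; apply (HF 1%nat); auto)).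
  - split; [exact Hc|exact I].
  - apply CS_step with (fun v p => pd v f p * Derive F (f p)); auto.
    + intros v p Hp. 
      eapply is_derive_eq; [apply (is_derive_Rcomp F (fun t => f (pt v p t)))|].
      { apply Derive_correct. rewrite put_get. apply (HF 1%nat); auto. }
      { eapply is_pd'; eauto. }
      cbv beta; rewrite ?put_get; reflexivity.
    + intros v; apply CS_mult; auto using CS_pd.
      apply IHn; auto using CS_le.
      (* Smoothness of [Derive F] is that of [F] shifted by one order; order 0 is vacuous and
         handled apart. *)
      intros m t Ht. generalize (HF (S m) t Ht). destruct m; [simpl; auto|].
      simpl. intros H. apply ex_derive_ext with (2 := H). intros s.
      transitivity (Derive_n F (m + 1) s); [now rewrite Nat.add_1_r|symmetry; exact (Derive_n_comp F m 1 s)].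
Qed.

Lemma smooth_exp : smooth_line (fun _ => True) exp.
Proof.
  intros n t _; destruct n; simpl; auto.
  apply ex_derive_ext with exp.
  - intros s; induction n in s |- *; simpl; auto.
    rewrite <- (Derive_ext exp _ s IHn). symmetry. apply is_derive_unique, is_derive_exp.
  - eexists; apply is_derive_exp.
Qed.

Lemma CS_exp n (D : space -> Prop) f : open D -> CS n D f -> CS n D (fun p => exp (f p)).
Proof. intros HD Hf; apply (CS_line n D (fun _ => True)); auto; apply smooth_exp. Qed.

(** Carathéodory's form of the derivative: the difference quotient, filled in by [l] at [t0], is
    continuous there. Together with the converse that follows, it reduces differentiation to algebra
    with continuous factors. *)
Lemma ex_derive_slope (f : R -> R) t0 l : is_derive f t0 l ->
  exists S : R -> R, continuous S t0 /\ S t0 = l /\ forall t, f t - f t0 = (t - t0) * S t.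
Proof.
  intros H; exists (fun t => if Req_EM_T t t0 then l else (f t - f t0) / (t - t0)).
  split; [|split].
  - apply continuous_from_locally; intros e He.
    destruct (Req_EM_T t0 t0) as [_|]; [|congruence].
    apply is_derive_Reals in H; destruct (H e He) as [d Hd]; exists d; intros t Ht.
    destruct (Req_EM_T t t0) as [|N].
    + rewrite Rminus_eq_0, Rabs_R0; exact He.
    + apply ball_R in Ht. specialize (Hd (t - t0)). rewrite Rplus_minus in Hd.
      apply Hd; [lra|exact Ht].
  - destruct (Req_EM_T t0 t0); congruence.
  - intros t; destruct (Req_EM_T t t0) as [->|N]; [ring|field; lra].
Qed.

Lemma is_derive_of_slope (f S : R -> R) t0 : continuous S t0 ->
  locally t0 (fun t => f t - f t0 = (t - t0) * S t) -> is_derive f t0 (S t0).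
Proof.
  intros Hc H; apply is_derive_Reals; intros e He.
  destruct (filter_and _ _ H (continuous_at_locally _ _ e Hc He)) as [d Hd].
  exists d; intros h Hh Hhd.
  destruct (Hd (t0 + h)) as [E1 E2].
  { apply ball_R. now replace (t0 + h - t0) with h by ring. }
  rewrite E1. replace ((t0 + h - t0) * S (t0 + h) / h) with (S (t0 + h)) by (field; exact Hh). exact E2.
Qed.

(** ** Slopes and the chain rule *)

(** The difference quotient as a mean of the partial over the segment: no division, hence no
    separate case for a zero increment, and joint continuity in base point and endpoint comes from
    the parameter integral. *)
Definition slope v f (q : space * R) : R :=
  RInt (fun s => pd v f (pt v (fst q) (gt v (fst q) + s * (snd q - gt v (fst q))))) 0 1.

Section Slopes.
Context (c : space) (r : R) (f : space -> R).
Hypothesis Hf : CS 1 (ball c r) f.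

Lemma pd_cont v p : ball c r p -> continuous (pd v f) p.
Proof. intros Hp; eapply CS_cont; [apply CS_pd, Hf|exact Hp]. Qed.

Lemma slope_diag v p : slope v f (p, gt v p) = pd v f p.
Proof.
  unfold slope; simpl. 
  rewrite (RInt_ext _ (fun _ => pd v f p)).
  - rewrite RInt_const. unfold scal; simpl. unfold mult; simpl. ring.
  - intros s _. f_equal. replace (gt v p + s * (gt v p - gt v p)) with (gt v p) by ring. apply put_get.
Qed.

Lemma slope_spec v p t : ball c r p -> Rabs (t - gt v c) < r ->
  f (pt v p t) - f p = (t - gt v p) * slope v f (p, t).
Proof.
  intros Hp Ht. unfold slope; simpl. set (a := gt v p).
  assert (Ha : Rabs (a - gt v c) < r) by (rewrite ball_space in Hp; apply Hp).
  assert (Hin : forall s, 0 <= s <= 1 -> ball c r (pt v p (a + s * (t - a)))).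
  { intros s Hs; apply ball_put; auto. now apply ball_convex1. }
  assert (Hcont : forall s, 0 <= s <= 1 -> continuous (fun s => pd v f (pt v p (a + s * (t - a)))) s).
  { intros s Hs. apply (continuous_comp (fun s => pt v p (a + s * (t - a))) (pd v f)); [|apply pd_cont; auto].
    apply continuous_put; [apply continuous_const|].
    apply continuous_Rplus; [apply continuous_const|apply continuous_Rmult; [apply continuous_id|apply continuous_const]]. }
  assert (E : is_RInt (fun s => (t - a) * pd v f (pt v p (a + s * (t - a)))) 0 1
     (minus (f (pt v p (a + 1 * (t - a)))) (f (pt v p (a + 0 * (t - a)))))).
  { apply (is_RInt_derive (V := R_CompleteNormedModule) (fun s => f (pt v p (a + s * (t - a))))); rewrite Rmin_left, Rmax_right by lra; intros s Hs.
    - apply (is_derive_Rcomp (fun y => f (pt v p y)) (fun s => a + s * (t - a))).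
      + eapply is_pd; eauto.
      + auto_derive; auto; ring.
    - apply continuous_Rmult; [apply continuous_const|apply Hcont; auto]. }
  apply (is_RInt_unique (V := R_CompleteNormedModule)) in E.
  replace (a + 1 * (t - a)) with t in E by ring. replace (a + 0 * (t - a)) with a in E by ring.
  unfold a in E at 3. rewrite put_get in E.
  unfold minus, plus, opp in E; simpl in E. unfold Rminus at 1. rewrite <- E.
  apply (RInt_scal (V := R_CompleteNormedModule)).
  apply (ex_RInt_continuous (V := R_CompleteNormedModule)); rewrite Rmin_left, Rmax_right by lra; auto.
Qed.

Lemma slope_cont v p t : ball c r p -> Rabs (t - gt v c) < r -> continuous (slope v f) (p, t).
Proof.
  intros Hp Ht. unfold slope. 
  apply (continuous_RInt_param (fun s (q : space * R) => pd v f (pt v (fst q) (gt v (fst q) + s * (snd q - gt v (fst q)))))).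
  assert (L : locally ((p, t) : space * R) (fun q => ball c r (fst q) /\ Rabs (snd q - gt v c) < r)).
  { apply filter_and.
    - apply (continuous_fst p t (ball c r)). now apply ball_space_open.
    - assert (Hr : 0 < r - Rabs (t - gt v c)) by lra.
      generalize (continuous_at_locally (fun q : space * R => snd q) (p, t) _ (continuous_snd p t) Hr).
      apply filter_imp; intros q Hq. change (Rabs (snd q - t) < r - Rabs (t - gt v c)) in Hq.
      replace (snd q - gt v c) with ((snd q - t) + (t - gt v c)) by ring.
      eapply Rle_lt_trans; [apply Rabs_triang|]. lra. }
  revert L; apply filter_imp; intros [q u] [Hq Hu] s Hs; cbn [fst snd] in Hq, Hu |- *.
  apply (continuous_comp (fun y : R * (space * R) =>
    pt v (fst (snd y)) (gt v (fst (snd y)) + fst y * (snd (snd y) - gt v (fst (snd y))))) (pd v f)).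
  - assert (C1 : continuous (fun y : R * (space * R) => fst (snd y)) (s, (q, u))).
    { apply @continuous_fst_comp, @continuous_snd. }
    assert (C2 : continuous (fun y : R * (space * R) => gt v (fst (snd y))) (s, (q, u))).
    { now apply @continuous_get_comp. }
    apply (continuous_put v (fun y : R * (space * R) => fst (snd y))
      (fun y => gt v (fst (snd y)) + fst y * (snd (snd y) - gt v (fst (snd y))))); [exact C1|].
    apply continuous_Rplus; [exact C2|]. apply continuous_Rmult; [apply continuous_fst|].
    apply continuous_Rminus; [|exact C2].
    apply @continuous_snd_comp, @continuous_snd.
  - cbn [fst snd]. apply pd_cont. apply ball_put; auto. apply ball_convex1; auto.
    rewrite ball_space in Hq; apply Hq.
Qed.

(** Telescoping along the staircase [q], [m1], [m2], [q'], which changes one coordinate at a time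
    and stays in the ball because balls are boxes. Each leg contributes its increment times a
    [slope]. When [q' = q] all corners collapse and the slopes become partials. *)
Lemma hadamard : exists A : option axis -> space * space -> R,
  (forall v q q', ball c r q -> ball c r q' -> continuous (A v) (q, q')) /\
  (forall q q', ball c r q -> ball c r q' -> f q' - f q = sum3 (fun v => (gt v q' - gt v q) * A v (q, q'))) /\
  (forall v q, A v (q, q) = pd v f q).
Proof.
  set (m1 := fun y : space * space => pt (Some ax1) (fst y) (gt (Some ax1) (snd y))).
  set (m2 := fun y : space * space => pt (Some ax2) (m1 y) (gt (Some ax2) (snd y))).
  exists (fun v y => slope v f ((match v with Some ax1 => fst y | Some ax2 => m1 y | None => m2 y end), gt v (snd y))).
  assert (B : forall v q, ball c r q -> Rabs (gt v q - gt v c) < r).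
  { intros v q Hq; rewrite ball_space in Hq; apply Hq. }
  assert (B1 : forall q q', ball c r q -> ball c r q' -> ball c r (m1 (q, q'))).
  { intros; unfold m1; simpl fst; simpl snd; apply ball_put; auto. }
  assert (B2 : forall q q', ball c r q -> ball c r q' -> ball c r (m2 (q, q'))).
  { intros; unfold m2; simpl snd; apply ball_put; auto. }
  split; [|split].
  - intros v q q' Hq Hq'.
    assert (Cg : forall w, continuous (fun y : space * space => gt w (snd y)) (q, q')).
    { intros w; apply @continuous_get_comp, @continuous_snd. }
    assert (C1 : continuous m1 (q, q')).
    { apply (continuous_put (Some ax1) (fun y : space * space => fst y) (fun y => gt (Some ax1) (snd y))); [exact (continuous_fst q q')|apply Cg]. }
    assert (C2 : continuous m2 (q, q')).
    { apply (continuous_put (Some ax2) m1 (fun y => gt (Some ax2) (snd y))); [apply C1|apply Cg]. }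
    apply (continuous_comp_2 (fun y => match v with Some ax1 => fst y | Some ax2 => m1 y | None => m2 y end)
       (fun y => gt v (snd y)) (fun a b => slope v f (a, b))).
    + destruct v as [[]|]; auto. exact (continuous_fst q q').
    + apply Cg.
    + eapply continuous_ext; [intros [a b]; reflexivity|].
      apply slope_cont; [|simpl snd; auto]. destruct v as [[]|]; auto.
  - intros q q' Hq Hq'. unfold sum3. simpl snd. simpl fst.
    rewrite <- (get_put_diff (Some ax2) (Some ax1) q (gt (Some ax1) q')) by discriminate.
    assert (E : gt None q = gt None (m2 (q, q'))).
    { unfold m2, m1. now rewrite !get_put_diff by discriminate. }
    rewrite E.
    assert (E3 : q' = pt None (m2 (q, q')) (gt None q')).
    { unfold m2, m1; apply space_eq; intros [[]|]; reflexivity. }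
    rewrite <- (slope_spec (Some ax1)) by auto.
    change (pt (Some ax1) q (gt (Some ax1) q')) with (m1 (q, q')).
    rewrite <- (slope_spec (Some ax2)) by auto.
    change (pt (Some ax2) (m1 (q, q')) (gt (Some ax2) q')) with (m2 (q, q')).
    rewrite <- (slope_spec None) by auto. rewrite <- E3. ring.
  - intros v q. rewrite <- (slope_diag v q). f_equal. f_equal.
    unfold m2, m1; destruct v as [[]|]; simpl fst; simpl snd; auto; rewrite ?put_get; reflexivity.
Qed.

End Slopes.

(** The Carathéodory slopes of the components of [a], weighted by the Hadamard coefficients of [f]
    between [a t0] and [a t], add up to a Carathéodory slope of the composite. *)
Lemma chain_rule (D : space -> Prop) f (a : R -> space) (l : option axis -> R) t0 :
  open D -> CS 1 D f -> D (a t0) -> (forall v, is_derive (fun t => gt v (a t)) t0 (l v)) ->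
  is_derive (fun t => f (a t)) t0 (sum3 (fun v => l v * pd v f (a t0))).
Proof.
  intros HD Hf Ha Hl.
  destruct (open_ball _ _ HD Ha) as [r Hr].
  destruct (hadamard (a t0) r f (CS_sub _ _ _ _ Hr Hf)) as (A & A1 & A2 & A3).
  assert (HS : exists S : option axis -> R -> R, forall v, continuous (S v) t0 /\ S v t0 = l v /\
     forall t, gt v (a t) - gt v (a t0) = (t - t0) * S v t).
  { destruct (ex_derive_slope _ _ _ (Hl (Some ax1))) as (S1 & H1).
    destruct (ex_derive_slope _ _ _ (Hl (Some ax2))) as (S2 & H2).
    destruct (ex_derive_slope _ _ _ (Hl None)) as (S3 & H3).
    exists (fun v => match v with Some ax1 => S1 | Some ax2 => S2 | None => S3 end).
    intros [[]|]; assumption. }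
  destruct HS as [S HS].
  assert (Ca : continuous a t0).
  { apply continuous_to_space; intros v; apply @ex_derive_continuous; eexists; apply Hl. }
  rewrite (sum3_ext _ (fun v => S v t0 * A v (a t0, a t0))).
  2: { intros v; rewrite A3; destruct (HS v) as (_ & -> & _); reflexivity. }
  apply (is_derive_of_slope (fun t => f (a t)) (fun t => sum3 (fun v => S v t * A v (a t0, a t)))).
  - assert (C : forall v, continuous (fun t => S v t * A v (a t0, a t)) t0).
    { intros v; apply continuous_Rmult; [apply HS|].
      apply (continuous_comp_2 (fun _ => a t0) a (fun x y => A v (x, y))); [apply continuous_const|exact Ca|].
      eapply continuous_ext; [intros [x y]; reflexivity|]. apply A1; apply ball_center. }
    unfold sum3; apply continuous_Rplus; [apply continuous_Rplus|]; apply C.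
  - assert (L : locally t0 (fun t => ball (a t0) r (a t))).
    { apply (Ca (ball (a t0) r)). exists r; auto. }
    revert L; apply filter_imp; intros t Ht.
    rewrite A2; [|apply ball_center|exact Ht].
    unfold sum3; cbv beta. destruct (HS (Some ax1)) as (_ & _ & ->). destruct (HS (Some ax2)) as (_ & _ & ->).
    destruct (HS None) as (_ & _ & ->). rewrite !Rmult_assoc, <- !Rmult_plus_distr_l; reflexivity.
Qed.

Lemma locally_Rabs (x s r : R) : Rabs (s - x) < r -> locally s (fun u => Rabs (u - x) < r).
Proof.
  intros Hs; assert (H0 : 0 < r - Rabs (s - x)) by lra.
  exists (mkposreal _ H0); intros u Hu; change (Rabs (u - s) < r - Rabs (s - x)) in Hu.
  replace (u - x) with ((u - s) + (s - x)) by ring.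
  eapply Rle_lt_trans; [apply Rabs_triang|]; lra.
Qed.

(** ** Composition, mixed partials and integrals along a coordinate *)

(** The chain rule expresses a partial of the composite by partials of [f] composed with the same
    [a]; hence the induction varies [f] and keeps [a]. *)
Lemma CS_comp n (D E : space -> Prop) f (a : space -> space) : open D -> open E ->
  CS n D f -> (forall v, CS n E (fun p => gt v (a p))) -> (forall p, E p -> D (a p)) ->
  CS n E (fun p => f (a p)).
Proof.
  intros HD HE; revert f; induction n; intros f Hf Ha Hin;
  (assert (Hc : forall p, E p -> continuous (fun p => f (a p)) p) by
    (intros p Hp; apply (continuous_comp a f); [|eapply CS_cont; eauto];
     apply continuous_to_space; intros v; eapply CS_cont; eauto)).
  - split; [exact Hc|exact I].
  - apply CS_step with (fun v p => sum3 (fun w => pd v (fun q => gt w (a q)) p * pd w f (a p))); auto.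
    + intros v p Hp. pattern p at 4; rewrite <- (put_get v p) at 1.
      apply (chain_rule D f (fun t => a (pt v p t)) _ _ HD).
      * clear - Hf. induction n; [exact Hf|apply IHn; now apply CS_le].
      * rewrite put_get; auto.
      * intros w. eapply (is_pd' E n (fun q => gt w (a q))); auto.
    + intros v; unfold sum3. assert (T : forall w, CS n E (fun p => pd v (fun q => gt w (a q)) p * pd w f (a p))).
      { intros w; apply CS_mult; auto.
        - apply (CS_pd n E (fun q => gt w (a q)) v); auto.
        - apply IHn; auto using CS_le, CS_pd. }
      apply CS_plus; auto. apply CS_plus; auto.
Qed.

Lemma continuous_put_put v w p (x y : R) (g : space -> R) : v <> w -> continuous g (pt v (pt w p y) x) ->
  continuity_2d_pt (fun s t => g (pt v (pt w p t) s)) x y.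
Proof.
  intros N H; apply continuity_2d_pt_filterlim.
  apply (continuous_comp (fun z : R * R => pt v (pt w p (snd z)) (fst z)) g (x, y)); [|exact H].
  apply continuous_put; [apply continuous_put; [apply continuous_const|apply continuous_snd]|apply continuous_fst].
Qed.

Lemma pd_comm (D : space -> Prop) f v w p : open D -> CS 2 D f -> D p ->
  pd v (pd w f) p = pd w (pd v f) p.
Proof.
  intros HD Hf Hp; destruct (var_eq_dec v w) as [->|N]; [reflexivity|].
  set (x := gt v p); set (y := gt w p); set (G := fun s t => f (pt v (pt w p t) s)).
  destruct (open_ball _ _ HD Hp) as [r Hr].
  assert (HB : forall s t, Rabs (s - x) < r -> Rabs (t - y) < r -> D (pt v (pt w p t) s)).
  { intros s t Hs Ht; apply Hr, ball_put; [apply ball_put; [apply ball_center|exact Ht]|exact Hs]. }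
  assert (Dt : forall g n s t, CS (S n) D g -> Rabs (s - x) < r -> Rabs (t - y) < r ->
     is_derive (fun t => g (pt v (pt w p t) s)) t (pd w g (pt v (pt w p t) s))).
  { intros g n s t Hg Hs Ht. generalize (HB s t Hs Ht). rewrite (put_comm v w) by auto; intros H1.
    eapply is_derive_ext; [|eapply is_pd; eauto]. intros u; simpl; now rewrite (put_comm v w). }
  assert (Ds : forall g n s t, CS (S n) D g -> Rabs (s - x) < r -> Rabs (t - y) < r ->
     is_derive (fun s => g (pt v (pt w p t) s)) s (pd v g (pt v (pt w p t) s))).
  { intros g n s t Hg Hs Ht. eapply is_pd; eauto. }
  assert (E1 : forall s t, Rabs (s - x) < r -> Rabs (t - y) < r -> 
     is_derive (fun z => Derive (fun t => G z t) t) s (pd v (pd w f) (pt v (pt w p t) s))).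
  { intros s t Hs Ht. apply is_derive_ext_loc with (fun z => pd w f (pt v (pt w p t) z)).
    - generalize (locally_Rabs _ _ _ Hs); apply filter_imp; intros z Hz. symmetry; apply is_derive_unique. eapply Dt; eauto.
    - eapply Ds; eauto. apply CS_pd; eauto. }
  assert (E2 : forall s t, Rabs (s - x) < r -> Rabs (t - y) < r -> 
     is_derive (fun z => Derive (fun s => G s z) s) t (pd w (pd v f) (pt v (pt w p t) s))).
  { intros s t Hs Ht. apply is_derive_ext_loc with (fun z => pd v f (pt v (pt w p z) s)).
    - generalize (locally_Rabs _ _ _ Ht); apply filter_imp; intros z Hz. symmetry; apply is_derive_unique. eapply Ds; eauto.
    - eapply Dt; eauto. apply CS_pd; eauto. }
  assert (E0 : pt v (pt w p y) x = p) by (unfold x, y; now rewrite !put_get).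
  assert (X0 : Rabs (x - x) < r) by (rewrite Rminus_eq_0, Rabs_R0; apply cond_pos).
  assert (Y0 : Rabs (y - y) < r) by (rewrite Rminus_eq_0, Rabs_R0; apply cond_pos).
  assert (H := Schwarz G x y).
  rewrite <- E0. rewrite <- (is_derive_unique _ _ _ (E1 x y X0 Y0)), <- (is_derive_unique _ _ _ (E2 x y X0 Y0)).
  assert (LL : locally_2d (fun s t => Rabs (s - x) < r /\ Rabs (t - y) < r) x y) by (exists r; auto).
  apply H; clear H.
  - destruct LL as [d Hd]; exists d; intros s t Hs Ht; destruct (Hd s t Hs Ht) as [Hs' Ht'].
    split; [|split; [|split]]; eexists.
    + unfold G; eapply Ds; eauto.
    + unfold G; eapply Dt; eauto.
    + apply E1; auto.
    + apply E2; auto.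
  - apply continuity_2d_pt_ext_loc with (fun s t => pd v (pd w f) (pt v (pt w p t) s)).
    + destruct LL as [d Hd]; exists d; intros s t Hs Ht; destruct (Hd s t Hs Ht) as [Hs' Ht'].
      symmetry; apply is_derive_unique; auto.
    + apply continuous_put_put; auto. rewrite E0. eapply CS_cont; [apply CS_pd, CS_pd, Hf|auto].
  - apply continuity_2d_pt_ext_loc with (fun s t => pd w (pd v f) (pt v (pt w p t) s)).
    + destruct LL as [d Hd]; exists d; intros s t Hs Ht; destruct (Hd s t Hs Ht) as [Hs' Ht'].
      symmetry; apply is_derive_unique; auto.
    + apply continuous_put_put; auto. rewrite E0. eapply CS_cont; [apply CS_pd, CS_pd, Hf|auto].
Qed.

Lemma ball_get (c : space) r p v : ball c r p -> Rabs (gt v p - gt v c) < r.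
Proof. rewrite ball_space; auto. Qed.

Lemma between_ball (x y s r : R) : Rabs (y - x) < r -> Rmin x y <= s <= Rmax x y -> Rabs (s - x) < r.
Proof.
  intros H; apply Rabs_def2 in H; unfold Rmin, Rmax; destruct (Rle_dec x y); intros; apply Rabs_def1; lra.
Qed.

Definition Int v (c : space) (a : space -> R) (p : space) : R :=
  RInt (fun s => a (pt v p s)) (gt v c) (gt v p).

Lemma Int_base v c a p : gt v p = gt v c -> Int v c a p = 0.
Proof. unfold Int; intros ->; apply (RInt_point (V := R_CompleteNormedModule)). Qed.

Section Integral.
Context (c : space) (r : R) (v : option axis).

Lemma line_cont (a : space -> R) p s : (forall p, ball c r p -> continuous a p) -> ball c r p -> Rabs (s - gt v c) < r ->
  continuous (fun s => a (pt v p s)) s.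
Proof.
  intros Ha Hp Hs; apply (continuous_comp (fun s => pt v p s) a).
  - apply continuous_put; [apply continuous_const|apply continuous_id].
  - apply Ha, ball_put; auto.
Qed.

Lemma line_ex_RInt (a : space -> R) p t t' : (forall p, ball c r p -> continuous a p) -> ball c r p ->
  Rabs (t - gt v c) < r -> Rabs (t' - gt v c) < r ->
  ex_RInt (fun s => a (pt v p s)) t t'.
Proof.
  intros Ha Hp Ht Ht'; apply (ex_RInt_continuous (V := R_CompleteNormedModule)); intros s Hs.
  apply line_cont; auto.
  apply Rabs_def2 in Ht; apply Rabs_def2 in Ht'.
  revert Hs; unfold Rmin, Rmax; destruct (Rle_dec t t'); intros; apply Rabs_def1; lra.
Qed.

Lemma Int_cont (a : space -> R) p : (forall p, ball c r p -> continuous a p) -> ball c r p -> continuous (Int v c a) p.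
Proof.
  intros Ha Hp.
  (* An affine substitution moves the variable endpoint into the integrand, so the result on fixed
     limits applies. *)
  apply continuous_ext_loc with (fun q => (gt v q - gt v c) * RInt (fun s => a (pt v q (gt v c + s * (gt v q - gt v c)))) 0 1).
  - generalize (ball_space_open c r p Hp); apply filter_imp; intros q Hq.
    unfold Int. assert (Hr : 0 < r) by (eapply Rle_lt_trans; [apply Rabs_pos|apply (ball_get c r q v Hq)]).
    assert (E := RInt_comp_lin (V := R_CompleteNormedModule) (fun s => a (pt v q s)) (gt v q - gt v c) (gt v c) 0 1).
    replace ((gt v q - gt v c) * 0 + gt v c) with (gt v c) in E by ring.
    replace ((gt v q - gt v c) * 1 + gt v c) with (gt v q) in E by ring.
    rewrite <- E; [|apply line_ex_RInt; auto; [rewrite Rminus_eq_0, Rabs_R0; auto|now apply ball_get]].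
    rewrite (RInt_scal (V := R_CompleteNormedModule)).
    + unfold scal; simpl; unfold mult; simpl. f_equal.
      apply RInt_ext; intros s _. do 2 f_equal. ring.
    + apply (ex_RInt_continuous (V := R_CompleteNormedModule)); rewrite Rmin_left, Rmax_right by lra; intros s Hs.
      apply (continuous_comp (fun s => pt v q ((gt v q - gt v c) * s + gt v c)) a).
      * apply continuous_put; [apply continuous_const|].
        apply continuous_Rplus; [|apply continuous_const]. apply continuous_Rmult; [apply continuous_const|apply continuous_id].
      * apply Ha, ball_put; auto. replace ((gt v q - gt v c) * s + gt v c) with (gt v c + s * (gt v q - gt v c)) by ring.
        apply ball_convex1; auto; [rewrite Rminus_eq_0, Rabs_R0; auto|now apply ball_get].
  - apply (continuous_Rmult (fun q => gt v q - gt v c)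
      (fun q => RInt (fun s => a (pt v q (gt v c + s * (gt v q - gt v c)))) 0 1)).
    + apply continuous_Rminus; [apply continuous_get|apply continuous_const].
    + apply (continuous_RInt_param (fun s q => a (pt v q (gt v c + s * (gt v q - gt v c))))).
      generalize (ball_space_open c r p Hp); apply filter_imp; intros q Hq s Hs.
      assert (Hr : 0 < r) by (eapply Rle_lt_trans; [apply Rabs_pos|apply (ball_get c r q v Hq)]).
      apply (continuous_comp (fun y : R * space => pt v (snd y) (gt v c + fst y * (gt v (snd y) - gt v c))) a).
      * apply (continuous_put v (fun y : R * space => snd y)
          (fun y => gt v c + fst y * (gt v (snd y) - gt v c))); [exact (continuous_snd s q)|].
        apply continuous_Rplus; [apply continuous_const|]. apply continuous_Rmult; [apply continuous_fst|].
        apply continuous_Rminus; [|apply continuous_const].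
        apply @continuous_get_comp, @continuous_snd.
      * apply Ha; simpl fst; simpl snd. apply ball_put; auto.
        apply ball_convex1; auto; [rewrite Rminus_eq_0, Rabs_R0; auto|now apply ball_get].
Qed.

Lemma is_derive_Int (a : space -> R) p t : (forall p, ball c r p -> continuous a p) -> ball c r p -> Rabs (t - gt v c) < r ->
  is_derive (fun t => Int v c a (pt v p t)) t (a (pt v p t)).
Proof.
  intros Ha Hp Ht.
  assert (Hr : 0 < r) by (eapply Rle_lt_trans; [apply Rabs_pos|apply Ht]).
  apply (is_derive_RInt (V := R_NormedModule) (fun s => a (pt v p s)) (fun t => Int v c a (pt v p t)) (gt v c)).
  - generalize (locally_Rabs _ _ _ Ht); apply filter_imp; intros u Hu.
    unfold Int. rewrite get_put_same. rewrite (RInt_ext _ (fun s => a (pt v p s))) by (intros; now rewrite put_put).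
    apply (RInt_correct (V := R_CompleteNormedModule)). apply line_ex_RInt; auto. rewrite Rminus_eq_0, Rabs_R0; auto.
  - apply line_cont; auto.
Qed.

(** Along [v] the integral differentiates to [a]; in the other directions differentiation passes
    under the integral and yields the integral of [pd w a]. Thus the integral gains nothing in the
    transverse directions and keeps exactly the class of [a]. *)
Lemma CS_Int n a : CS n (ball c r) a -> CS n (ball c r) (Int v c a).
Proof.
  revert a; induction n; intros a Ha;
  (assert (Hc : forall p, ball c r p -> continuous a p) by (intros; eapply CS_cont; eauto)).
  - split; [|exact I]. intros; apply Int_cont; auto.
  - apply CS_step with (fun w => if var_eq_dec w v then a else Int v c (pd w a)).
    + apply ball_space_open.
    + intros; apply Int_cont; auto.
    + intros w p Hp. destruct (var_eq_dec w v) as [->|N].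
      * eapply is_derive_eq; [apply is_derive_Int; auto; now apply ball_get|now rewrite put_get].
      * assert (Hr : 0 < r) by (eapply Rle_lt_trans; [apply Rabs_pos|apply (ball_get c r p v Hp)]).
        assert (Hv := ball_get c r p v Hp). assert (Hw := ball_get c r p w Hp).
        assert (L := locally_Rabs _ _ _ Hw).
        assert (D1 : forall t s, Rabs (t - gt w c) < r -> Rabs (s - gt v c) < r ->
           is_derive (fun u => a (pt v (pt w p u) s)) t (pd w a (pt w (pt v p s) t))).
        { intros t s Ht Hs. eapply is_derive_ext; [|eapply is_pd; [exact Ha|]].
          - intros u; simpl. now rewrite (put_comm v w).
          - apply ball_put; auto. apply ball_put; auto. }
        eapply is_derive_ext with (fun t => RInt (fun s => a (pt v (pt w p t) s)) (gt v c) (gt v p)).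
        { intros t; unfold Int. now rewrite (get_put_diff v w) by auto. }
        eapply is_derive_eq.
        { apply (is_derive_RInt_param (fun t s => a (pt v (pt w p t) s))).
          - revert L; apply filter_imp; intros t Ht s Hs. eexists; apply D1; auto. eapply between_ball; eauto.
          - intros s Hs. assert (Hs' := between_ball _ _ _ _ Hv Hs).
            apply continuity_2d_pt_ext_loc with (fun t s => pd w a (pt w (pt v p s) t)).
            + destruct L as [d Hd]. assert (H0 : 0 < r - Rabs (s - gt v c)) by lra.
              exists (mkposreal _ (Rmin_pos _ _ (cond_pos d) H0)); intros t u Ht Hu. simpl in Ht, Hu.
              symmetry; apply is_derive_unique, D1.
              * apply Hd. apply ball_R. eapply Rlt_le_trans; [apply Ht|apply Rmin_l].
              * replace (u - gt v c) with ((u - s) + (s - gt v c)) by ring. eapply Rle_lt_trans; [apply Rabs_triang|].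
                assert (Hm := Rmin_r d (r - Rabs (s - gt v c))). lra.
            + apply continuous_put_put; auto. eapply CS_cont; [apply CS_pd; exact Ha|].
              apply ball_put; auto. apply ball_put; auto.
          - revert L; apply filter_imp; intros t Ht. apply line_ex_RInt; auto.
            apply ball_put; auto. rewrite Rminus_eq_0, Rabs_R0; auto. }
        unfold Int. apply RInt_ext; intros s Hs. simpl.
        etransitivity; [apply is_derive_unique, (D1 (gt w p) s Hw)|].
        { eapply between_ball; [exact Hv|split; apply Rlt_le, Hs]. }
        rewrite <- (put_comm v w) by auto; now rewrite put_get.
    + intros w; destruct (var_eq_dec w v); [now apply CS_le|]. apply IHn; now apply CS_pd.
Qed.

End Integral.

(** ** The fibrewise inverse of a family *)

Definition image (B : space -> Prop) (f : space -> R) : space -> Prop :=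
  fun p => exists k, B (fst p, k) /\ f (fst p, k) = snd p.

Section Inverse.
Context (c : space) (r sigma : R) (f : space -> R).
Let B : space -> Prop := ball c r.
Hypothesis Hf : forall n, CS n B f.
Hypothesis Hpos : forall p, B p -> 0 < sigma * pd None f p.

(** The factor [sigma] carries the constant sign of the last partial, so that increasing and
    decreasing fibres are treated at once. *)
Lemma fibre_increasing x k k' : B (x, k) -> B (x, k') -> k < k' -> sigma * f (x, k) < sigma * f (x, k').
Proof.
  intros Hk Hk' Hlt.
  assert (Hb : forall s, k <= s <= k' -> B (x, s)).
  { intros s Hs. apply (ball_put c r (x, k) None s Hk).
    assert (H1 := ball_get _ _ _ None Hk). assert (H2 := ball_get _ _ _ None Hk').
    simpl in *. apply Rabs_def2 in H1; apply Rabs_def2 in H2. apply Rabs_def1; lra. }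
  assert (D : forall s, k <= s <= k' -> is_derive (fun s => f (x, s)) s (pd None f (x, s))).
  { intros s Hs. apply (is_pd B 0 f None (x, k) s (Hf 1) (Hb s Hs)). }
  destruct (MVT_gen (fun s => f (x, s)) k k' (fun s => pd None f (x, s))) as [s [Hs E]].
  - rewrite Rmin_left, Rmax_right by lra. intros s Hs; apply D; lra.
  - rewrite Rmin_left, Rmax_right by lra. intros s Hs. apply continuity_pt_filterlim.
    apply (@ex_derive_continuous R_AbsRing R_NormedModule). eexists; apply D; lra.
  - rewrite Rmin_left, Rmax_right in Hs by lra.
    assert (H := Hpos _ (Hb s Hs)). apply Rlt_0_minus.
    replace (sigma * f (x, k') - sigma * f (x, k)) with (sigma * (f (x, k') - f (x, k))) by ring.
    rewrite E. replace (sigma * (pd None f (x, s) * (k' - k))) with (sigma * pd None f (x, s) * (k' - k)) by ring.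
    apply Rmult_lt_0_compat; lra.
Qed.

Lemma fibre_injective x k k' : B (x, k) -> B (x, k') -> f (x, k) = f (x, k') -> k = k'.
Proof.
  intros Hk Hk' E; destruct (Rtotal_order k k') as [H|[H|H]]; auto; exfalso.
  - generalize (fibre_increasing x k k' Hk Hk' H); rewrite E; lra.
  - generalize (fibre_increasing x k' k Hk' Hk H); rewrite E; lra.
Qed.

(** One statement behind both the openness of the image and the continuity of the inverse.
    Monotonicity puts the value at [k] strictly between those at [k - d] and [k + d]; the strict
    bracketing persists for nearby points by continuity, and the intermediate value theorem then
    produces the parameter. *)
Lemma image_near x k e : B (x, k) -> 0 < e ->
  locally ((x, f (x, k)) : space) (fun p => exists k', B (fst p, k') /\ f (fst p, k') = snd p /\ Rabs (k' - k) < e).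
Proof.
  intros Hk He.
  assert (Hr := ball_get _ _ _ None Hk). simpl in Hr.
  (* Half of [e] makes the final bound strict; half of the distance from [k] to the boundary keeps
     both endpoints [k - d] and [k + d] in the ball. *)
  set (d := Rmin (e / 2) ((r - Rabs (k - snd c)) / 2)).
  assert (Hd : 0 < d) by (unfold d; apply Rmin_pos; lra).
  assert (Hd1 : d < e) by (eapply Rle_lt_trans; [apply Rmin_l|lra]).
  assert (Hd2 : d + Rabs (k - snd c) < r).
  { assert (H := Rmin_r (e / 2) ((r - Rabs (k - snd c)) / 2)). fold d in H. lra. }
  assert (HB : forall s, Rabs (s - k) <= d -> B (x, s)).
  { intros s Hs; apply (ball_put c r (x, k) None s Hk). simpl.
    replace (s - snd c) with ((s - k) + (k - snd c)) by ring.
    eapply Rle_lt_trans; [apply Rabs_triang|]; lra. }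
  assert (Bm : B (x, k - d)) by (apply HB; replace (k - d - k) with (- d) by ring; rewrite Rabs_Ropp, Rabs_pos_eq; lra).
  assert (Bp : B (x, k + d)) by (apply HB; replace (k + d - k) with d by ring; rewrite Rabs_pos_eq; lra).
  assert (Im : sigma * f (x, k - d) < sigma * f (x, k)) by (apply fibre_increasing; auto; lra).
  assert (Ip : sigma * f (x, k) < sigma * f (x, k + d)) by (apply fibre_increasing; auto; lra).
  assert (Cs : forall s, B (x, s) -> locally ((x, f (x, k)) : space) (fun p => B (fst p, s))).
  { intros s Hs. apply (continuous_put None (fun p => p) (fun _ => s) (x, f (x, k)) (continuous_id _) (continuous_const _ _) B).
    apply (ball_space_open c r _ Hs). }
  assert (Cf : forall s, B (x, s) -> continuous (fun p : space => sigma * f (fst p, s) - sigma * snd p) (x, f (x, k))).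
  { intros s Hs. apply (continuous_Rminus (fun p : space => sigma * f (fst p, s)) (fun p => sigma * snd p)).
    - apply (continuous_Rmult (fun _ => sigma) (fun p : space => f (fst p, s))); [apply continuous_const|].
      apply (continuous_comp (fun p : space => pt None p s) f).
      + apply (continuous_put None (fun p => p) (fun _ => s)); [apply continuous_id|apply continuous_const].
      + eapply CS_cont; [apply (Hf 0)|exact Hs].
    - apply (continuous_Rmult (fun _ => sigma) (gt None)); [apply continuous_const|apply continuous_get]. }
  assert (Lm := continuous_at_locally _ _ _ (Cf _ Bm) (proj2 (Rlt_0_minus _ _) Im)).
  assert (Lp := continuous_at_locally _ _ _ (Cf _ Bp) (proj2 (Rlt_0_minus _ _) Ip)).
  generalize (filter_and _ _ (filter_and _ _ (Cs _ Bm) (Cs _ Bp)) (filter_and _ _ Lm Lp)).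
  apply filter_imp. intros p [[B1 B2] [L1 L2]]; cbn [fst snd] in L1, L2.
  apply Rabs_def2 in L1; apply Rabs_def2 in L2.
  assert (Bs : forall s, k - d <= s <= k + d -> B (fst p, s)).
  { intros s Hs. apply (ball_put c r (fst p, k - d) None s B1).
    assert (H1 := ball_get _ _ _ None B1). assert (H2 := ball_get _ _ _ None B2).
    simpl in *. apply Rabs_def2 in H1; apply Rabs_def2 in H2. apply Rabs_def1; lra. }
  assert (X1 : forall a b z w : R, a - w - (b - z) < z - b -> a - w < 0) by (intros; lra).
  assert (X2 : forall a b z w : R, - (b - z) < a - w - (b - z) -> 0 < a - w) by (intros; lra).
  destruct (Ranalysis5.IVT_interv (fun s => sigma * f (fst p, s) - sigma * snd p) (k - d) (k + d)) as [s [Hs E]].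
  - intros s Hs. apply continuity_pt_filterlim.
    apply (continuous_Rminus (fun s => sigma * f (fst p, s)) (fun _ => sigma * snd p)); [|apply continuous_const].
    apply (continuous_Rmult (fun _ => sigma) (fun s => f (fst p, s))); [apply continuous_const|].
    apply (@ex_derive_continuous R_AbsRing R_NormedModule). eexists.
    apply (is_pd B 0 f None (fst p, k - d) s (Hf 1)). apply (Bs s Hs).
  - lra.
  - exact (X1 _ _ _ _ (proj1 L1)).
  - exact (X2 _ _ _ _ (proj2 L2)).
  - exists s; split; [auto|split].
    + assert (H := Hpos _ (Bs s Hs)). assert (sigma <> 0) by (intros E0; rewrite E0 in H; lra).
      apply Rmult_eq_reg_l with sigma; auto. lra.
    + apply Rle_lt_trans with d; [|exact Hd1]. apply Rabs_le; lra.
Qed.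

(** A total function obtained by choice; its value off [image B f] is unspecified, so every fact
    about it assumes membership in the image. *)
Definition fibre_inverse (p : space) : R :=
  epsilon (inhabits 0) (fun k => B (fst p, k) /\ f (fst p, k) = snd p).
Let K := fibre_inverse.

Lemma fibre_inverse_spec p : image B f p -> B (fst p, K p) /\ f (fst p, K p) = snd p.
Proof. intros H; exact (epsilon_spec (inhabits 0) _ H). Qed.

Lemma fibre_inverse_unique p k : B (fst p, k) -> f (fst p, k) = snd p -> K p = k.
Proof.
  intros H E. destruct (fibre_inverse_spec p (ex_intro _ k (conj H E))) as [H1 E1].
  apply (fibre_injective (fst p)); auto. congruence.
Qed.

Lemma image_open : open (image B f).
Proof.
  intros [x z] (k & Hk & E); simpl in *; subst z.
  generalize (image_near x k 1 Hk Rlt_0_1). apply filter_imp. intros p (k' & H1 & H2 & _); exists k'; auto.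
Qed.

Lemma fibre_inverse_cont p : image B f p -> continuous K p.
Proof.
  intros Hp; destruct (fibre_inverse_spec p Hp) as [H E].
  apply continuous_from_locally; intros e He.
  generalize (image_near _ _ e H He). rewrite E, <- surjective_pairing.
  apply filter_imp. intros q (k' & H1 & H2 & H3). now rewrite (fibre_inverse_unique q k').
Qed.

Let graph (p : space) : space := (fst p, K p).

Lemma graph_cont p : image B f p -> continuous graph p.
Proof.
  intros Hp. apply (continuous_put None (fun p => p) K); [apply continuous_id|now apply fibre_inverse_cont].
Qed.

(** The result of differentiating [f (x, K (x, z)) = z] implicitly. The right-hand sides contain [K]
    but none of its derivatives, which is what lets the smoothness proof gain one order at a
    time. *)
Definition fibre_inverse_pd (v : option axis) (p : space) : R :=
  match v with
  | None => / pd None f (fst p, K p)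
  | Some i => - pd (Some i) f (fst p, K p) / pd None f (fst p, K p)
  end.

(** Between two points of the graph of [K], [f] changes exactly as the last coordinate does.
    Hadamard's formula is then a linear equation for the increment of [K]; solving it gives the
    difference quotient [S] in closed form, and continuity of [K] identifies its limit. *)
Lemma fibre_inverse_derive v p : image B f p ->
  is_derive (fun t => K (pt v p t)) (gt v p) (fibre_inverse_pd v p).
Proof.
  intros Hp; destruct (fibre_inverse_spec p Hp) as [HB E].
  destruct (hadamard c r f (Hf 1)) as (A & A1 & A2 & A3).
  set (Q := fun t => graph (pt v p t)).
  assert (Q0 : Q (gt v p) = graph p) by (unfold Q; now rewrite put_get).
  assert (HB' : B (graph p)) by exact HB.
  assert (CQ : continuous Q (gt v p)).
  { apply (continuous_comp (fun t => pt v p t) graph).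
    - apply continuous_put; [apply continuous_const|apply continuous_id].
    - rewrite put_get; now apply graph_cont. }
  assert (CA : forall w, continuous (fun t => A w (graph p, Q t)) (gt v p)).
  { intros w. apply (continuous_comp_2 (fun _ => graph p) Q (fun x y => A w (x, y))); [apply continuous_const|exact CQ|].
    rewrite Q0. eapply continuous_ext; [intros [x y]; reflexivity|]. apply A1; auto. }
  set (S := fun t => match v with None => / A None (graph p, Q t)
     | Some i => - A (Some i) (graph p, Q t) / A None (graph p, Q t) end).
  assert (N0 : A None (graph p, Q (gt v p)) <> 0).
  { rewrite Q0, A3. assert (H := Hpos _ HB'). intros E0. rewrite E0 in H; lra. }
  assert (ES : fibre_inverse_pd v p = S (gt v p)).
  { unfold S, fibre_inverse_pd. rewrite !Q0, !A3. destruct v as [i|]; [rewrite A3|]; reflexivity. }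
  rewrite ES. apply is_derive_of_slope.
  - unfold S. destruct v as [i|].
    + apply (continuous_Rmult (fun t => - A (Some i) (graph p, Q t)) (fun t => / A None (graph p, Q t)));
        [|apply continuous_Rinv_comp; auto].
      apply (continuous_ext (fun t => 0 - A (Some i) (graph p, Q t))); [intros; apply Rminus_0_l|].
      apply (continuous_Rminus (fun _ => 0) (fun t => A (Some i) (graph p, Q t))); [apply continuous_const|auto].
    + apply continuous_Rinv_comp; auto.
  - assert (L1 : locally (gt v p) (fun t => image B f (pt v p t))) by (apply (locally_put v p (image B f)), image_open, Hp).
    assert (L2 := continuous_at_locally _ _ _ (CA None) (Rabs_pos_lt _ N0)).
    generalize (filter_and _ _ L1 L2); apply filter_imp; intros t [Ht Hn]; cbv beta in Hn.
    assert (Nt : A None (graph p, Q t) <> 0).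
    { intros E0; rewrite E0, Rminus_0_l, Rabs_Ropp in Hn; lra. }
    destruct (fibre_inverse_spec _ Ht) as [HBt Et].
    assert (H := A2 (graph p) (Q t) HB' HBt).
    unfold Q, graph at 1 2 in H. rewrite Et, E in H. fold graph in H. fold (Q t) in H.
    rewrite put_get. apply Rmult_eq_reg_r with (A None (graph p, Q t)); auto.
    unfold S. revert H. unfold sum3.
    assert (G : forall w, w <> None -> gt w (Q t) = gt w (pt v p t) /\ gt w (graph p) = gt w p).
    { intros [[]|] Nw; [split; reflexivity|split; reflexivity|congruence]. }
    assert (GN : gt None (Q t) = K (pt v p t) /\ gt None (graph p) = K p) by (split; reflexivity).
    destruct (G (Some ax1)) as [-> ->]; [discriminate|].
    destruct (G (Some ax2)) as [-> ->]; [discriminate|]. destruct GN as [-> ->].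
    (* The linear relation in its three shapes: the first or the second independent variable moves
       and the value stays fixed, or only the value [z] moves. *)
    assert (X1 : forall u a y b K1 K0 N z : R, N <> 0 -> z - z = u * a + (y - y) * b + (K1 - K0) * N ->
      (K1 - K0) * N = u * (- a / N) * N).
    { intros u a y b K1 K0 N z HN H; replace (u * (- a / N) * N) with (- (u * a)) by (field; exact HN); lra. }
    assert (X2 : forall u a y b K1 K0 N z : R, N <> 0 -> z - z = (y - y) * b + u * a + (K1 - K0) * N ->
      (K1 - K0) * N = u * (- a / N) * N).
    { intros u a y b K1 K0 N z HN H; replace (u * (- a / N) * N) with (- (u * a)) by (field; exact HN); lra. }
    assert (X3 : forall u y b x a K1 K0 N : R, N <> 0 -> u = (y - y) * b + (x - x) * a + (K1 - K0) * N ->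
      (K1 - K0) * N = u * / N * N).
    { intros u y b x a K1 K0 N HN H; replace (u * / N * N) with u by (field; exact HN); lra. }
    change (snd (pt v p t)) with (gt None (pt v p t)). change (snd p) with (gt None p).
    destruct v as [[]|]; rewrite ?get_put_same, !get_put_diff by discriminate; intros H.
    + exact (X1 _ _ _ _ _ _ _ _ Nt H).
    + exact (X2 _ _ _ _ _ _ _ _ Nt H).
    + exact (X3 _ _ _ _ _ _ _ _ Nt H).
Qed.

Lemma fibre_inverse_smooth n : CS n (image B f) K.
Proof.
  induction n.
  - split; [|exact I]; apply fibre_inverse_cont.
  - assert (HC : forall g, CS n B g -> CS n (image B f) (fun p => g (graph p))).
    { intros g Hg. apply (CS_comp n B); auto.
      - apply ball_space_open.
      - apply image_open.
      - intros v. destruct v as [i|]; [|exact IHn].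
        apply (CS_get n _ (Some i)), image_open.
      - intros p Hp; apply (fibre_inverse_spec p Hp). }
    assert (HN : forall p, image B f p -> pd None f (graph p) <> 0).
    { intros p Hp E. assert (H := Hpos _ (proj1 (fibre_inverse_spec p Hp))). unfold graph in E. rewrite E in H; lra. }
    apply CS_step with fibre_inverse_pd.
    + apply image_open.
    + apply fibre_inverse_cont.
    + intros; now apply fibre_inverse_derive.
    + intros [i|].
      * apply CS_div; auto; [apply image_open| |apply (HC (pd None f)), CS_pd, Hf].
        apply CS_opp; [apply image_open|]. apply (HC (pd (Some i) f)), CS_pd, Hf.
      * apply CS_inv; auto; [apply image_open|apply (HC (pd None f)), CS_pd, Hf].
Qed.

Lemma fibre_inverse_pdE v p : image B f p -> pd v K p = fibre_inverse_pd v p.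
Proof. intros Hp; now apply is_derive_unique, fibre_inverse_derive. Qed.

End Inverse.

(** ** Smooth flows along a coordinate *)

Lemma derive_zero_eq (f : R -> R) a b :
  (forall s, Rmin a b <= s <= Rmax a b -> is_derive f s 0) -> f a = f b.
Proof.
  intros H; destruct (Rtotal_order a b) as [L|[->|L]]; [|reflexivity|].
  - rewrite Rmin_left, Rmax_right in H by lra; exact (eq_is_derive f a b H L).
  - rewrite Rmin_right, Rmax_left in H by lra; symmetry; exact (eq_is_derive f b a H L).
Qed.

Lemma Int_bound v c r (a : space -> R) M p : (forall q, ball c r q -> continuous a q) ->
  (forall q, ball c r q -> Rabs (a q) <= M) -> ball c r p ->
  Rabs (Int v c a p) <= Rabs (gt v p - gt v c) * M.
Proof.
  intros Hc HM Hp. assert (Hv := ball_get c r p v Hp).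
  assert (Hr : Rabs (gt v c - gt v c) < r) by (rewrite Rminus_eq_0, Rabs_R0; eapply Rle_lt_trans; [apply Rabs_pos|apply Hv]).
  unfold Int; destruct (Rle_dec (gt v c) (gt v p)) as [L|L].
  - rewrite (Rabs_pos_eq (gt v p - gt v c)) by lra. apply abs_RInt_le_const; auto.
    + eapply line_ex_RInt; eauto.
    + intros t Ht. apply HM, ball_put; auto. eapply between_ball; [exact Hv|]. rewrite Rmin_left, Rmax_right by lra; lra.
  - rewrite <- (opp_RInt_swap (V := R_CompleteNormedModule)) by (eapply line_ex_RInt; eauto).
    change (Rabs (- RInt (fun s => a (pt v p s)) (gt v p) (gt v c)) <= Rabs (gt v p - gt v c) * M).
    rewrite Rabs_Ropp, Rabs_minus_sym, (Rabs_pos_eq (gt v c - gt v p)) by lra. apply abs_RInt_le_const; [lra| |].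
    + eapply line_ex_RInt; eauto.
    + intros t Ht. apply HM, ball_put; auto. eapply between_ball; [exact Hv|]. rewrite Rmin_right, Rmax_left by lra; lra.
Qed.

Lemma Int_minus v c r (a b : space -> R) p : (forall q, ball c r q -> continuous a q) ->
  (forall q, ball c r q -> continuous b q) -> ball c r p ->
  Int v c a p - Int v c b p = Int v c (fun q => a q - b q) p.
Proof.
  intros Ha Hb Hp. assert (Hv := ball_get c r p v Hp).
  assert (Hr : Rabs (gt v c - gt v c) < r) by (rewrite Rminus_eq_0, Rabs_R0; eapply Rle_lt_trans; [apply Rabs_pos|apply Hv]).
  unfold Int; symmetry. apply (RInt_minus (V := R_CompleteNormedModule) (fun s => a (pt v p s)) (fun s => b (pt v p s)));
    eapply line_ex_RInt; eauto.
Qed.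

Lemma Int_ext_line v c (a b : space -> R) p : (forall s, Rmin (gt v c) (gt v p) < s < Rmax (gt v c) (gt v p) -> a (pt v p s) = b (pt v p s)) ->
  Int v c a p = Int v c b p.
Proof. intros H; apply RInt_ext; exact H. Qed.

Lemma pow_half_pos n : 0 < (1 / 2) ^ n.
Proof. apply pow_lt; lra. Qed.

(** Summing the increments from [n] on gives at most [2 * C * (1 / 2) ^ n]. This makes the sequence
    Cauchy, so the total operator [Lim_seq] really is its limit, and the bound passes to that
    limit. *)
Lemma geometric_limit (u : nat -> R) C : (forall n, Rabs (u (S n) - u n) <= C * (1 / 2) ^ n) ->
  forall n, Rabs (u n - Lim_seq u) <= 2 * C * (1 / 2) ^ n.
Proof.
  intros H.
  assert (HC : 0 <= C) by (specialize (H 0%nat); simpl in H; generalize (Rabs_pos (u 1%nat - u 0%nat)); lra).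
  assert (Hk : forall n k, Rabs (u (n + k)%nat - u n) <= 2 * C * (1 / 2) ^ n * (1 - (1 / 2) ^ k)).
  { intros n k; induction k.
    - rewrite Nat.add_0_r, Rminus_eq_0, Rabs_R0; simpl; lra.
    - rewrite Nat.add_succ_r. replace (u (S (n + k)) - u n) with ((u (S (n + k)) - u (n + k)%nat) + (u (n + k)%nat - u n)) by ring.
      eapply Rle_trans; [apply Rabs_triang|]. specialize (H (n + k)%nat). rewrite pow_add in H. simpl. lra. }
  assert (Hn : forall n m, (n <= m)%nat -> Rabs (u m - u n) <= 2 * C * (1 / 2) ^ n).
  { intros n m L. replace m with (n + (m - n))%nat by lia. eapply Rle_trans; [apply Hk|].
    assert (0 <= 2 * C * (1 / 2) ^ n) by (generalize (pow_half_pos n); nra).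
    generalize (pow_half_pos (m - n)); nra. }
  assert (E : ex_finite_lim_seq u).
  { apply ex_lim_seq_cauchy_corr. intros e.
    (* Two tails of size [2 * C] must fit below [e]; the added 1 keeps the denominator positive when
       [C] is 0. *)
    destruct (pow_lt_1_zero (1 / 2) ltac:(rewrite Rabs_pos_eq; lra) (e / (4 * C + 1))) as [N HN].
    { apply Rdiv_lt_0_compat; [apply cond_pos|lra]. }
    exists N; intros n m L1 L2.
    assert (HN' := HN N (Nat.le_refl N)). rewrite Rabs_pos_eq in HN' by (apply Rlt_le, pow_half_pos).
    replace (u n - u m) with ((u n - u N) - (u m - u N)) by ring.
    eapply Rle_lt_trans; [apply Rabs_triang|]. rewrite Rabs_Ropp.
    generalize (Hn N n L1) (Hn N m L2); intros G1 G2.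
    apply Rmult_lt_compat_r with (r := 4 * C + 1) in HN'; [|lra].
    replace (e / (4 * C + 1) * (4 * C + 1)) with (pos e) in HN' by (field; lra).
    generalize (pow_half_pos N); lra. }
  apply Lim_seq_correct' in E. intros n.
  assert (B : is_lim_seq (fun m => Rabs (u n - u m)) (Rabs (u n - Lim_seq u))).
  { apply (is_lim_seq_abs (fun m => u n - u m) (u n - Lim_seq u)).
    apply (is_lim_seq_minus' (fun _ => u n) u); [apply is_lim_seq_const|exact E]. }
  refine (is_lim_seq_le_loc _ _ (Rabs (u n - Lim_seq u)) (2 * C * (1 / 2) ^ n) _ B (is_lim_seq_const _)).
  exists n; intros m L. rewrite Rabs_minus_sym; auto.
Qed.

Lemma below_geometric_0 x C : (forall n : nat, Rabs x <= C * (1 / 2) ^ n) -> x = 0.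
Proof.
  intros H. destruct (Req_dec x 0) as [|N]; auto. exfalso.
  assert (Hx := Rabs_pos_lt x N).
  assert (HC : 0 < C) by (specialize (H 0%nat); simpl in H; lra).
  destruct (pow_lt_1_zero (1 / 2) ltac:(rewrite Rabs_pos_eq; lra) (Rabs x / C)) as [n Hn].
  { apply Rdiv_lt_0_compat; lra. }
  specialize (Hn n (Nat.le_refl n)). rewrite Rabs_pos_eq in Hn by (apply Rlt_le, pow_half_pos).
  apply Rmult_lt_compat_r with (r := C) in Hn; [|lra].
  replace (Rabs x / C * C) with (Rabs x) in Hn by (field; lra). specialize (H n). lra.
Qed.

Lemma geometric_small C e : 0 < e -> exists n : nat, C * (1 / 2) ^ n < e.
Proof.
  intros He. destruct (Rle_dec C 0) as [L|L].
  - exists 0%nat; simpl; lra.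
  - destruct (pow_lt_1_zero (1 / 2) ltac:(rewrite Rabs_pos_eq; lra) (e / C)) as [n Hn].
    { apply Rdiv_lt_0_compat; lra. }
    exists n. specialize (Hn n (Nat.le_refl n)). rewrite Rabs_pos_eq in Hn by (apply Rlt_le, pow_half_pos).
    apply Rmult_lt_compat_l with (r := C) in Hn; [|lra]. replace (C * (e / C)) with e in Hn by (field; lra). exact Hn.
Qed.

(** * Picard iteration with one coordinate as time and the others as parameters *)

Section Picard.
Context (v : option axis) (c : space) (r d M L : R) (h : space -> R).
Hypothesis Hh : CS 1 (ball c r) h.
Hypothesis HM : forall p, ball c r p -> Rabs (h p) <= M.
Hypothesis HL : forall p, ball c r p -> Rabs (pd None h p) <= L.
Hypotheses (Hd : 0 < d) (HM0 : 0 <= M) (Hdr : d + d * M <= r) (HdL : d * L <= 1 / 2).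
Let B : space -> Prop := ball c d.

Let graph (u : space -> R) (p : space) : space := (fst p, u p).

(** Here [d + d * M <= r] is spent: an initial value within [d] of the centre, displaced by at most
    [d * M], does not leave the ball where [h] is controlled. *)
Lemma graph_in_ball u p : B p -> Rabs (u p - snd p) <= d * M -> ball c r (graph u p).
Proof.
  intros Hp Hu. apply (ball_put c r p None).
  - eapply ball_le; [|exact Hp]. assert (0 <= d * M) by (apply Rmult_le_pos; lra). lra.
  - assert (H := ball_get _ _ _ None Hp). simpl in H |- *.
    replace (u p - snd c) with ((u p - snd p) + (snd p - snd c)) by ring.
    eapply Rle_lt_trans; [apply Rabs_triang|]. lra.
Qed.

Lemma graph_continuous (u : space -> R) p : continuous u p -> continuous (graph u) p.
Proof. intros H; apply (continuous_put None (fun p => p) u); [apply continuous_id|exact H]. Qed.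

Lemma lipschitz x k k' : ball c r (x, k) -> ball c r (x, k') -> Rabs (h (x, k') - h (x, k)) <= L * Rabs (k' - k).
Proof.
  intros Hk Hk'.
  assert (D : forall s, Rmin k k' <= s <= Rmax k k' -> ball c r (x, s)).
  { intros s Hs. apply (ball_put c r (x, k) None); auto.
    assert (H1 := ball_get _ _ _ None Hk). assert (H2 := ball_get _ _ _ None Hk'). simpl in *.
    apply Rabs_def2 in H1; apply Rabs_def2 in H2. revert Hs; unfold Rmin, Rmax; destruct (Rle_dec k k'); intros; apply Rabs_def1; lra. }
  destruct (MVT_gen (fun s => h (x, s)) k k' (fun s => pd None h (x, s))) as [s [Hs E]].
  - intros s Hs. apply (is_pd (ball c r) 0 h None (x, k) s Hh). apply (D s); split; apply Rlt_le, Hs.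
  - intros s Hs. apply continuity_pt_filterlim.
    apply (@ex_derive_continuous R_AbsRing R_NormedModule). eexists.
    apply (is_pd (ball c r) 0 h None (x, k) s Hh). now apply (D s).
  - eapply Rle_trans; [right; apply f_equal; exact E|].
    rewrite Rabs_mult; apply Rmult_le_compat_r; [apply Rabs_pos|]. apply HL; auto.
Qed.

Fixpoint picard (n : nat) : space -> R :=
  match n with
  | O => snd
  | S n => fun p => snd p + Int v c (fun q => h (graph (picard n) q)) p
  end.

(** The set preserved by the Picard map; on it the integrand is defined inside the ball and
    continuous. *)
Definition near_snd (u : space -> R) : Prop := forall p, B p -> continuous u p /\ Rabs (u p - snd p) <= d * M.

Lemma near_snd_comp u p : near_snd u -> B p -> continuous (fun q => h (graph u q)) p.
Proof.
  intros Hu Hp; destruct (Hu p Hp) as [H1 H2].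
  apply (continuous_comp (graph u) h); [now apply graph_continuous|].
  eapply CS_cont; [exact Hh|now apply graph_in_ball].
Qed.

Lemma near_snd_step u : near_snd u -> near_snd (fun p => snd p + Int v c (fun q => h (graph u q)) p).
Proof.
  intros Hu p Hp; split.
  - apply (continuous_Rplus (gt None) (Int v c (fun q => h (graph u q)))); [apply continuous_get|].
    apply Int_cont with d; auto. intros q Hq; now apply near_snd_comp.
  - replace (snd p + Int v c (fun q => h (graph u q)) p - snd p) with (Int v c (fun q => h (graph u q)) p) by ring.
    eapply Rle_trans; [apply (Int_bound v c d _ M); auto|].
    + intros q Hq; now apply near_snd_comp.
    + intros q Hq. apply HM, graph_in_ball; auto. apply Hu; auto.
    + apply Rmult_le_compat_r; auto. apply Rlt_le, (ball_get c d p v Hp).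
Qed.

Lemma picard_near n : near_snd (picard n).
Proof.
  induction n; simpl; [|now apply near_snd_step].
  intros p _; split; [apply (continuous_get None)|]. rewrite Rminus_eq_0, Rabs_R0. apply Rmult_le_pos; lra.
Qed.

(** The contraction estimate, with ratio 1/2 supplied by [d * L <= 1 / 2]. *)
Lemma Int_diff_bound u w e p : near_snd u -> near_snd w -> 0 <= e -> (forall q, B q -> Rabs (u q - w q) <= e) -> B p ->
  Rabs (Int v c (fun q => h (graph u q)) p - Int v c (fun q => h (graph w q)) p) <= e / 2.
Proof.
  intros Hu Hw He H Hp.
  rewrite (Int_minus v c d); auto; try (intros; now apply near_snd_comp).
  eapply Rle_trans; [apply (Int_bound v c d _ (L * e)); auto|].
  - intros q Hq. apply (continuous_Rminus (fun q => h (graph u q)) (fun q => h (graph w q))); now apply near_snd_comp.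
  - intros q Hq. eapply Rle_trans; [apply lipschitz; apply graph_in_ball; auto; [apply Hw|apply Hu]; auto|].
    apply Rmult_le_compat_l; auto. eapply Rle_trans; [apply Rabs_pos|apply (HL (graph u q)), graph_in_ball; auto; now apply Hu].
  - assert (H0 : 0 <= L) by (eapply Rle_trans; [apply Rabs_pos|apply (HL (graph u p)), graph_in_ball; auto; now apply Hu]).
    apply Rle_trans with (d * (L * e)).
    + apply Rmult_le_compat_r; [nra|]. apply Rlt_le, (ball_get c d p v Hp).
    + replace (d * (L * e)) with (d * L * e) by ring. nra.
Qed.

Lemma picard_step n p : B p -> Rabs (picard (S n) p - picard n p) <= d * M * (1 / 2) ^ n.
Proof.
  assert (H0 : 0 <= d * M) by (apply Rmult_le_pos; lra).
  revert p; induction n; intros p Hp.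
  - rewrite pow_O, Rmult_1_r. apply (near_snd_step (picard 0) (picard_near 0) p Hp).
  - change (picard (S (S n)) p) with (snd p + Int v c (fun q => h (graph (picard (S n)) q)) p).
    change (picard (S n) p) with (snd p + Int v c (fun q => h (graph (picard n) q)) p).
    set (a := Int v c (fun q => h (graph (picard (S n)) q)) p). set (b := Int v c (fun q => h (graph (picard n) q)) p).
    replace (snd p + a - (snd p + b)) with (a - b) by ring.
    eapply Rle_trans; [apply (Int_diff_bound _ _ (d * M * (1 / 2) ^ n)); auto using picard_near|].
    + generalize (pow_half_pos n); nra.
    + simpl; lra.
Qed.

(** With [v] as time, this is the solution that has the value [snd p] at the time of the centre [c].
    Keeping the initial value as the last coordinate of [p] makes a flow already a one-parametric
    family. *)
Definition flow (p : space) : R := Lim_seq (fun n => picard n p).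

Lemma flow_approx n p : B p -> Rabs (picard n p - flow p) <= 2 * (d * M) * (1 / 2) ^ n.
Proof. intros Hp; apply (geometric_limit (fun n => picard n p)). intros m; now apply picard_step. Qed.

Lemma flow_near : near_snd flow.
Proof.
  intros p Hp; split.
  - apply continuous_from_locally; intros e He.
    destruct (geometric_small (2 * (d * M)) (e / 3)) as [n Hn]; [lra|].
    destruct (picard_near n p Hp) as [Hc _].
    assert (He3 : 0 < e / 3) by lra.
    generalize (filter_and _ _ (ball_space_open c d p Hp) (continuous_at_locally _ _ _ Hc He3)).
    apply filter_imp; intros q [Hq H].
    assert (H1 := flow_approx n p Hp). assert (H2 := flow_approx n q Hq).
    replace (flow q - flow p) with ((picard n q - picard n p) - (picard n q - flow q) + (picard n p - flow p)) by ring.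
    eapply Rle_lt_trans; [apply Rabs_triang|]. eapply Rle_lt_trans; [apply Rplus_le_compat_r, Rabs_triang|].
    rewrite Rabs_Ropp. lra.
  (* A violation of the closed bound would have a fixed positive size, whereas the iterates obey the
     bound and come arbitrarily close to [flow p]. *)
  - apply Rnot_lt_le; intros Hlt.
    destruct (geometric_small (2 * (d * M)) (Rabs (flow p - snd p) - d * M)) as [n Hn]; [lra|].
    destruct (picard_near n p Hp) as [_ H]. assert (H1 := flow_approx n p Hp).
    assert (H2 := Rabs_triang (picard n p - snd p) (- (picard n p - flow p))).
    rewrite Rabs_Ropp in H2. replace (picard n p - snd p + - (picard n p - flow p)) with (flow p - snd p) in H2 by ring. lra.
Qed.

(** The defect splits into the distance from [picard (S n)] to the limit and the contracted distance
    from [picard n] to it. Both decay like [(1 / 2) ^ n] and [n] is arbitrary, so the defect is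
    zero. *)
Lemma flow_eq p : B p -> flow p = snd p + Int v c (fun q => h (graph flow q)) p.
Proof.
  intros Hp. apply Rminus_diag_uniq.
  assert (H0 : 0 <= d * M) by (apply Rmult_le_pos; lra).
  apply (below_geometric_0 _ (4 * (d * M))). intros n.
  assert (H1 := flow_approx (S n) p Hp).
  assert (H2 : Rabs (Int v c (fun q => h (graph (picard n) q)) p - Int v c (fun q => h (graph flow q)) p)
     <= 2 * (d * M) * (1 / 2) ^ n / 2).
  { apply Int_diff_bound; auto using picard_near, flow_near.
    - generalize (pow_half_pos n); nra.
    - intros; now apply flow_approx. }
  change (picard (S n) p) with (snd p + Int v c (fun q => h (graph (picard n) q)) p) in H1.
  set (a := Int v c (fun q => h (graph (picard n) q)) p) in *. set (b := Int v c (fun q => h (graph flow q)) p) in *.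
  replace (flow p - (snd p + b)) with (- (snd p + a - flow p) + (a - b)) by ring.
  eapply Rle_trans; [apply Rabs_triang|]. rewrite Rabs_Ropp. simpl in H1. generalize (pow_half_pos n); nra.
Qed.

Lemma flow_in p : B p -> ball c r (fst p, flow p).
Proof. intros Hp; apply (graph_in_ball flow); auto; now apply flow_near. Qed.

End Picard.

(** * Smooth dependence of the flow on time, initial value and remaining variable *)

Section FlowSmooth.
Context (i : axis) (c : space) (r d : R) (h phi : space -> R).
Let v : option axis := Some i.
Let B : space -> Prop := ball c d.
Let g (p : space) : space := (fst p, phi p).
Hypothesis Hh : CS 1 (ball c r) h.
Hypothesis phi_cont : forall p, B p -> continuous phi p.
Hypothesis phi_in : forall p, B p -> ball c r (fst p, phi p).
Hypothesis phi_eq : forall p, B p -> phi p = snd p + Int v c (fun q => h (fst q, phi q)) p.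

Lemma flow_graph_cont p : B p -> continuous g p.
Proof. intros H; apply (continuous_put None (fun p => p) phi); [apply continuous_id|now apply phi_cont]. Qed.

Lemma flow_comp_cont (a : space -> R) p : (forall q, ball c r q -> continuous a q) -> B p ->
  continuous (fun q => a (g q)) p.
Proof. intros Ha Hp; apply (continuous_comp g a); [now apply flow_graph_cont|apply Ha, phi_in, Hp]. Qed.

Lemma h_cont q : ball c r q -> continuous h q.
Proof. intros Hq; eapply CS_cont; [exact Hh|exact Hq]. Qed.

Lemma flow_time p s : B p -> Rabs (s - gt v c) < d ->
  is_derive (fun t => phi (pt v p t)) s (h (g (pt v p s))).
Proof.
  intros Hp Hs.
  apply is_derive_ext_loc with (fun t => snd p + Int v c (fun q => h (g q)) (pt v p t)).
  - generalize (locally_Rabs _ _ _ Hs); apply filter_imp; intros t Ht.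
    symmetry; apply (phi_eq (pt v p t)), ball_put; auto.
  - eapply is_derive_eq.
    + apply is_derive_Rplus; [apply (is_derive_const (K := R_AbsRing) (V := R_NormedModule))|].
      apply (is_derive_Int c d v (fun q => h (g q))); auto.
      intros q Hq. apply flow_comp_cont; auto using h_cont.
    + apply Rplus_0_l.
Qed.

Lemma flow_initial p : B p -> gt v p = gt v c -> phi p = gt None p.
Proof. intros Hp E; rewrite phi_eq, Int_base by auto; apply Rplus_0_r. Qed.

(** The fundamental solution of the linearised equation along a trajectory, equal to 1 at the
    initial time; being an exponential, it shows that the flow is increasing in its initial
    value. *)
Definition flow_exp (p : space) : R := exp (Int v c (fun q => pd None h (g q)) p).

(** Records how a coordinate enters: 0 for the last one, which acts through the initial value, 1 for
    an independent variable, which acts through [h]. The same flag occurs in [pd_graph], since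
    [(fst p, f p)] keeps the independent variables and replaces the last coordinate. *)
Definition param_flag (w : option axis) : R := match w with None => 0 | Some _ => 1 end.

(** Variation of constants for the linearised equation: initial value 1 and no source when the
    initial value is varied, initial value 0 and source [pd w h] when an independent variable is. *)
Definition flow_pd (w : option axis) (p : space) : R :=
  flow_exp p * ((1 - param_flag w) +
    param_flag w * Int v c (fun q => / flow_exp q * pd w h (g q)) p).

(* The difference of two solutions satisfies the linear equation with the Hadamard
   coefficients of [h], so the difference quotient has a closed form, continuous in
   the parameter. *)
Lemma flow_param w p : w <> v -> B p ->
  is_derive (fun t => phi (pt w p t)) (gt w p) (flow_pd w p).
Proof.
  intros Nw Hp. set (t0 := gt w p). set (e := param_flag w).
  assert (Nv : v <> w) by congruence.
  assert (Ht0 : Rabs (t0 - gt w c) < d) by (apply ball_get, Hp).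
  destruct (hadamard c r h Hh) as (A & A1 & A2 & A3).
  set (alpha := fun u q => A u (g (pt w q t0), g q)).
  assert (BP : forall q, B q -> B (pt w q t0)) by (intros q Hq; apply ball_put; auto).
  assert (Ca : forall u q, B q -> continuous (alpha u) q).
  { intros u q Hq. apply (continuous_comp_2 (fun q => g (pt w q t0)) g (fun x y => A u (x, y))).
    - apply (continuous_comp (fun q => pt w q t0) g).
      + apply (continuous_put w (fun q => q) (fun _ => t0)); [apply continuous_id|apply continuous_const].
      + apply flow_graph_cont; auto.
    - apply flow_graph_cont; auto.
    - eapply continuous_ext; [intros [x y]; reflexivity|]. apply A1; apply phi_in; auto. }
  set (G := Int v c (alpha None)).
  assert (CG : forall q, B q -> continuous G q) by (intros q Hq; apply Int_cont with d; auto).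
  assert (Cexp : forall (u : space -> R) q, continuous u q -> continuous (fun q => exp (u q)) q).
  { intros u q Hu. apply (continuous_comp u exp); [exact Hu|]. apply (@ex_derive_continuous R_AbsRing R_NormedModule).
    eexists; apply is_derive_exp. }
  set (b := fun q => / exp (G q) * alpha w q).
  assert (Cb : forall q, B q -> continuous b q).
  { intros q Hq; apply (continuous_Rmult (fun q => / exp (G q)) (alpha w)); auto.
    apply continuous_Rinv_comp; auto. apply Rgt_not_eq, exp_pos. }
  set (S := fun q => exp (G q) * ((1 - e) + e * Int v c b q)).
  assert (CS' : forall q, B q -> continuous S q).
  { intros q Hq. apply (continuous_Rmult (fun q => exp (G q)) (fun q => (1 - e) + e * Int v c b q)); auto.
    apply (continuous_Rplus (fun _ => 1 - e) (fun q => e * Int v c b q)); [apply continuous_const|].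
    apply (continuous_Rmult (fun _ => e) (Int v c b)); [apply continuous_const|]. apply Int_cont with d; auto. }
  assert (Key : forall q, B q -> phi q - phi (pt w q t0) = (gt w q - t0) * S q).
  { intros q Hq.
    set (De := fun s => phi (pt v q s) - phi (pt v (pt w q t0) s)).
    assert (Hv := ball_get _ _ _ v Hq). fold v in Hv.
    (* Both trajectories are read at the same time, so the time coordinate contributes nothing to
       Hadamard's sum. The increment of [w] appears as a source term only if [w] is an independent
       variable. *)
    assert (Had : forall s, Rabs (s - gt v c) < d -> h (g (pt v q s)) - h (g (pt v (pt w q t0) s)) =
       De s * alpha None (pt v q s) + e * (gt w q - t0) * alpha w (pt v q s)).
    { intros s Hs. rewrite (A2 (g (pt v (pt w q t0) s)) (g (pt v q s))) by (apply phi_in, ball_put; auto; apply (BP q Hq)).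
      unfold alpha. rewrite <- !(put_comm v w) by auto.
      assert (GS : forall j p, gt (Some j) (g p) = gt (Some j) p) by reflexivity.
      assert (GN : forall p, gt None (g p) = phi p) by reflexivity.
      set (P1 := g (pt v (pt w q t0) s)). set (P2 := g (pt v q s)).
      assert (E1 : forall j, Some j <> w -> gt (Some j) P2 - gt (Some j) P1 = 0).
      { intros j Nj. unfold P1, P2. rewrite !GS.
        destruct (var_eq_dec (Some j) v) as [->|Nj'].
        - rewrite !get_put_same; ring.
        - rewrite !get_put_diff by auto; ring. }
      assert (E2 : w <> None -> gt w P2 - gt w P1 = gt w q - t0).
      { intros Nn. unfold P1, P2. destruct w as [j|]; [|congruence]. rewrite !GS.
        rewrite (get_put_diff (Some j) v), (get_put_diff (Some j) v), get_put_same by auto; reflexivity. }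
      unfold sum3. change (gt None P2 - gt None P1) with (De s).
      clear - E1 E2. unfold e. destruct w as [[]|]; simpl param_flag.
      - rewrite (E1 ax2), E2 by discriminate.
        assert (X : forall x a b y z : R, x * a + 0 * b + y * z = y * z + 1 * x * a) by (intros; ring). apply X.
      - rewrite (E1 ax1), E2 by discriminate.
        assert (X : forall x a b y z : R, 0 * b + x * a + y * z = y * z + 1 * x * a) by (intros; ring). apply X.
      - rewrite (E1 ax1), (E1 ax2) by discriminate.
        assert (X : forall x a b y z : R, 0 * a + 0 * b + y * z = y * z + 0 * x * z) by (intros; ring). apply X. }
    (* Integrating factor times the difference of the trajectories, minus what variation of
       constants predicts. Zero derivative and zero initial value make it vanish, which is [Key]. *)
    set (y := fun s => / exp (G (pt v q s)) * De s - (gt w q - t0) * ((1 - e) + e * Int v c b (pt v q s))).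
    assert (D : forall s, Rabs (s - gt v c) < d -> is_derive y s 0).
    { intros s Hs.
      assert (DG : is_derive (fun s => G (pt v q s)) s (alpha None (pt v q s))) by (apply (is_derive_Int c d v); auto).
      assert (DJ : is_derive (fun s => Int v c b (pt v q s)) s (b (pt v q s))) by (apply (is_derive_Int c d v); auto).
      assert (DD : is_derive De s (h (g (pt v q s)) - h (g (pt v (pt w q t0) s)))).
      { apply is_derive_Rminus; apply flow_time; auto. }
      assert (NE : exp (G (pt v q s)) <> 0) by apply Rgt_not_eq, exp_pos.
      eapply is_derive_eq.
      - apply is_derive_Rminus.
        + apply is_derive_Rmult; [|exact DD]. apply is_derive_Rinv; [exact NE|].
          apply (is_derive_Rcomp exp (fun s => G (pt v q s))); [apply is_derive_exp|exact DG].
        + apply (is_derive_Rmult (fun _ => gt w q - t0)); [apply (is_derive_const (K := R_AbsRing) (V := R_NormedModule))|].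
          apply (is_derive_Rplus (fun _ => 1 - e)); [apply (is_derive_const (K := R_AbsRing) (V := R_NormedModule))|].
          apply (is_derive_Rmult (fun _ => e)); [apply (is_derive_const (K := R_AbsRing) (V := R_NormedModule))|exact DJ].
      - rewrite Had by auto. unfold b. change (@zero R_NormedModule) with 0. field. exact NE. }
    assert (Hd0 : Rabs (gt v c - gt v c) < d) by (rewrite Rminus_eq_0, Rabs_R0; eapply Rle_lt_trans; [apply Rabs_pos|exact Hv]).
    assert (Y0 : y (gt v c) = 0).
    (* At the initial time each trajectory equals its own last coordinate. The two therefore differ
       by [gt w q - t0] if the initial value is varied and by nothing otherwise, in agreement with
       the factor [1 - e]. *)
    { unfold y, De, G. rewrite !Int_base by apply get_put_same.
      rewrite !flow_initial; try apply get_put_same; try (apply ball_put; auto).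
      rewrite exp_0, Rinv_1.
      rewrite !(get_put_diff None v) by discriminate.
      2: exact (BP q Hq).
      unfold e. destruct w as [j|]; simpl param_flag.
      - rewrite (get_put_diff None (Some j)) by discriminate. ring.
      - rewrite get_put_same. ring. }
    assert (Y1 : y (gt v c) = y (gt v q)).
    { apply derive_zero_eq. intros s Hs. exact (D s (between_ball _ _ _ _ Hv Hs)). }
    rewrite Y0 in Y1. unfold y, De in Y1.
    rewrite (put_comm v w) in Y1 by auto. rewrite put_get in Y1.
    unfold S. assert (NE : exp (G q) <> 0) by apply Rgt_not_eq, exp_pos.
    set (X := phi q - phi (pt w q t0)) in *. set (Z := (gt w q - t0)) in *. set (W := 1 - e + e * Int v c b q) in *.
    assert (E1 : / exp (G q) * X = Z * W) by lra.
    replace X with (exp (G q) * (/ exp (G q) * X)) by (field; exact NE). rewrite E1. ring. }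
  (* Where [w] equals [t0] the two compared points coincide, so the Hadamard coefficients become
     partials of [h] and [S] turns into [flow_pd]. *)
  assert (Gline : forall q, gt w q = t0 -> G q = Int v c (fun q => pd None h (g q)) q).
  { intros q Hq. apply Int_ext_line. intros s _. unfold alpha.
    replace (pt w (pt v q s) t0) with (pt v q s); [apply A3|].
    rewrite <- Hq, <- (put_comm v w) by auto. now rewrite put_get. }
  assert (ES : S p = flow_pd w p).
  { unfold S, flow_pd, flow_exp. rewrite (Gline p) by reflexivity. fold e.
    do 3 f_equal. apply Int_ext_line. intros s _. unfold b.
    assert (Eg : gt w (pt v p s) = t0) by (rewrite get_put_diff; auto).
    rewrite (Gline _ Eg). f_equal. unfold alpha.
    replace (pt w (pt v p s) t0) with (pt v p s); [apply A3|]. unfold t0.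
    rewrite <- (put_comm v w) by auto. now rewrite put_get. }
  rewrite <- ES. unfold t0. rewrite <- (put_get w p) at 2.
  apply (is_derive_of_slope (fun t => phi (pt w p t)) (fun t => S (pt w p t))).
  - apply (continuous_comp (fun t => pt w p t) S).
    + apply (continuous_put w (fun _ => p) (fun t => t)); [apply continuous_const|apply continuous_id].
    + rewrite put_get; auto.
  - generalize (locally_Rabs _ _ _ Ht0); apply filter_imp; intros t Ht.
    assert (H := Key (pt w p t) (ball_put c d p w t Hp Ht)). rewrite put_put, get_put_same in H. exact H.
Qed.

Lemma flow_exp_pos p : 0 < flow_exp p.
Proof. apply exp_pos. Qed.

(* [d_i phi = h(x, phi)] and the formulas for the other partials involve only [phi],
   not its derivatives: one more derivative is gained at each step. *)
Lemma CS_flow : (forall n, CS n (ball c r) h) -> forall n, CS n B phi.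
Proof.
  intros Hs n; assert (Bo : open B) by apply ball_space_open.
  induction n.
  - split; [exact phi_cont|exact I].
  - assert (HC : forall a, CS n (ball c r) a -> CS n B (fun p => a (g p))).
    { intros a Ha. apply (CS_comp n (ball c r)); auto.
      - apply ball_space_open.
      - intros [j|]; [|exact IHn]. apply (CS_get n _ (Some j)), Bo. }
    assert (HE : CS n B flow_exp).
    { apply CS_exp; auto. apply CS_Int, (HC (pd None h)), CS_pd, Hs. }
    apply CS_step with (fun w => if var_eq_dec w v then fun p => h (g p) else flow_pd w); auto.
    + intros w p Hp; destruct (var_eq_dec w v) as [->|N].
      * generalize (flow_time p (gt v p) Hp (ball_get _ _ _ v Hp)). now rewrite put_get.
      * now apply flow_param.
    + intros w; destruct (var_eq_dec w v) as [_|N]; [apply HC, Hs|].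
      unfold flow_pd. apply CS_mult; auto. apply CS_plus; auto; [apply CS_const|].
      apply CS_mult; auto; [apply CS_const|].
      apply CS_Int. apply CS_mult; auto; [|apply (HC (pd w h)), CS_pd, Hs].
      apply CS_inv; auto. intros; apply Rgt_not_eq, flow_exp_pos.
Qed.

End FlowSmooth.

Lemma locally_bounded (f : space -> R) c : continuous f c -> locally c (fun p => Rabs (f p) <= Rabs (f c) + 1).
Proof.
  intros H; generalize (continuous_at_locally f c 1 H Rlt_0_1); apply filter_imp; intros p Hp.
  replace (f p) with ((f p - f c) + f c) by ring. eapply Rle_trans; [apply Rabs_triang|]. lra.
Qed.

Lemma flow_exists i (D : SP -> Prop) h (c : SP) : open D -> D c -> (forall n, CS n D h) ->
  exists (d : posreal) (phi : space -> R),
    (forall n, CS n (ball c d) phi) /\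
    (forall p, ball c d p -> D (fst p, phi p)) /\
    (forall p, ball c d p -> pd (Some i) phi p = h (fst p, phi p)) /\
    (forall p, ball c d p -> gt (Some i) p = gt (Some i) c -> phi p = snd p) /\
    (forall p, ball c d p -> 0 < pd None phi p).
Proof.
  intros HD Hc Hh.
  assert (C0 : continuous h c) by (eapply CS_cont; [apply (Hh 0%nat)|exact Hc]).
  assert (C1 : continuous (pd None h) c) by (eapply CS_cont; [apply CS_pd, (Hh 1%nat)|exact Hc]).
  destruct (filter_and _ _ (HD c Hc) (filter_and _ _ (locally_bounded _ _ C0) (locally_bounded _ _ C1))) as [r Hr].
  set (M := Rabs (h c) + 1) in *. set (L := Rabs (pd None h c) + 1) in *.
  assert (HM : 1 <= M) by (unfold M; generalize (Rabs_pos (h c)); lra).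
  assert (HL : 1 <= L) by (unfold L; generalize (Rabs_pos (pd None h c)); lra).
  (* The two entries are exactly what yields [d + d * M <= r] and [d * L <= 1 / 2]. *)
  set (d := Rmin (r / (1 + M)) (/ (2 * L))).
  assert (Hd : 0 < d).
  { unfold d; apply Rmin_pos; [apply Rdiv_lt_0_compat; [apply cond_pos|lra]|apply Rinv_0_lt_compat; lra]. }
  assert (Hd1 : d + d * M <= r).
  { replace (d + d * M) with (d * (1 + M)) by ring. apply Rle_trans with (r / (1 + M) * (1 + M)).
    - apply Rmult_le_compat_r; [lra|apply Rmin_l].
    - right; field; lra. }
  assert (Hd2 : d * L <= 1 / 2).
  { apply Rle_trans with (/ (2 * L) * L); [apply Rmult_le_compat_r; [lra|apply Rmin_r]|right; field; lra]. }
  assert (Hs : forall n, CS n (ball c r) h) by (intros n; apply CS_sub with D; auto; intros p Hp; apply (Hr p Hp)).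
  set (v := Some i). set (phi := flow v c h).
  assert (HM' : forall p, ball c r p -> Rabs (h p) <= M) by (intros p Hp; apply (Hr p Hp)).
  assert (HL' : forall p, ball c r p -> Rabs (pd None h p) <= L) by (intros p Hp; apply (Hr p Hp)).
  assert (HM0 : 0 <= M) by lra.
  assert (Pc : forall p, ball c d p -> continuous phi p).
  { intros p Hp. apply (flow_near v c r d M L h (Hs 1%nat) HM' HL' Hd HM0 Hd1 Hd2 p Hp). }
  assert (Pi : forall p, ball c d p -> ball c r (fst p, phi p)).
  { intros p Hp. apply (flow_in v c r d M L h (Hs 1%nat) HM' HL' Hd HM0 Hd1 Hd2 p Hp). }
  assert (Pe : forall p, ball c d p -> phi p = snd p + Int v c (fun q => h (fst q, phi q)) p).
  { intros p Hp. apply (flow_eq v c r d M L h (Hs 1%nat) HM' HL' Hd HM0 Hd1 Hd2 p Hp). }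
  exists (mkposreal d Hd), phi; simpl pos. split; [|split; [|split; [|split]]].
  - now apply (CS_flow i c r d h phi (Hs 1%nat)).
  - intros p Hp; apply (Hr _ (Pi p Hp)).
  - intros p Hp; apply is_derive_unique.
    assert (T := flow_time i c r d h phi (Hs 1%nat) Pc Pi Pe p (gt (Some i) p) Hp (ball_get _ _ _ _ Hp)).
    rewrite put_get in T; exact T.
  - intros p Hp E. now apply (flow_initial i c d h phi).
  - intros p Hp.
    assert (T := flow_param i c r d h phi (Hs 1%nat) Pc Pi Pe None p ltac:(discriminate) Hp).
    apply is_derive_unique in T. eapply Rlt_le_trans; [|right; symmetry; exact T].
    unfold flow_pd; simpl param_flag. rewrite Rmult_0_l, Rminus_0_r, Rplus_0_r, Rmult_1_r. apply exp_pos.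
Qed.

(** ** The reduction condition *)

Notation u1 j i := (j (ind_u1 i)).

Lemma total_D_lift k (g : space -> R) j :
  total_D k (lift g) j = pd (Some k) g (base j) + u1 j k * pd None g (base j).
Proof.
  assert (E : forall m, partial (jet_coord (ind_u1 m)) (lift g) j = 0).
  { intros m; unfold partial. transitivity (Derive (fun _ => g (base j)) (j (ind_u1 m))); [|apply Derive_const].
    destruct m; reflexivity. }
  unfold total_D, sum_axis. rewrite !E.
  change (partial (jet_coord U) (lift g) j) with (pd None g (base j)).
  replace (partial (jet_coord (ind_x k)) (lift g) j) with (pd (Some k) g (base j)); [ring|].
  destruct k; reflexivity.
Qed.

Lemma pd_const v k (p : space) : pd v (fun _ => k) p = 0.
Proof. unfold partial; apply Derive_const. Qed.

Lemma prolong1_axis_field i zeta k j :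
  prolong1 (axis_field i zeta) k j = pd (Some k) zeta (base j) + u1 j k * pd None zeta (base j).
Proof.
  unfold prolong1, sum_axis. rewrite !total_D_lift. simpl xi. rewrite !pd_const. simpl eta. ring.
Qed.

Lemma partial_ext {T} (c : coordinate T) f g p : (forall q, f q = g q) -> partial c f p = partial c g p.
Proof. intros H; apply Derive_ext; intros; apply H. Qed.

Section Jets.
Context (F : R -> R) (J : R -> Prop) (i : axis) (W : SP -> Prop) (zeta : space -> R).
Hypothesis HF : smooth_line J F.
Hypothesis HW : open W.
Hypothesis HJ : forall p, W p -> J (snd p).
Hypothesis Hz : forall n, CS n W zeta.

(** The [xi] are constant and contribute nothing, leaving [D_2 D_1 zeta]; the term with [U12] arises
    because [prolong1] depends on the jet coordinate [U1]. *)
Lemma prolong2_axis_field j : W (base j) ->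
  prolong2 (axis_field i zeta) ax1 ax2 j =
    pd (Some ax2) (pd (Some ax1) zeta) (base j) + u1 j ax1 * pd (Some ax2) (pd None zeta) (base j)
    + u1 j ax2 * (pd None (pd (Some ax1) zeta) (base j) + u1 j ax1 * pd None (pd None zeta) (base j))
    + j U12 * pd None zeta (base j).
Proof.
  intros Hj.
  assert (D : forall v w, is_derive (fun t => pd w zeta (pt v (base j) t)) (gt v (base j)) (pd v (pd w zeta) (base j))).
  { intros v w; eapply (is_pd' W 0); [apply CS_pd, (Hz 2)|exact Hj]. }
  assert (DS : forall v, Derive (fun t => pd (Some ax1) zeta (pt v (base j) t) + j U1 * pd None zeta (pt v (base j) t)) (gt v (base j)) =
    pd v (pd (Some ax1) zeta) (base j) + j U1 * pd v (pd None zeta) (base j)).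
  { intros v. apply is_derive_unique. eapply is_derive_eq.
    - apply is_derive_Rplus; [apply D|]. apply (is_derive_Rmult (fun _ => j U1)); [|apply D].
      apply (is_derive_const (K := R_AbsRing) (V := R_NormedModule)).
    - change (@zero R_NormedModule) with 0; ring. }
  unfold prolong2, sum_axis. rewrite !total_D_lift. simpl xi. rewrite !pd_const.
  unfold total_D, sum_axis.
  rewrite !(partial_ext _ (prolong1 (axis_field i zeta) ax1) _ j (prolong1_axis_field i zeta ax1)).
  (* Updating a single jet coordinate either updates one coordinate of [base], or affects only the
     factor [u_1], or does nothing. Each jet partial is thus convertible to an ordinary derivative
     along a line. *)
  change (partial (jet_coord (ind_x ax2)) (fun q => pd (Some ax1) zeta (base q) + u1 q ax1 * pd None zeta (base q)) j)
    with (Derive (fun t => pd (Some ax1) zeta (pt (Some ax2) (base j) t) + j U1 * pd None zeta (pt (Some ax2) (base j) t)) (gt (Some ax2) (base j))).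
  change (partial (jet_coord U) (fun q => pd (Some ax1) zeta (base q) + u1 q ax1 * pd None zeta (base q)) j)
    with (Derive (fun t => pd (Some ax1) zeta (pt None (base j) t) + j U1 * pd None zeta (pt None (base j) t)) (gt None (base j))).
  change (partial (jet_coord (ind_u1 ax1)) (fun q => pd (Some ax1) zeta (base q) + u1 q ax1 * pd None zeta (base q)) j)
    with (Derive (fun t => pd (Some ax1) zeta (base j) + t * pd None zeta (base j)) (j U1)).
  change (partial (jet_coord (ind_u1 ax2)) (fun q => pd (Some ax1) zeta (base q) + u1 q ax1 * pd None zeta (base q)) j)
    with (Derive (fun t => pd (Some ax1) zeta (base j) + j U1 * pd None zeta (base j)) (j U2)).
  rewrite !DS, Derive_const.
  assert (X : Derive (fun t => pd (Some ax1) zeta (base j) + t * pd None zeta (base j)) (j U1) = pd None zeta (base j)).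
  { apply is_derive_unique; auto_derive; auto; apply Rmult_1_l. }
  rewrite X; simpl; ring.
Qed.

Lemma second_prolongation_axis_field j : W (base j) ->
  second_prolongation (axis_field i zeta) (wave_lhs F) j =
  prolong2 (axis_field i zeta) ax1 ax2 j - zeta (base j) * Derive F (j U).
Proof.
  intros Hj. unfold second_prolongation, sum_axis.
  assert (E : forall c, c <> U -> c <> U12 -> partial (jet_coord c) (wave_lhs F) j = 0).
  { intros c N1 N2. unfold partial.
    transitivity (Derive (fun _ => wave_lhs F j) (j c)); [|apply Derive_const].
    destruct c; try congruence; reflexivity. }
  rewrite (E (ind_x ax1)), (E (ind_x ax2)), (E (ind_u1 ax1)), (E (ind_u1 ax2)), (E U11), (E U22) by discriminate.
  assert (EU : partial (jet_coord U) (wave_lhs F) j = - Derive F (j U)).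
  { change (Derive (fun t => j U12 - F t) (j U) = - Derive F (j U)). apply is_derive_unique.
    eapply is_derive_eq.
    - apply (is_derive_Rminus (fun _ => j U12)); [apply (is_derive_const (K := R_AbsRing) (V := R_NormedModule))|].
      apply Derive_correct. apply (HF 1%nat), (HJ _ Hj).
    - change (@zero R_NormedModule) with 0; ring. }
  assert (EU12 : partial (jet_coord U12) (wave_lhs F) j = 1).
  { change (Derive (fun t => t - F (j U)) (j U12) = 1). apply is_derive_unique. auto_derive; auto. }
  rewrite EU, EU12. simpl eta. unfold lift. ring.
Qed.

Lemma characteristic_axis_field j : characteristic (axis_field i zeta) j = zeta (base j) - u1 j i.
Proof. unfold characteristic, sum_axis, lift; destruct i; simpl; ring. Qed.

Lemma char_manifold_axis_field j : W (base j) ->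
  (char_manifold (axis_field i zeta) j <->
   zeta (base j) = u1 j i /\
   forall k, pd (Some k) zeta (base j) + u1 j k * pd None zeta (base j) = j (ind_u2 i k)).
Proof.
  intros Hj.
  assert (D : forall v k, Derive (fun t => zeta (pt v (base j) t) - k) (gt v (base j)) = pd v zeta (base j)).
  { intros v k. apply is_derive_unique. eapply is_derive_eq.
    - apply (is_derive_Rminus (fun t => zeta (pt v (base j) t)) (fun _ => k)); [|apply (is_derive_const (K := R_AbsRing) (V := R_NormedModule))].
      eapply (is_pd' W 0); [apply (Hz 1)|exact Hj].
    - change (@zero R_NormedModule) with 0; ring. }
  assert (T : forall k, total_D k (characteristic (axis_field i zeta)) j =
     pd (Some k) zeta (base j) + u1 j k * pd None zeta (base j) - j (ind_u2 i k)).
  { intros k. unfold total_D.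
    assert (E1 : partial (jet_coord (ind_x k)) (characteristic (axis_field i zeta)) j = pd (Some k) zeta (base j)).
    { rewrite (partial_ext _ _ _ j characteristic_axis_field), <- (D (Some k) (u1 j i)). destruct k, i; reflexivity. }
    assert (E2 : partial (jet_coord U) (characteristic (axis_field i zeta)) j = pd None zeta (base j)).
    { rewrite (partial_ext _ _ _ j characteristic_axis_field), <- (D None (u1 j i)). destruct i; reflexivity. }
    assert (E3 : forall m, partial (jet_coord (ind_u1 m)) (characteristic (axis_field i zeta)) j = if axis_eqb i m then -1 else 0).
    { intros m. rewrite (partial_ext _ _ _ j characteristic_axis_field).
      assert (Q : axis_eqb i m = true \/ axis_eqb i m = false) by (destruct (axis_eqb i m); auto).
      destruct Q as [Q|Q]; rewrite Q.
      - transitivity (Derive (fun t => zeta (base j) - t) (u1 j m)).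
        + destruct i, m; try discriminate; reflexivity.
        + apply is_derive_unique; auto_derive; auto; ring.
      - transitivity (Derive (fun t => zeta (base j) - u1 j i) (u1 j m)).
        + destruct i, m; try discriminate; reflexivity.
        + apply Derive_const. }
    unfold sum_axis. rewrite E1, E2, !E3. destruct i, k; simpl; ring. }
  unfold char_manifold. rewrite characteristic_axis_field. split.
  - intros [H1 H2]; split; [lra|]. intros k; specialize (H2 k); rewrite T in H2; lra.
  - intros [H1 H2]; split; [lra|]. intros k; rewrite T, H2; ring.
Qed.

(** The prolongation recursion yields [D_2 D_1 zeta]. Symmetry of the second partials of [zeta]
    brings it to the order [D_o D_i], so the rest of the argument need not distinguish the two
    axes. *)
Lemma second_prolongation_sym j : W (base j) ->
  second_prolongation (axis_field i zeta) (wave_lhs F) j =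
    pd (Some (other i)) (pd (Some i) zeta) (base j) + u1 j i * pd (Some (other i)) (pd None zeta) (base j)
    + u1 j (other i) * (pd None (pd (Some i) zeta) (base j) + u1 j i * pd None (pd None zeta) (base j))
    + j U12 * pd None zeta (base j) - zeta (base j) * Derive F (j U).
Proof.
  intros Hj. rewrite second_prolongation_axis_field, prolong2_axis_field by auto.
  destruct i; simpl other; [reflexivity|].
  rewrite (pd_comm W zeta (Some ax1) (Some ax2)), (pd_comm W zeta None (Some ax2)), (pd_comm W zeta (Some ax1) None)
    by auto.
  ring.
Qed.

Hypothesis Hzu : forall p, W p -> pd None zeta p <> 0.

(* The value of [u_o], [o] the other axis, on an invariant solution: solve [F = D_o zeta]. *)
Definition conj_coef (p : space) : R := (F (snd p) - pd (Some (other i)) zeta p) / pd None zeta p.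

Lemma CS_conj_coef n : CS n W conj_coef.
Proof.
  apply CS_div; auto; [|apply CS_pd, Hz].
  apply CS_minus; auto; [|apply CS_pd, Hz].
  apply (CS_line n W J F (gt None)); auto. now apply CS_get.
Qed.

Lemma conj_coef_spec p : W p -> pd (Some (other i)) zeta p + conj_coef p * pd None zeta p = F (snd p).
Proof. intros Hp; unfold conj_coef, Rdiv; rewrite Rmult_assoc, Rinv_l, Rmult_1_r by auto; apply Rplus_minus. Qed.

(** Derivative of the defining relation of [conj_coef]. It may be differentiated because it holds on
    the open set [W], and its right-hand side depends on [u] alone. *)
Lemma conj_coef_derive v p : W p ->
  pd v (pd (Some (other i)) zeta) p + (pd v conj_coef p * pd None zeta p + conj_coef p * pd v (pd None zeta) p)
  = match v with None => Derive F (snd p) | Some _ => 0 end.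
Proof.
  intros Hp.
  assert (D1 : is_derive (fun t => pd (Some (other i)) zeta (pt v p t) + conj_coef (pt v p t) * pd None zeta (pt v p t)) (gt v p)
     (pd v (pd (Some (other i)) zeta) p + (pd v conj_coef p * pd None zeta p + conj_coef p * pd v (pd None zeta) p))).
  { eapply is_derive_eq.
    - apply is_derive_Rplus; [eapply (is_pd' W 0); [apply CS_pd, (Hz 2)|exact Hp]|].
      apply is_derive_Rmult; [eapply (is_pd' W 0); [apply (CS_conj_coef 1)|exact Hp]|].
      eapply (is_pd' W 0); [apply CS_pd, (Hz 2)|exact Hp].
    - cbv beta; rewrite put_get; reflexivity. }
  apply is_derive_unique in D1. rewrite <- D1.
  transitivity (Derive (fun t => F (gt None (pt v p t))) (gt v p)).
  - apply Derive_ext_loc. apply (locally_put v p (fun q => pd (Some (other i)) zeta q + conj_coef q * pd None zeta q = F (snd q))).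
    generalize (HW p Hp); apply filter_imp; apply conj_coef_spec.
  - destruct v as [k|].
    + rewrite (Derive_ext _ (fun _ => F (gt None p))); [apply Derive_const|].
      intros t; now rewrite get_put_diff.
    + apply Derive_ext; intros t; now rewrite get_put_same.
Qed.

(** Take the derivative of the defining relation of [conj_coef] in [x_i] plus [zeta] times its
    derivative in [u]. This eliminates every second derivative of [zeta], and [zeta_u] factors out
    of what remains. *)
Lemma reduction_equation_at j : W (base j) -> u1 j i = zeta (base j) -> u1 j (other i) = conj_coef (base j) ->
  j U12 = F (j U) ->
  second_prolongation (axis_field i zeta) (wave_lhs F) j =
  (F (j U) - (pd (Some i) conj_coef (base j) + zeta (base j) * pd None conj_coef (base j))) * pd None zeta (base j).
Proof.
  intros Hj E1 E2 E3. rewrite second_prolongation_sym, E1, E2, E3 by auto.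
  assert (H1 := conj_coef_derive (Some i) _ Hj). assert (H2 := conj_coef_derive None _ Hj).
  cbv beta iota in H1, H2. change (snd (base j)) with (j U) in H2.
  rewrite (pd_comm W zeta (Some (other i)) (Some i)), (pd_comm W zeta (Some (other i)) None), (pd_comm W zeta None (Some i)) by auto.
  rewrite <- H2. 
  replace (pd (Some i) (pd (Some (other i)) zeta) (base j)) with
    (- (pd (Some i) conj_coef (base j) * pd None zeta (base j) + conj_coef (base j) * pd (Some i) (pd None zeta) (base j))) by lra.
  ring.
Qed.

(** On the equation and the manifold, [u_i = zeta], [u_12 = F] and hence [u_o = conj_coef] are
    forced. The condition on jets is therefore a condition at the base point, and [zeta_u <> 0]
    allows the factor to be cancelled. *)
Lemma reduction_operator_axis_field :
  axis_reduction_operator F J i W zeta <->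
  forall p, W p -> pd (Some i) conj_coef p + zeta p * pd None conj_coef p = F (snd p).
Proof.
  split.
  - intros [(_ & _ & _ & _ & _ & H) _] p Hp.
    (* A jet over [p] satisfying all constraints. The pure second derivative along [i] must be
       [D_i zeta]; the other pure one is unconstrained and is given the same value. *)
    set (j := fun c => match c with
      | X1 => fst (fst p) | X2 => snd (fst p) | U => snd p
      | U1 => match i with ax1 => zeta p | ax2 => conj_coef p end
      | U2 => match i with ax1 => conj_coef p | ax2 => zeta p end
      | U12 => F (snd p)
      | U11 | U22 => pd (Some i) zeta p + zeta p * pd None zeta p end).
    assert (Ej : base j = p) by (destruct p as [[]]; reflexivity).
    assert (Hj : W (base j)) by now rewrite Ej.
    assert (E1 : u1 j i = zeta p) by (destruct i; reflexivity).
    assert (E2 : u1 j (other i) = conj_coef p) by (destruct i; reflexivity).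
    assert (HS : second_prolongation (axis_field i zeta) (wave_lhs F) j = 0).
    { apply H; auto.
      - unfold wave_lhs; simpl; ring.
      - apply char_manifold_axis_field; auto. rewrite Ej. split; [now rewrite E1|].
        intros k. assert (K : k = i \/ k = other i) by (destruct i, k; auto). destruct K as [->| ->].
        + rewrite E1. destruct i; reflexivity.
        + rewrite E2, conj_coef_spec by auto. destruct i; reflexivity. }
    rewrite reduction_equation_at in HS; rewrite ?Ej; auto. rewrite Ej in HS.
    change (j U) with (snd p) in HS. apply Rmult_integral in HS. destruct HS as [HS|HS]; [lra|].
    now destruct (Hzu p Hp).
  - intros H. split; [|exact Hzu]. split; [exact HW|]. split; [exact HJ|]. split; [|split; [exact Hz|split]].
    + intros k n; exact (CS_const n W (if axis_eqb i k then 1 else 0)).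
    + intros p _ [H1 H2]. simpl in H1, H2. destruct i; simpl in *; lra.
    + intros j Hj HL HC. apply char_manifold_axis_field in HC; auto. destruct HC as [E1 E2].
      assert (E3 : j U12 = F (j U)) by (unfold wave_lhs in HL; lra).
      specialize (E2 (other i)). replace (j (ind_u2 i (other i))) with (j U12) in E2 by (destruct i; reflexivity).
      rewrite reduction_equation_at; auto.
      * rewrite H by auto. change (snd (base j)) with (j U). ring.
      * unfold conj_coef. change (snd (base j)) with (j U). rewrite <- E3, <- E2. field; auto.
Qed.

End Jets.

(** ** Families and invariant solutions *)

Lemma graph_open_comp (B D : SP -> Prop) (f : space -> R) p : open D ->
  (forall q, B q -> continuous f q) -> B p -> D (fst p, f p) -> locally p (fun q : SP => D (fst q, f q)).
Proof.
  intros HD Hc Hp Hg.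
  apply (continuous_put None (fun q => q) f p (continuous_id p) (Hc p Hp) D). now apply HD.
Qed.

Lemma CS_graph n (B D : SP -> Prop) a f : open B -> open D -> CS n D a -> CS n B f ->
  (forall p, B p -> D (fst p, f p)) -> CS n B (fun p => a (fst p, f p)).
Proof.
  intros HB HD Ha Hf Hin. apply (CS_comp n D B a (fun p => (fst p, f p))); auto.
  intros [k|]; [|exact Hf]. apply (CS_get n _ (Some k)), HB.
Qed.

Lemma pd_graph (B D : SP -> Prop) a f v p : open B -> open D -> CS 1 D a -> CS 1 B f ->
  B p -> D (fst p, f p) ->
  pd v (fun p => a (fst p, f p)) p = param_flag v * pd v a (fst p, f p) + pd v f p * pd None a (fst p, f p).
Proof.
  intros HB HD Ha Hf Hp Hg. apply is_derive_unique.
  eapply is_derive_eq.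
  - apply (chain_rule D a (fun t => (fst (pt v p t), f (pt v p t)))
      (fun w => match w with None => pd v f p | Some _ => if var_eq_dec w v then 1 else 0 end)); auto.
    + rewrite put_get; exact Hg.
    + intros [k|]; [|eapply is_pd'; eauto].
      change (is_derive (fun t => gt (Some k) (pt v p t)) (gt v p) (if var_eq_dec (Some k) v then 1 else 0)).
      destruct (var_eq_dec (Some k) v) as [<-|N].
      * eapply is_derive_ext; [intros t; symmetry; apply get_put_same|exact (is_derive_id (K := R_AbsRing) (gt (Some k) p))].
      * eapply is_derive_ext; [intros t; symmetry; apply get_put_diff; congruence|].
        apply (is_derive_const (K := R_AbsRing) (V := R_NormedModule)).
  - rewrite put_get. unfold sum3. 
    destruct (var_eq_dec (Some ax1) v) as [<-|N1].
    + destruct (var_eq_dec (Some ax2) (Some ax1)); [discriminate|]. simpl param_flag.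
      assert (X : forall a b x y : R, 1 * a + 0 * b + x * y = 1 * a + x * y) by (intros; ring). apply X.
    + destruct (var_eq_dec (Some ax2) v) as [<-|N2].
      * simpl param_flag.
        assert (X : forall a b x y : R, 0 * b + 1 * a + x * y = 1 * a + x * y) by (intros; ring). apply X.
      * destruct v as [[]|]; try congruence. simpl param_flag.
        assert (X : forall a b c x y : R, 0 * b + 0 * a + x * y = 0 * c + x * y) by (intros; ring). apply X.
Qed.

Lemma line_const (c : SP) r (g : space -> R) v p t : CS 1 (ball c r) g ->
  (forall q, ball c r q -> pd v g q = 0) -> ball c r p -> Rabs (t - gt v c) < r -> g (pt v p t) = g p.
Proof.
  intros Hg H0 Hp Ht. symmetry. rewrite <- (put_get v p) at 1.
  apply (derive_zero_eq (fun s => g (pt v p s))). intros s Hs.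
  assert (Hv := ball_get _ _ _ v Hp).
  assert (B : ball c r (pt v p s)).
  { apply ball_put; auto. apply Rabs_def2 in Hv; apply Rabs_def2 in Ht.
    revert Hs; unfold Rmin, Rmax; destruct (Rle_dec (gt v p) t); intros; apply Rabs_def1; lra. }
  rewrite <- (H0 _ B). eapply is_pd; eauto.
Qed.

(** The independent variables are moved to those of the centre one after the other, which stays
    inside the box. *)
Lemma fibrewise_const (c : SP) r (g : space -> R) p : CS 1 (ball c r) g ->
  (forall a q, ball c r q -> pd (Some a) g q = 0) -> ball c r p -> g p = g (fst c, snd p).
Proof.
  intros Hg H0 Hp.
  assert (Hr : 0 < r) by (eapply Rle_lt_trans; [apply Rabs_pos|apply (ball_get c r p None Hp)]).
  assert (C : forall v, Rabs (gt v c - gt v c) < r) by (intros v; rewrite Rminus_eq_0, Rabs_R0; exact Hr).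
  rewrite <- (line_const c r g (Some ax1) p (gt (Some ax1) c)) by auto.
  rewrite <- (line_const c r g (Some ax2) _ (gt (Some ax2) c)); auto.
  - destruct c as [[]]; destruct p as [[]]; reflexivity.
  - apply ball_put; auto.
Qed.

(** * Family members and single solutions as functions on [space] *)

Notation pl_coords := [plane_x ax1; plane_x ax2].

Lemma CS_member n (V : SP -> Prop) g k : CS n V g -> Ck (T := prod_UniformSpace R_UniformSpace R_UniformSpace) pl_coords n (slice V k) (member g k).
Proof.
  revert g; induction n; intros g Hg;
  (assert (Hc : forall x, slice V k x -> continuous (member g k) x)).
  1,3: intros x Hx; apply (continuous_comp_2 (fun x : plane => x) (fun _ => k) (fun x k => g (x, k)));
     [apply continuous_id|apply continuous_const|];
     eapply continuous_ext; [intros [y t]; reflexivity|]; eapply CS_cont; [exact Hg|exact Hx].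
  - split; [exact Hc|exact I].
  - split; [exact Hc|]. intros c [<-|[<-|[]]]; (split; [intros x Hx|]).
    + exact (CS_ex n V g (Some ax1) (x, k) Hg Hx).
    + exact (IHn _ (CS_pd n V g (Some ax1) Hg)).
    + exact (CS_ex n V g (Some ax2) (x, k) Hg Hx).
    + exact (IHn _ (CS_pd n V g (Some ax2) Hg)).
Qed.

(** Lifts a single solution to a function on [space] that ignores the last coordinate, so that the
    calculus developed for families applies to it too. *)
Lemma CS_of_plane n (O : plane -> Prop) (u : plane -> R) : open O ->
  Ck (T := prod_UniformSpace R_UniformSpace R_UniformSpace) pl_coords n O u -> CS n (fun p => O (fst p)) (fun p => u (fst p)).
Proof.
  intros HO. assert (HO' : open (fun p : SP => O (fst p))).
  { intros p Hp. exact (continuous_fst_comp (fun p : SP => p) p (continuous_id p) O (HO _ Hp)). }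
  revert u; induction n; intros u Hu;
  (assert (Hc : forall p : SP, O (fst p) -> continuous (fun p : SP => u (fst p)) p)).
  1,3: intros p Hp; apply (continuous_comp (fun p : SP => fst p) u);
    [apply @continuous_fst_comp, @continuous_id|apply Hu, Hp].
  - split; [exact Hc|exact I].
  - destruct Hu as [_ Hu]. apply CS_intro; auto.
    + intros [[]|] p Hp.
      * apply (Hu (plane_x ax1)); simpl; auto.
      * apply (Hu (plane_x ax2)); simpl; auto.
      * exact (ex_derive_const (K := R_AbsRing) (V := R_NormedModule) (u (fst p)) (gt None p)).
    + intros [[]|].
      * apply (IHn (partial (plane_x ax1) u)), (Hu (plane_x ax1)); simpl; auto.
      * apply (IHn (partial (plane_x ax2) u)), (Hu (plane_x ax2)); simpl; auto.
      * apply CS_ext with (fun _ => 0); auto; [|apply CS_const].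
        intros p _; symmetry; exact (Derive_const (u (fst p)) (gt None p)).
Qed.

Lemma slice_open (V : SP -> Prop) k : open V -> open (slice V k).
Proof.
  intros HV x Hx.
  apply (continuous_comp_2 (fun x : plane => x) (fun _ => k) (fun x k => (x, k)) x (continuous_id x) (continuous_const k x)) with (P := V).
  - apply (continuous_ext (fun z : SP => z)); [intros [y t]; reflexivity|apply continuous_id].
  - now apply HV.
Qed.

Lemma u12_sym (V : SP -> Prop) f i p : open V -> CS 2 V f -> V p ->
  pd (Some (other i)) (pd (Some i) f) p = pd (Some ax2) (pd (Some ax1) f) p.
Proof. intros HV Hf Hp; destruct i; [reflexivity|]; now apply (pd_comm V). Qed.

Lemma solution_family_pd F J V f i p : solution_family F J V f -> V p ->
  J (f p) /\ pd (Some (other i)) (pd (Some i) f) p = F (f p).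
Proof.
  intros (HV & Hf & _ & Hs) Hp. destruct (Hs (snd p)) as (_ & _ & H).
  destruct p as [x k]. destruct (H x Hp) as [H1 H2]. split; [exact H1|].
  rewrite (u12_sym V) by auto. unfold wave_lhs in H2.
  change (pd (Some ax2) (pd (Some ax1) f) (x, k) - F (f (x, k)) = 0) in H2. lra.
Qed.

Lemma solution_family_intro F J (V : SP -> Prop) f i : open V -> (forall n, CS n V f) ->
  (forall p, V p -> pd None f p <> 0) -> (forall p, V p -> J (f p)) ->
  (forall p, V p -> pd (Some (other i)) (pd (Some i) f) p = F (f p)) -> solution_family F J V f.
Proof.
  intros HV Hf HN HJ HE. split; [exact HV|split; [exact Hf|split; [exact HN|]]].
  intros k; split; [now apply slice_open|split].
  - intros n; apply CS_member, Hf.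
  - intros x Hx; split; [apply (HJ (x, k) Hx)|].
    change (pd (Some ax2) (pd (Some ax1) f) (x, k) - F (f (x, k)) = 0).
    rewrite <- (u12_sym V f i) by auto. rewrite HE by auto. ring.
Qed.

Lemma invariant_member i zeta V f k :
  invariant (axis_field i zeta) (slice V k) (member f k) <->
  forall x, V (x, k) -> pd (Some i) f (x, k) = zeta (x, f (x, k)).
Proof.
  assert (E : forall x, characteristic (axis_field i zeta) (jet_of (member f k) x) = zeta (x, f (x, k)) - pd (Some i) f (x, k)).
  { intros [a b]. rewrite characteristic_axis_field. destruct i; reflexivity. }
  split; intros H x Hx; specialize (H x Hx); rewrite E in *; lra.
Qed.

Section ConjugatePartial.
Context (F : R -> R) (J : R -> Prop) (i : axis) (W : SP -> Prop) (zeta : space -> R).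
Hypothesis HW : open W.
Hypothesis Hz : forall n, CS n W zeta.
Hypothesis Hzu : forall p, W p -> pd None zeta p <> 0.

(** Differentiating [u_i = zeta (x, u)] along the other axis gives [F = zeta_o + u_o zeta_u], to be
    solved for [u_o]. The last partial of [f] is not mentioned, so the lemma serves families and
    lifted single solutions alike. *)
Lemma invariant_conj_partial (V : SP -> Prop) f p : open V -> (forall n, CS n V f) ->
  (forall q, V q -> W (fst q, f q)) -> (forall q, V q -> pd (Some i) f q = zeta (fst q, f q)) -> V p ->
  pd (Some (other i)) (pd (Some i) f) p = F (f p) ->
  pd (Some (other i)) f p = conj_coef F i zeta (fst p, f p).
Proof.
  intros HV Hf Hin Hi Hp HE. unfold conj_coef. simpl snd. rewrite <- HE.
  assert (L : locally p (fun q : SP => pd (Some i) f q = zeta (fst q, f q))).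
  { generalize (HV p Hp); apply filter_imp; auto. }
  rewrite (pd_ext_loc _ _ _ _ L), (pd_graph V W) by auto. simpl param_flag.
  assert (N := Hzu _ (Hin p Hp)).
  assert (X : forall a b z : R, z <> 0 -> b = (1 * a + b * z - a) / z) by (intros; field; auto). now apply X.
Qed.

End ConjugatePartial.

Section FamilyOperator.
Context (F : R -> R) (J : R -> Prop) (i : axis) (c : SP) (r sigma : R) (f zeta : space -> R).
Let B : SP -> Prop := ball c r.
Let W : SP -> Prop := image B f.
Hypothesis HF : smooth_line J F.
Hypothesis Hf : forall n, CS n B f.
Hypothesis Hpos : forall p, B p -> 0 < sigma * pd None f p.
Hypothesis HJ : forall p, B p -> J (f p).
Hypothesis HE : forall p, B p -> pd (Some (other i)) (pd (Some i) f) p = F (f p).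
Hypothesis Hz : forall n, CS n W zeta.
Hypothesis Hzu : forall p, W p -> pd None zeta p <> 0.
Hypothesis Hzf : forall p, B p -> pd (Some i) f p = zeta (fst p, f p).

Lemma family_in_image p : B p -> W (fst p, f p).
Proof. intros Hp; exists (snd p); destruct p as [x k]; split; auto. Qed.

Lemma family_image_open : open W.
Proof. now apply (image_open c r sigma f). Qed.

Lemma family_conj_partial p : B p -> pd (Some (other i)) f p = conj_coef F i zeta (fst p, f p).
Proof.
  intros Hp. apply (invariant_conj_partial F i W zeta family_image_open Hz Hzu B); auto.
  - apply ball_space_open.
  - intros; now apply family_in_image.
Qed.

Lemma family_range p : W p -> J (snd p).
Proof. intros (k & Hk & E); exact (eq_ind _ J (HJ _ Hk) _ E). Qed.

(** Each point of [W] lies on the graph of a member, so an identity obtained by differentiating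
    along the family holds on all of [W]. *)
Lemma family_operator : axis_reduction_operator F J i W zeta.
Proof.
  assert (HW := family_image_open).
  apply (reduction_operator_axis_field F J i W zeta HF HW family_range Hz Hzu).
  intros [x z] (k & Hk & Ep); cbn [fst snd] in Hk, Ep; subst z.
  assert (Cc := CS_conj_coef F J i W zeta HF HW family_range Hz Hzu 1).
  assert (L : locally ((x, k) : SP) (fun q : SP => pd (Some (other i)) f q = conj_coef F i zeta (fst q, f q))).
  { generalize (ball_space_open c r _ Hk); apply filter_imp; apply family_conj_partial. }
  assert (E := pd_ext_loc (Some i) _ _ _ L).
  rewrite (pd_graph B W) in E; auto; [|apply ball_space_open|exact (family_in_image (x, k) Hk)].
  rewrite (pd_comm B) in E; auto; [|apply ball_space_open].
  rewrite HE, Hzf in E by auto. simpl param_flag in E.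
  assert (X : forall x y z : R, z = 1 * x + y -> x + y = z) by (intros; lra). exact (X _ _ _ E).
Qed.

Lemma family_invariant : invariant_family F J (axis_field i zeta) W B f.
Proof.
  assert (HW := family_image_open).
  set (K := fibre_inverse c r f).
  assert (KS := fibre_inverse_spec c r f). fold B W K in KS.
  assert (KC : forall n, CS n W K) by (intros n; now apply (fibre_inverse_smooth c r sigma f)).
  assert (KD : forall v p, W p -> pd v K p = fibre_inverse_pd c r f v p) by (intros v p; now apply (fibre_inverse_pdE c r sigma f)).
  split; [|split; [|split]].
  - intros x k Hk; apply (family_in_image (x, k) Hk).
  - intros k; apply invariant_member; intros x Hx; apply (Hzf (x, k) Hx).
  - intros x z (k & Hk & Ek). exists k; split; [auto|]. intros k' [Hk' Ek'].
    apply (fibre_injective c r sigma f Hf Hpos x); auto. simpl in Ek; congruence.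
  - intros O u (HO & Hu & Hs) Hin Hinv x Hx.
    set (O' := fun p : SP => O (fst p)). set (u' := fun p : SP => u (fst p)).
    assert (HO' : open O').
    { intros p Hp. exact (continuous_fst_comp (fun p : SP => p) p (continuous_id p) O (HO _ Hp)). }
    assert (Hu' : forall n, CS n O' u') by (intros n; apply CS_of_plane; auto).
    assert (Hin' : forall p, O' p -> W (fst p, u' p)) by (intros p Hp; apply Hin, Hp).
    assert (Ui : forall p, O' p -> pd (Some i) u' p = zeta (fst p, u' p)).
    { intros p Hp. assert (E := Hinv (fst p) Hp). rewrite characteristic_axis_field in E.
      destruct p as [[a b] z]. unfold u'. destruct i; apply Rminus_diag_uniq in E; symmetry; exact E. }
    assert (U12' : forall p, O' p -> pd (Some (other i)) (pd (Some i) u') p = F (u' p)).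
    { intros p Hp. rewrite (u12_sym O') by auto. destruct (Hs _ Hp) as [_ E]. apply Rminus_diag_uniq in E. exact E. }
    assert (Uo : forall p, O' p -> pd (Some (other i)) u' p = conj_coef F i zeta (fst p, u' p)).
    { intros p Hp. apply (invariant_conj_partial F i W zeta HW Hz Hzu O'); auto. }
    assert (KCu : CS 1 O' (fun p => K (fst p, u' p))).
    { apply (CS_graph 1 O' W); auto. }
    (* The chain rule gives [(u_a - f_a) / f_kappa] at the parameter [K (x, u x)]. There [u] and [f]
       have the same value, so both first derivatives agree, being [zeta] or [conj_coef] at one
       common point. *)
    assert (KD0 : forall a p, O' p -> pd (Some a) (fun p => K (fst p, u' p)) p = 0).
    { intros a p Hp. rewrite (pd_graph O' W) by auto.
      rewrite !KD by auto. destruct (KS _ (Hin' p Hp)) as [KB KE]. simpl fst in KB, KE. simpl snd in KE.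
      set (q := (fst p, K (fst p, u' p))) in *.
      assert (Ea : pd (Some a) u' p = pd (Some a) f q).
      { assert (A : a = i \/ a = other i) by (destruct a, i; auto). destruct A as [->| ->].
        - rewrite Ui, Hzf by auto. rewrite <- KE. reflexivity.
        - rewrite Uo, family_conj_partial by auto. rewrite <- KE. reflexivity. }
      rewrite Ea. unfold fibre_inverse_pd. simpl param_flag. fold K.
      change (fst p, K (fst p, u' p)) with q.
      assert (N : pd None f q <> 0) by (intros E0; generalize (Hpos q KB); rewrite E0; lra).
      assert (X : forall a z : R, z <> 0 -> 1 * (- a / z) + a * / z = 0) by (intros; field; auto).
      now apply X. }
    exists (K (x, u x)).
    destruct (KS (x, u x) (Hin x Hx)) as [KB KE]. split; [exact KB|].
    (* The last coordinate 0 is arbitrary: nothing lifted from [plane] depends on it. *)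
    destruct (open_ball _ (x, 0) HO' Hx) as [d Hd].
    exists d. intros y Hy.
    assert (By : ball ((x, 0) : SP) d (y, 0)) by (split; [exact Hy|apply ball_center]).
    assert (E := fibrewise_const (x, 0) d (fun p => K (fst p, u' p)) (y, 0)
      (CS_sub 1 _ _ _ Hd KCu) (fun a q Hq => KD0 a q (Hd q Hq)) By).
    simpl in E. unfold u' in E; simpl in E. rewrite <- E.
    symmetry. apply (KS (y, u y)). apply Hin. apply (Hd (y, 0) By).
Qed.

End FamilyOperator.

(** ** From operators to families *)

(** Uniqueness for a linear homogeneous equation along [v] with zero data, by an integrating factor.
    It propagates one equation of the Frobenius system off the slice where it is known. *)
Lemma linear_zero v (c : SP) r (a y : space -> R) : (forall p, ball c r p -> continuous a p) -> CS 1 (ball c r) y ->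
  (forall p, ball c r p -> pd v y p = a p * y p) ->
  (forall p, ball c r p -> gt v p = gt v c -> y p = 0) ->
  forall p, ball c r p -> y p = 0.
Proof.
  intros Ha Hy H0 Hi p Hp.
  assert (Hv := ball_get _ _ _ v Hp).
  assert (Hc : Rabs (gt v c - gt v c) < r) by (rewrite Rminus_eq_0, Rabs_R0; eapply Rle_lt_trans; [apply Rabs_pos|exact Hv]).
  set (G := Int v c a). set (w := fun s => / exp (G (pt v p s)) * y (pt v p s)).
  assert (E : w (gt v c) = w (gt v p)).
  { apply derive_zero_eq; intros s Hs.
    assert (Hs' := between_ball _ _ _ _ Hv Hs). assert (Hq := ball_put c r p v s Hp Hs').
    assert (NE : exp (G (pt v p s)) <> 0) by apply Rgt_not_eq, exp_pos.
    eapply is_derive_eq.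
    - apply is_derive_Rmult; [|eapply is_pd; eauto]. apply is_derive_Rinv; [exact NE|].
      apply (is_derive_Rcomp exp (fun s => G (pt v p s))); [apply is_derive_exp|].
      apply (is_derive_Int c r v); auto.
    - rewrite H0 by auto. cbv beta. field; exact NE. }
  unfold w in E. rewrite put_get, (Hi (pt v p (gt v c))), Rmult_0_r in E; [|apply ball_put; auto|apply get_put_same].
  symmetry in E; apply Rmult_integral in E; destruct E as [E|E]; [|exact E].
  exfalso; revert E; apply Rinv_neq_0_compat, Rgt_not_eq, exp_pos.
Qed.

Lemma CS_put n (B : SP -> Prop) v k u : open B -> CS n B (fun p => gt u (pt v p k)).
Proof.
  intros HB; destruct (var_eq_dec u v) as [->|N].
  - apply CS_ext with (fun _ => k); auto; [|apply CS_const]. intros p _; now rewrite get_put_same.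
  - apply CS_ext with (gt u); auto; [|now apply CS_get]. intros p _; now rewrite get_put_diff.
Qed.

Lemma pd_put_same (g : space -> R) v k p : pd v (fun q => g (pt v q k)) p = 0.
Proof.
  unfold partial. rewrite (Derive_ext _ (fun _ => g (pt v p k))); [apply Derive_const|].
  intros t; now rewrite put_put.
Qed.

Lemma pd_put_diff (g : space -> R) v w k p : v <> w -> pd w (fun q => g (pt v q k)) p = pd w g (pt v p k).
Proof.
  intros N; unfold partial. rewrite get_put_diff by auto. apply Derive_ext; intros t; now rewrite put_comm.
Qed.

(* Frobenius for the commuting fields [d_i + a d_z] and [d_o + b d_z], by composing their flows. *)
Lemma integral_family i (D : SP -> Prop) (a b : space -> R) (c : SP) :
  open D -> D c -> (forall n, CS n D a) -> (forall n, CS n D b) ->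
  (forall p, D p -> pd (Some i) b p + a p * pd None b p = pd (Some (other i)) a p + b p * pd None a p) ->
  exists (r : posreal) (f : space -> R),
    (forall n, CS n (ball c r) f) /\
    (forall p, ball c r p -> D (fst p, f p)) /\
    (forall p, ball c r p -> pd (Some i) f p = a (fst p, f p)) /\
    (forall p, ball c r p -> pd (Some (other i)) f p = b (fst p, f p)) /\
    (forall p, ball c r p -> 0 < pd None f p) /\
    f c = snd c.
Proof.
  intros HD Hc Ha Hb Hcomm. set (o := other i) in *.
  assert (Nio : Some i <> Some o) by (unfold o; destruct i; discriminate).
  assert (Noi : Some o <> Some i) by congruence.
  destruct (flow_exists i D a c HD Hc Ha) as (d1 & p1 & A1 & A2 & A3 & A4 & A5).
  destruct (flow_exists o D b c HD Hc Hb) as (d2 & p2 & B1 & B2 & B3 & B4 & B5).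
  set (t0 := gt (Some o) c).
  (* The flow along [x_i], taken on the line [x_o = t0], supplies the initial values for the flow
     along [x_o]. *)
  set (g0 := fun q : SP => p1 (pt (Some o) q t0)).
  set (G := fun q : SP => (fst q, g0 q) : SP).
  assert (O1 : open (ball c d1)) by apply ball_space_open.
  assert (O2 : open (ball c d2)) by apply ball_space_open.
  assert (T0 : forall r, 0 < r -> Rabs (t0 - gt (Some o) c) < r) by (intros; unfold t0; rewrite Rminus_eq_0, Rabs_R0; auto).
  assert (P1 : forall q, ball c d1 q -> ball c d1 (pt (Some o) q t0)) by (intros; apply ball_put; auto; apply T0, cond_pos).
  assert (Cg0 : forall n, CS n (ball c d1) g0).
  { intros n. apply (CS_comp n (ball c d1) (ball c d1) p1 (fun q => pt (Some o) q t0)); auto.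
    intros u; now apply CS_put. }
  assert (Cc : ball c d1 c) by apply ball_center.
  assert (Ec : pt (Some o) c t0 = c) by apply put_get.
  assert (g0c : g0 c = snd c) by (unfold g0; rewrite Ec; apply A4; auto).
  assert (L : locally c (fun q : SP => ball c d2 (G q))).
  { apply (graph_open_comp (ball c d1) (ball c d2) g0); auto.
    - intros q Hq; eapply CS_cont; [apply (Cg0 0%nat)|exact Hq].
    - rewrite g0c, <- surjective_pairing. apply ball_center. }
  destruct (filter_and _ _ L (O1 c Cc)) as [r Hr].
  set (B := ball c r). assert (OB : open B) by apply ball_space_open.
  assert (R1 : forall q, B q -> ball c d1 q) by (intros q Hq; apply (Hr q Hq)).
  assert (R2 : forall q, B q -> ball c d2 (G q)) by (intros q Hq; apply (Hr q Hq)).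
  set (f := fun q : SP => p2 (G q)).
  assert (Cf : forall n, CS n B f).
  { intros n. apply (CS_graph n B (ball c d2)); auto. apply CS_sub with (ball c d1); auto. }
  assert (Cg : CS 1 B g0) by (apply CS_sub with (ball c d1); auto).
  assert (Df : forall v q, B q -> pd v f q = param_flag v * pd v p2 (G q) + pd v g0 q * pd None p2 (G q)).
  { intros v q Hq. apply (pd_graph B (ball c d2)); auto; exact (R2 q Hq). }
  assert (FD : forall q, B q -> D (fst q, f q)) by (intros q Hq; apply (B2 _ (R2 q Hq))).
  assert (Fo : forall q, B q -> pd (Some o) f q = b (fst q, f q)).
  { intros q Hq. rewrite Df by auto. unfold g0 at 1; rewrite pd_put_same, B3 by auto.
    assert (X : forall x y : R, 1 * x + 0 * y = x) by (intros; ring). apply X. }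
  assert (Fi0 : forall q, B q -> gt (Some o) q = t0 -> pd (Some i) f q = a (fst q, f q)).
  { intros q Hq E.
    (* On the slice the second flow is at its initial time, so [f] reduces to the first flow, and
       this along a whole interval of [x_i], as differentiation requires. *)
    assert (Eg : forall s, Rabs (s - gt (Some i) c) < r -> f (pt (Some i) q s) = p1 (pt (Some i) q s)).
    { intros s Hs. assert (Hs' := ball_put c r q (Some i) s Hq Hs).
      assert (Et : gt (Some o) (pt (Some i) q s) = t0) by (rewrite get_put_diff; auto).
      unfold f. rewrite B4; auto.
      change (p1 (pt (Some o) (pt (Some i) q s) t0) = p1 (pt (Some i) q s)).
      now rewrite <- Et, put_get. }
    assert (Eq : f q = p1 q) by (rewrite <- (put_get (Some i) q); apply Eg, (ball_get _ _ _ _ Hq)).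
    rewrite Eq, <- A3 by auto. unfold partial. apply Derive_ext_loc.
    generalize (locally_Rabs _ _ _ (ball_get _ _ _ (Some i) Hq)); apply filter_imp; exact Eg. }
  (* The defect of the [x_i] equation. Commutation of the fields turns its [x_o] derivative into
     [b_u] times the defect, so vanishing on the slice forces it to vanish everywhere. *)
  set (e := fun q : SP => pd (Some i) f q - a (fst q, f q)).
  assert (Caf : CS 1 B (fun q => a (fst q, f q))) by (apply (CS_graph 1 B D); auto).
  assert (Ce : CS 1 B e) by (apply CS_minus; auto; apply CS_pd, (Cf 2%nat)).
  assert (De : forall q, B q -> pd (Some o) e q = pd None b (fst q, f q) * e q).
  { intros q Hq. 
    assert (E1 : pd (Some o) e q = pd (Some o) (pd (Some i) f) q - pd (Some o) (fun q => a (fst q, f q)) q).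
    { apply is_derive_unique. apply is_derive_Rminus.
      - apply (is_pd' B 0 (pd (Some i) f)); [apply CS_pd, (Cf 2%nat)|exact Hq].
      - apply (is_pd' B 0 (fun q => a (fst q, f q))); [exact Caf|exact Hq]. }
    rewrite E1. rewrite (pd_comm B) by auto.
    assert (L1 : locally q (fun q : SP => pd (Some o) f q = b (fst q, f q))) by (generalize (OB q Hq); apply filter_imp; auto).
    rewrite (pd_ext_loc _ _ _ _ L1). rewrite !(pd_graph B D) by auto. rewrite (Fo q Hq).
    unfold e. simpl param_flag.
    assert (X : forall bi fi bn ao bb an aa : R, bi + aa * bn = ao + bb * an ->
      1 * bi + fi * bn - (1 * ao + bb * an) = bn * (fi - aa)) by (intros; nra).
    apply X. apply (Hcomm _ (FD q Hq)). }
  assert (E0 : forall q, B q -> e q = 0).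
  { apply (linear_zero (Some o) c r (fun q => pd None b (fst q, f q)) e); auto.
    - intros q Hq. eapply CS_cont; [|exact Hq]. apply (CS_graph 0 B D (pd None b)); auto. apply CS_pd, Hb.
    - intros q Hq E. unfold e. rewrite Fi0 by auto. apply Rminus_eq_0. }
  exists r, f. split; [|split; [|split; [|split; [|split]]]]; auto.
  - intros q Hq. apply Rminus_diag_uniq, (E0 q Hq).
  - intros q Hq. rewrite Df by auto. simpl param_flag. unfold g0. rewrite pd_put_diff by discriminate.
    rewrite Rmult_0_l, Rplus_0_l. apply Rmult_lt_0_compat; [apply A5|apply B5]; auto.
  - unfold f. rewrite B4; [exact g0c|apply (R2 c (ball_center c r))|reflexivity].
Qed.

(** [W'] is the region swept by the local Frobenius family, so that a member passes through every
    one of its points; the value of [f] at the centre puts [p] in it. *)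
Lemma operator_has_family F J i (W : SP -> Prop) zeta : smooth_line J F ->
  axis_reduction_operator F J i W zeta -> forall p : SP, W p ->
  exists W' V f, open W' /\ W' p /\ subdomain W' W /\
    solution_family F J V f /\ invariant_family F J (axis_field i zeta) W' V f.
Proof.
  intros HF HR p Hp.
  assert (HR' := HR). destruct HR' as [(HW & HJ & _ & Hz & _ & _) Hzu].
  set (b := conj_coef F i zeta).
  assert (Hb : forall n, CS n W b) by (intros n; now apply (CS_conj_coef F J)).
  assert (H1 : forall q, W q -> pd (Some i) b q + zeta q * pd None b q = F (snd q)).
  { now apply (reduction_operator_axis_field F J i W zeta). }
  assert (H2 : forall q, W q -> pd (Some (other i)) zeta q + b q * pd None zeta q = F (snd q)).
  { intros q Hq; now apply (conj_coef_spec F i W zeta). }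
  destruct (integral_family i W zeta b p HW Hp Hz Hb) as (r & f & Cf & FW & Fi & Fo & FN & Fp).
  { intros q Hq; rewrite H1, H2; auto. }
  set (B := ball p r). assert (OB : open B) by apply ball_space_open.
  assert (FE : forall q, B q -> pd (Some (other i)) (pd (Some i) f) q = F (f q)).
  { intros q Hq.
    assert (L : locally q (fun q : SP => pd (Some i) f q = zeta (fst q, f q))) by (generalize (OB q Hq); apply filter_imp; auto).
    rewrite (pd_ext_loc _ _ _ _ L), (pd_graph B W) by auto. rewrite Fo by auto.
    assert (E := H2 _ (FW q Hq)). simpl snd in E. rewrite <- E. simpl param_flag.
    assert (X : forall x y : R, 1 * x + y = x + y) by (intros; ring). apply X. }
  assert (Pos : forall q, ball p r q -> 0 < 1 * pd None f q) by (intros q Hq; rewrite Rmult_1_l; now apply FN).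
  assert (Sub : forall q, image B f q -> W q).
  { intros [x z] (k & Hk & E). cbn [fst snd] in Hk, E; subst z. exact (FW (x, k) Hk). }
  assert (FJ : forall q, B q -> J (f q)) by (intros q Hq; exact (HJ _ (FW q Hq))).
  exists (image B f), B, f. split; [|split; [|split; [|split]]].
  - now apply (image_open p r 1 f).
  - exists (snd p). rewrite <- surjective_pairing. split; [apply ball_center|exact Fp].
  - exact Sub.
  - apply (solution_family_intro F J B f i); auto.
    intros q Hq; apply Rgt_not_eq, FN, Hq.
  - apply (family_invariant F J i p r 1 f zeta); auto.
    intros n; apply CS_sub with W; auto.
Qed.

(** ** From families to operators *)

(** Supplies the sign factor of the fibrewise inverse: the value of [g] at the centre plays the part
    of [sigma]. *)
Lemma sign_ball (V : SP -> Prop) (g : space -> R) (p : SP) : open V -> V p -> continuous g p -> g p <> 0 ->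
  exists r : posreal, forall q, ball p r q -> V q /\ 0 < g p * g q.
Proof.
  intros HV Hp Hc H0.
  destruct (filter_and _ _ (HV p Hp) (continuous_at_locally _ _ _ Hc (Rabs_pos_lt _ H0))) as [r Hr].
  exists r; intros q Hq; destruct (Hr q Hq) as [H1 H2]. split; [exact H1|].
  revert H0 H2. generalize (g p) (g q); intros x y H0 H2.
  unfold Rabs in H2; destruct (Rcase_abs (y - x)), (Rcase_abs x); nra.
Qed.

Lemma nondegenerate_open F J i (V : SP -> Prop) f : solution_family F J V f -> open (nondegenerate i V f).
Proof.
  intros (HV & Hf & _ & _) p [Hp H0].
  assert (Hc : continuous (pd (Some i) (pd None f)) p).
  { eapply CS_cont; [apply CS_pd, CS_pd, (Hf 2%nat)|exact Hp]. }
  destruct (sign_ball V _ p HV Hp Hc H0) as [r Hr]. exists r; intros q Hq.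
  destruct (Hr q Hq) as [H1 H2]. split; [exact H1|]. intros E.
  change (pd (Some i) (pd None f) q = 0) in E. rewrite E in H2; lra.
Qed.

Lemma nondegenerate_dense F J i (V : SP -> Prop) f : smooth_line J F -> (forall z, J z -> Derive F z <> 0) ->
  solution_family F J V f -> dense_in (nondegenerate i V f) V.
Proof.
  intros HF HF' HS p Hp P HP. apply NNPP; intros Hno.
  assert (HS' := HS). destruct HS' as (HV & Hf & HN & _).
  assert (Z : forall q, V q -> P q -> pd (Some i) (pd None f) q = 0).
  { intros q Hq HPq. apply NNPP; intros E. apply Hno. exists q; split; [split|]; auto. }
  assert (L : locally p (fun q : SP => pd None (pd (Some i) f) q = 0)).
  { generalize (filter_and _ _ (HV p Hp) HP); apply filter_imp; intros q [H1 H2].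
    rewrite (pd_comm V); auto. }
  assert (E1 : pd None (pd (Some (other i)) (pd (Some i) f)) p = 0).
  { rewrite (pd_comm V); [|exact HV|apply CS_pd, (Hf 3%nat)|exact Hp].
    rewrite (pd_ext_loc _ _ _ _ L). apply pd_const. }
  assert (L2 : locally p (fun q : SP => pd (Some (other i)) (pd (Some i) f) q = F (f q))).
  { generalize (HV p Hp); apply filter_imp; intros q Hq. now apply (solution_family_pd F J V f i q). }
  rewrite (pd_ext_loc _ _ _ _ L2) in E1.
  assert (JF := proj1 (solution_family_pd F J V f i p HS Hp)).
  assert (E2 : pd None (fun q => F (f q)) p = pd None f p * Derive F (f p)).
  { apply is_derive_unique. eapply is_derive_eq.
    - apply (is_derive_Rcomp F (fun t => f (pt None p t))).
      + apply Derive_correct. rewrite put_get. now apply (HF 1%nat).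
      + now apply (is_pd' V 0).
    - rewrite put_get; reflexivity. }
  destruct (Rmult_integral _ _ (eq_trans (eq_sym E2) E1)) as [E3|E3].
  - now apply (HN p).
  - now apply (HF' (f p)).
Qed.

Lemma family_has_operator F J i (V : SP -> Prop) f : smooth_line J F -> solution_family F J V f ->
  forall p : SP, nondegenerate i V f p ->
  exists V' W zeta, open V' /\ V' p /\ subdomain V' V /\
    axis_reduction_operator F J i W zeta /\ invariant_family F J (axis_field i zeta) W V' f.
Proof.
  intros HF HS p Hp. assert (HO := nondegenerate_open F J i V f HS).
  assert (HS' := HS). destruct HS' as (HV & Hf & HN & _).
  assert (Hc : continuous (pd None f) p).
  { eapply CS_cont; [apply CS_pd, (Hf 1%nat)|apply Hp]. }
  (* The ball is chosen inside the nondegenerate set and not merely inside [V]; this gives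
     [zeta_u <> 0] on the whole image. *)
  destruct (sign_ball (nondegenerate i V f) _ p HO Hp Hc (HN p (proj1 Hp))) as [r Hr].
  set (B := ball p r). set (sigma := pd None f p) in *.
  assert (OB : open B) by apply ball_space_open.
  assert (BV : forall q, B q -> V q) by (intros q Hq; apply (Hr q Hq)).
  assert (Cf : forall n, CS n B f) by (intros n; apply CS_sub with V; auto).
  assert (Pos : forall q, B q -> 0 < sigma * pd None f q) by (intros q Hq; apply (Hr q Hq)).
  set (W := image B f). set (K := fibre_inverse p r f).
  assert (OW : open W) by now apply (image_open p r sigma f).
  assert (KS := fibre_inverse_spec p r f). fold B W K in KS.
  assert (KC : forall n, CS n W K) by (intros n; now apply (fibre_inverse_smooth p r sigma f)).
  set (zeta := fun q : SP => pd (Some i) f (fst q, K q)).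
  assert (Zf : forall q, B q -> pd (Some i) f q = zeta (fst q, f q)).
  { intros [x k] Hq. unfold zeta. simpl fst.
    assert (E : K (x, f (x, k)) = k) by (now apply (fibre_inverse_unique p r sigma f)). now rewrite E. }
  assert (Zc : forall n, CS n W zeta).
  { intros n. apply (CS_graph n W B (pd (Some i) f)); auto; [apply CS_pd, Cf|]. intros q Hq; apply (KS q Hq). }
  assert (Zu : forall q, W q -> pd None zeta q <> 0).
  { intros q Hq. unfold zeta. rewrite (pd_graph W B) by (auto; apply CS_pd || apply (KS q Hq); apply (Cf 2%nat)).
    simpl param_flag. unfold K at 2. rewrite (fibre_inverse_pdE p r sigma f) by auto. unfold fibre_inverse_pd. fold K.
    destruct (KS q Hq) as [KB _].
    assert (N1 : pd (Some i) (pd None f) (fst q, K q) <> 0) by apply (proj1 (Hr _ KB)).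
    assert (N2 : pd None f (fst q, K q) <> 0) by (apply HN, BV, KB).
    rewrite (pd_comm B f None (Some i)) by auto.
    assert (X : forall a b c : R, b <> 0 -> c <> 0 -> 0 * a + / b * c <> 0).
    { intros a b c Hb Hc'; rewrite Rmult_0_l, Rplus_0_l. apply Rmult_integral_contrapositive_currified; auto.
      now apply Rinv_neq_0_compat. }
    now apply X. }
  assert (HJ : forall q, B q -> J (f q)) by (intros q Hq; apply (solution_family_pd F J V f i q HS (BV q Hq))).
  assert (HE : forall q, B q -> pd (Some (other i)) (pd (Some i) f) q = F (f q)).
  { intros q Hq; apply (solution_family_pd F J V f i q HS (BV q Hq)). }
  exists B, W, zeta. split; [exact OB|split; [apply ball_center|split; [exact BV|split]]].
  - now apply (family_operator F J i p r sigma f zeta).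
  - now apply (family_invariant F J i p r sigma f zeta).
Qed.

(** Bridges the two notions of smoothness: iterated derivatives along a fibre are iterates of the
    last partial. Needed for the parameter change. *)
Lemma smooth_fibre (N : SP -> Prop) (I : R -> Prop) x (g : space -> R) : open I -> (forall t, I t -> N (x, t)) ->
  (forall n, CS n N g) -> smooth_line I (fun t => g (x, t)).
Proof.
  intros HI HN Hg n.
  assert (H : forall m (t : R), I t -> Derive_n (fun t => g (x, t)) m t = Nat.iter m (partial (sc None)) g (x, t)).
  { induction m; intros t Ht; [reflexivity|]. simpl.
    transitivity (Derive (fun t => Nat.iter m (partial (sc None)) g (x, t)) t); [|reflexivity].
    apply Derive_ext_loc. generalize (HI t Ht); apply filter_imp; exact IHm. }
  assert (Hs : forall m k, CS k N (Nat.iter m (partial (sc None)) g)).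
  { induction m; intros k; [apply Hg|]. simpl. apply (CS_pd k N _ None), IHm. }
  intros t Ht. destruct n; [exact Logic.I|]. simpl.
  apply ex_derive_ext_loc with (fun t => Nat.iter n (partial (sc None)) g (x, t)).
  - generalize (HI t Ht); apply filter_imp; intros s Hs'; symmetry; auto.
  - apply (CS_ex 0 N _ None (x, t)); auto.
Qed.

Section Correspondence.
Context (F : R -> R) (J : R -> Prop) (i : axis) (W : SP -> Prop) (zeta : space -> R) (V : SP -> Prop) (f : space -> R).
Hypothesis HR : axis_reduction_operator F J i W zeta.
Hypothesis HS : solution_family F J V f.
Hypothesis HI : invariant_family F J (axis_field i zeta) W V f.

Lemma invariant_family_in p : V p -> W (fst p, f p).
Proof. destruct p as [x k]; apply (proj1 HI). Qed.

Lemma invariant_family_pd p : V p -> pd (Some i) f p = zeta (fst p, f p).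
Proof.
  destruct p as [x k]; intros Hp. destruct HI as (_ & H & _). specialize (H k).
  rewrite invariant_member in H. now apply H.
Qed.

Lemma invariant_family_conj p : V p -> pd (Some (other i)) f p = conj_coef F i zeta (fst p, f p).
Proof.
  intros Hp. destruct HR as [(HW & _ & _ & Hz & _) Hzu]. destruct HS as (HV & Hf & _).
  apply (invariant_conj_partial F i W zeta HW Hz Hzu V); auto.
  - apply invariant_family_in.
  - apply invariant_family_pd.
  - now apply (solution_family_pd F J V f i p).
Qed.

End Correspondence.

(** ** Equivalence of families *)

Section Equivalence.
Context (F : R -> R) (J : R -> Prop) (i : axis).
Context (W : SP -> Prop) (zeta : space -> R) (V : SP -> Prop) (f : space -> R).
Context (W' : SP -> Prop) (zeta' : space -> R) (V' : SP -> Prop) (f' : space -> R).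
Hypothesis HR : axis_reduction_operator F J i W zeta.
Hypothesis HR' : axis_reduction_operator F J i W' zeta'.
Hypothesis HS : solution_family F J V f.
Hypothesis HS' : solution_family F J V' f'.
Hypothesis HI : invariant_family F J (axis_field i zeta) W V f.
Hypothesis HI' : invariant_family F J (axis_field i zeta') W' V' f'.
Context (x : plane) (k k' z : R).
Hypotheses (Hk : V (x, k)) (Ek : f (x, k) = z) (Hk' : V' (x, k')) (Ek' : f' (x, k') = z).

Lemma equal_operators_equivalent :
  locally ((x, z) : SP) (fun p => zeta p = zeta' p) -> equivalent_families_at x f k f' k'.
Proof.
  intros HL.
  destruct HS as (HV & Hf & HN & _). destruct HS' as (HV' & Hf' & HN' & _).
  assert (Hc' : continuous (pd None f') ((x, k') : SP)).
  { eapply CS_cont; [apply CS_pd, (Hf' 1%nat)|exact Hk']. }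
  destruct (sign_ball V' _ (x, k') HV' Hk' Hc' (HN' _ Hk')) as [r' Hr'].
  set (p' := (x, k') : SP) in *. set (sigma := pd None f' p') in *. set (B' := ball p' r').
  assert (BV : forall q, B' q -> V' q) by (intros q Hq; apply (Hr' q Hq)).
  assert (Cf' : forall n, CS n B' f') by (intros n; apply CS_sub with V'; auto).
  assert (Pos : forall q, B' q -> 0 < sigma * pd None f' q) by (intros q Hq; apply (Hr' q Hq)).
  set (Im := image B' f'). set (K := fibre_inverse p' r' f').
  assert (OI : open Im) by now apply (image_open p' r' sigma f').
  assert (KS := fibre_inverse_spec p' r' f'). fold B' Im K in KS.
  assert (KC : forall n, CS n Im K) by (intros n; now apply (fibre_inverse_smooth p' r' sigma f')).
  assert (Bc : B' p') by apply ball_center.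
  assert (HIm : Im (x, z)) by (exists k'; split; auto).
  (* Agreement of [zeta] and [zeta'] is needed as germs at every nearby graph point, since
     [conj_coef] involves their derivatives. *)
  assert (LL : locally ((x, k) : SP) (fun q : SP => V q /\ Im (fst q, f q) /\
      locally ((fst q, f q) : SP) (fun p => zeta p = zeta' p))).
  { apply filter_and; [exact (HV _ Hk)|].
    assert (Cc : continuous f ((x, k) : SP)) by (eapply CS_cont; [apply (Hf 0%nat)|exact Hk]).
    assert (G := continuous_put None (fun q : SP => q) f (x, k) (continuous_id _) Cc).
    apply filter_and.
    - apply (G Im). apply OI. change (Im (x, f (x, k))). rewrite Ek. exact HIm.
    - apply (G (fun q : SP => locally q (fun p => zeta p = zeta' p))).
      change (locally ((x, f (x, k)) : SP) (fun q => locally q (fun p : SP => zeta p = zeta' p))).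
      rewrite Ek. now apply locally_locally. }
  destruct LL as [r Hr]. set (N := ball ((x, k) : SP) r).
  assert (ON : open N) by apply ball_space_open.
  (* The parameter of the member of [f'] through a point of the graph of [f]. Once it is shown not
     to depend on the independent variables, its restriction to the fibre over [x] is the parameter
     change. *)
  set (kappa := fun q : SP => K (fst q, f q)).
  assert (NV : forall q, N q -> V q) by (intros q Hq; apply (Hr q Hq)).
  assert (NI : forall q, N q -> Im (fst q, f q)) by (intros q Hq; apply (Hr q Hq)).
  assert (Cf : forall n, CS n N f) by (intros n; apply CS_sub with V; auto).
  assert (Ck : forall n, CS n N kappa) by (intros n; apply (CS_graph n N Im); auto).
  assert (Dk : forall v q, N q -> pd v kappa q =
     param_flag v * fibre_inverse_pd p' r' f' v (fst q, f q) + pd v f q * / pd None f' (fst q, kappa q)).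
  { intros v q Hq. unfold kappa at 1. rewrite (pd_graph N Im) by auto.
    unfold K. rewrite !(fibre_inverse_pdE p' r' sigma f') by (auto; apply (NI q Hq)). reflexivity. }
  assert (KB : forall q, N q -> B' (fst q, kappa q) /\ f' (fst q, kappa q) = f q).
  { intros q Hq; exact (KS _ (NI q Hq)). }
  assert (Nf' : forall q, N q -> pd None f' (fst q, kappa q) <> 0) by (intros q Hq; apply HN', BV, KB, Hq).
  assert (D0 : forall a q, N q -> pd (Some a) kappa q = 0).
  { intros a q Hq. rewrite Dk by auto. unfold fibre_inverse_pd. fold K.
    change (fst (fst q, f q), K (fst q, f q)) with ((fst q, kappa q) : space).
    assert (Ea : pd (Some a) f q = pd (Some a) f' (fst q, kappa q)).
    { destruct (KB q Hq) as [H1 H2].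
      destruct (Hr q Hq) as (_ & _ & Lz).
      assert (A : a = i \/ a = other i) by (destruct a, i; auto). destruct A as [->| ->].
      - rewrite (invariant_family_pd F J i W zeta V f HI) by auto.
        rewrite (invariant_family_pd F J i W' zeta' V' f' HI') by auto.
        cbn [fst]. rewrite H2. apply (locally_singleton _ _ Lz).
      - rewrite (invariant_family_conj F J i W zeta V f HR HS HI) by auto.
        rewrite (invariant_family_conj F J i W' zeta' V' f' HR' HS' HI') by auto.
        cbn [fst]. rewrite H2. unfold conj_coef.
        rewrite !(pd_ext_loc _ _ _ _ Lz). reflexivity. }
    rewrite Ea. simpl param_flag.
    assert (X : forall a b : R, b <> 0 -> 1 * (- a / b) + a * / b = 0) by (intros; field; auto).
    apply X, Nf', Hq. }
  assert (Const : forall q, N q -> kappa q = kappa (x, snd q)).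
  { intros q Hq. apply (fibrewise_const (x, k) r kappa q); auto. }
  exists (fun t => kappa (x, t)), (fun t => Rabs (t - k) < r).
  assert (OI' : open (fun t => Rabs (t - k) < r)) by (intros t Ht; now apply locally_Rabs).
  assert (IN : forall t, Rabs (t - k) < r -> N (x, t)).
  { intros t Ht. apply (ball_put _ _ (x, k) None t (ball_center _ _) Ht). }
  split; [exact OI'|split; [|split; [|split; [|split]]]].
  - rewrite Rminus_eq_0, Rabs_R0; apply cond_pos.
  - apply (smooth_fibre N); auto.
  (* The derivative of the parameter change is [f_kappa / f'_kappa]. *)
  - intros t Ht. change (pd None kappa (x, t) <> 0). rewrite Dk by auto. simpl param_flag.
    assert (X : forall a b c : R, a <> 0 -> c <> 0 -> 0 * b + a * / c <> 0).
    { intros a b c Ha Hc0; rewrite Rmult_0_l, Rplus_0_l. apply Rmult_integral_contrapositive_currified; auto.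
      now apply Rinv_neq_0_compat. }
    apply X; [apply HN, NV, IN, Ht|apply Nf', IN, Ht].
  - change (K (x, f (x, k)) = k'). rewrite Ek. apply (fibre_inverse_unique p' r' sigma f'); auto.
  - exists r. intros q Hq. rewrite <- Const by exact Hq. apply KB, Hq.
Qed.

(** Differentiating [f' (x, theta kappa) = f (x, kappa)] in [x_i] does not touch [theta]: both
    families have the same value and the same [x_i] derivative, which are the arguments and values
    of [zeta] and [zeta']. *)
Lemma equivalent_operators_equal :
  equivalent_families_at x f k f' k' -> locally ((x, z) : SP) (fun p => zeta p = zeta' p).
Proof.
  intros (theta & I & HIo & HIk & Hth & _ & Etk & HL).
  destruct HS as (HV & Hf & HN & _). destruct HS' as (HV' & _ & _ & _).
  assert (Hc : continuous (pd None f) ((x, k) : SP)).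
  { eapply CS_cont; [apply CS_pd, (Hf 1%nat)|exact Hk]. }
  destruct (sign_ball V _ (x, k) HV Hk Hc (HN _ Hk)) as [r Hr].
  set (p := (x, k) : SP) in *. set (sigma := pd None f p) in *. set (B := ball p r).
  assert (Cf : forall n, CS n B f).
  { intros n; apply CS_sub with V; auto. intros q Hq; apply (Hr q Hq). }
  assert (Pos : forall q, B q -> 0 < sigma * pd None f q) by (intros q Hq; apply (Hr q Hq)).
  set (Im := image B f). set (K := fibre_inverse p r f).
  assert (OI : open Im) by now apply (image_open p r sigma f).
  assert (KS := fibre_inverse_spec p r f). fold B Im K in KS.
  assert (Bc : B p) by apply ball_center.
  assert (HIm : Im (x, z)) by (exists k; split; auto).
  assert (KE : K (x, z) = k) by (apply (fibre_inverse_unique p r sigma f); auto).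
  assert (CK : continuous K ((x, z) : SP)) by now apply (fibre_inverse_cont p r sigma f).
  assert (G := continuous_put None (fun q : SP => q) K (x, z) (continuous_id _) CK).
  assert (L1 : locally p (fun q : SP => V' (fst q, theta (snd q)))).
  { assert (Ct : continuous (fun q : SP => theta (snd q)) p).
    { apply (continuous_comp (fun q : SP => snd q) theta); [apply @continuous_snd_comp, @continuous_id|].
      apply (@ex_derive_continuous R_AbsRing R_NormedModule). now apply (Hth 1%nat). }
    apply (continuous_put None (fun q : SP => q) _ p (continuous_id _) Ct V'). apply HV'.
    change (V' (x, theta k)). now rewrite Etk. }
  assert (L2 := filter_and _ _ L1 (locally_locally _ _ HL)).
  (* Continuity of [K] pulls points near [(x, z)] back to points near [(x, k)], where the identity
     between the families is available; thus a full neighbourhood of [(x, z)] is covered. *)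
  assert (L3 : locally ((x, z) : SP) (fun q : SP => Im q /\ V' (fst q, theta (K q)) /\
      locally ((fst q, K q) : SP) (fun p : SP => f' (fst p, theta (snd p)) = f p))).
  { apply filter_and; [exact (OI _ HIm)|].
    apply (G (fun q : SP => V' (fst q, theta (snd q)) /\ locally q (fun p : SP => f' (fst p, theta (snd p)) = f p))).
    change (locally ((x, K (x, z)) : SP) (fun q : SP => V' (fst q, theta (snd q)) /\ locally q (fun p : SP => f' (fst p, theta (snd p)) = f p))).
    rewrite KE. exact L2. }
  revert L3; apply filter_imp. intros [y w] (HIq & HVq & Hq). cbn [fst] in HVq.
  destruct (KS _ HIq) as [KB KEq]. cbn [fst snd] in KB, KEq.
  set (t := K (y, w)) in *.
  assert (HVt : V (y, t)) by apply (Hr _ KB).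
  assert (E1 : pd (Some i) f (y, t) = zeta (y, w)).
  { rewrite (invariant_family_pd F J i W zeta V f HI) by auto. cbn [fst]. exact (f_equal (fun w => zeta (y, w)) KEq). }
  assert (E2 : pd (Some i) f' (y, theta t) = zeta' (y, w)).
  { rewrite (invariant_family_pd F J i W' zeta' V' f' HI') by auto. cbn [fst].
    assert (E := locally_singleton _ _ Hq). exact (f_equal (fun w => zeta' (y, w)) (eq_trans E KEq)). }
  rewrite <- E1, <- E2.
  transitivity (pd (Some i) (fun p : SP => f' (fst p, theta (snd p))) (y, t)); [|reflexivity].
  symmetry; now apply pd_ext_loc.
Qed.

End Equivalence.

Theorem theorem5 (J : R -> Prop) (F : R -> R)
    (J_open : open J) (F_smooth : smooth_line J F)
    (F_u : forall z, J z -> Derive F z <> 0) :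
  forall i : axis,
  (* every operator d_i + zeta d_u is, locally, assigned the family of its
     invariant solutions *)
  (forall W zeta, axis_reduction_operator F J i W zeta ->
     forall p, W p ->
     exists W' V f, open W' /\ W' p /\ subdomain W' W /\
       solution_family F J V f /\
       invariant_family F J (axis_field i zeta) W' V f) /\
  (* for every family the function f_{i kappa} is nonzero on an open dense part
     of the domain, where the family arises, locally, from such an operator *)
  (forall V f, solution_family F J V f ->
     open (nondegenerate i V f) /\ dense_in (nondegenerate i V f) V /\
     forall p, nondegenerate i V f p ->
     exists V' W zeta, open V' /\ V' p /\ subdomain V' V /\
       axis_reduction_operator F J i W zeta /\
       invariant_family F J (axis_field i zeta) W V' f) /\
  (* operators coincide iff the corresponding families are equivalent *)
  (forall W zeta V f W' zeta' V' f',
     axis_reduction_operator F J i W zeta ->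
     axis_reduction_operator F J i W' zeta' ->
     solution_family F J V f ->
     solution_family F J V' f' ->
     invariant_family F J (axis_field i zeta) W V f ->
     invariant_family F J (axis_field i zeta') W' V' f' ->
     forall (x : plane) (k k' z : R),
     V (x, k) -> f (x, k) = z -> V' (x, k') -> f' (x, k') = z ->
     (locally ((x, z) : space) (fun p => zeta p = zeta' p) <->
      equivalent_families_at x f k f' k')).
Proof.
  intros i; split; [|split].
  - intros W zeta HR p Hp; now apply (operator_has_family F J i W zeta).
  - intros V f HS; split; [now apply (nondegenerate_open F J)|split].
    + now apply (nondegenerate_dense F J).
    + intros p Hp; now apply (family_has_operator F J i V f).
  - intros W zeta V f W' zeta' V' f' HR HR' HS HS' HI HI' x k k' z Hk Ek Hk' Ek'; split.
    + now apply (equal_operators_equivalent F J i W zeta V f W' zeta' V' f').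
    + now apply (equivalent_operators_equal F J i W zeta V f W' zeta' V' f').
Qed.
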